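(* Let $\theta\in[0,1]$, let $H:\mathbb R^{2d}\to\mathbb R$, $f=-\frac{\partial H}{\partial Q}$, $g=\frac{\partial H}{\partial P}$, let $a,b\in\mathbb R^d$ be constant, and let $(P,Q)$ solve on $[0,T]$ $$dP_t=f(P_t,Q_t)\,dt+a\,dW_t,\qquad dQ_t=g(P_t,Q_t)\,dt+b\,dW_t$$ with deterministic initial value $(P_0,Q_0)\in\mathbb R^{2d}$. Assume $f,g$ are globally Lipschitz continuous, $f,g\in C^4(\mathbb R^{2d};\mathbb R^d)$, and $D^kf,D^kg$ for $k=2,3,4$ grow at most polynomially. Let $B$ be a Brownian motion independent of $W$ and let $U=(U_P,U_Q)=(U_{P,1},\dots,U_{P,d},U_{Q,1},\dots,U_{Q,d})$ be the solution, with $U(0)=0$, of the It\^o system, $i=1,\dots,d$, $$\begin{aligned} dU_{P,i}=&\Big[\big(\tfrac{\partial f^i}{\partial P}\big)^{\top}U_P+\big(\tfrac{\partial f^i}{\partial Q}\big)^{\top}U_Q\Big]dt+(\theta-\tfrac12)\Big[\big(\tfrac{\partial f^i}{\partial P}\big)^{\top}f-\big(\tfrac{\partial f^i}{\partial Q}\big)^{\top}g\Big]dt\\ &+\Big[(\tfrac12\theta^2-\tfrac14)a^{\top}\tfrac{\partial^2f^i}{\partial P^2}a+(\theta(1-\theta)-\tfrac12)a^{\top}\tfrac{\partial^2f^i}{\partial P\partial Q}b+(\tfrac12(1-\theta)^2-\tfrac14)b^{\top}\tfrac{\partial^2f^i}{\partial Q^2}b\Big]dt\\ &+(\theta-\tfrac12)\Big[\big(\tfrac{\partial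 f^i}{\partial P}\big)^{\top}a-\big(\tfrac{\partial f^i}{\partial Q}\big)^{\top}b\Big]dW_t-\tfrac{\sqrt3}{6}\Big[\big(\tfrac{\partial f^i}{\partial P}\big)^{\top}a+\big(\tfrac{\partial f^i}{\partial Q}\big)^{\top}b\Big]dB_t, \end{aligned}$$ and $dU_{Q,i}$ is given by the same expression with $f^i$ replaced by $g^i$ (the non-differentiated factors $f$, $g$ in the second bracket unchanged), all functions being evaluated at $(P_t,Q_t)$. Then $U$ has a Hamiltonian formulation: it satisfies $$d\begin{pmatrix} U_P \\ U_Q \end{pmatrix}=\begin{pmatrix}-\frac{\partial H_0}{\partial U_Q}\\ \frac{\partial H_0}{\partial U_P}\end{pmatrix}dt+\begin{pmatrix}-\frac{\partial H_1}{\partial U_Q}\\ \frac{\partial H_1}{\partial U_P}\end{pmatrix}\circ dW_t+\begin{pmatrix}-\frac{\partial H_2}{\partial U_Q}\\ \frac{\partial H_2}{\partial U_P}\end{pmatrix}\circ dB_t,$$ where, with all functions evaluated at $(P,Q)$, $$\begin{aligned} H_0=&\ \tfrac12U_P^{\top}\tfrac{\partial g}{\partial P}U_P-U_Q^{\top}\tfrac{\partial f}{\partial P}U_P-\tfrac12U_Q^{\top}\tfrac{\partial f}{\partial Q}U_Q\\ &+(\theta-\tfrac12)\sum_{i=1}^d\Big(\Big[\big(\tfrac{\partial g^i}{\partial P}\big)^{\top}f-\big(\tfrac{\partial g^i}{\partial Q}\big)^{\top}g\Big]U_{P,i}-\Big[\big(\tfrac{\partial f^i}{\partial P}\big)^{\top}f-\big(\tfrac{\partial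 f^i}{\partial Q}\big)^{\top}g\Big]U_{Q,i}\Big)\\ &-\sum_{i=1}^d\Big(\tfrac12\theta(1-\theta)a^{\top}\tfrac{\partial^2g^i}{\partial P^2}a-\big(\theta(1-\theta)-\tfrac12\big)a^{\top}\tfrac{\partial^2g^i}{\partial P\partial Q}b+\tfrac12\theta(1-\theta)b^{\top}\tfrac{\partial^2g^i}{\partial Q^2}b\Big)U_{P,i}\\ &+\sum_{i=1}^d\Big(\tfrac12\theta(1-\theta)a^{\top}\tfrac{\partial^2f^i}{\partial P^2}a-\big(\theta(1-\theta)-\tfrac12\big)a^{\top}\tfrac{\partial^2f^i}{\partial P\partial Q}b+\tfrac12\theta(1-\theta)b^{\top}\tfrac{\partial^2f^i}{\partial Q^2}b\Big)U_{Q,i},\\ H_1=&\ (\theta-\tfrac12)\sum_{i=1}^d\Big(\Big[\big(\tfrac{\partial g^i}{\partial P}\big)^{\top}a-\big(\tfrac{\partial g^i}{\partial Q}\big)^{\top}b\Big]U_{P,i}-\Big[\big(\tfrac{\partial f^i}{\partial P}\big)^{\top}a-\big(\tfrac{\partial f^i}{\partial Q}\big)^{\top}b\Big]U_{Q,i}\Big),\\ H_2=&-\tfrac{\sqrt3}{6}\sum_{i=1}^d\Big(\Big[\big(\tfrac{\partial g^i}{\partial P}\big)^{\top}a+\big(\tfrac{\partial g^i}{\partial Q}\big)^{\top}b\Big]U_{P,i}-\Big[\big(\tfrac{\partial f^i}{\partial P}\big)^{\top}a+\big(\tfrac{\partial f^i}{\partial Q}\big)^{\top}b\Big]U_{Q,i}\Big).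 \end{aligned}$$
   Context: $W$ is a one-dimensional Brownian motion on a complete filtered probability space; $B$ lives on an extension of that space. $\circ\,dW$, $\circ\,dB$ denote Stratonovich integrals. Write $f=(f^1,\dots,f^d)$, $g=(g^1,\dots,g^d)$. For scalar $\phi(P,Q)$, $\frac{\partial\phi}{\partial P},\frac{\partial\phi}{\partial Q}\in\mathbb R^d$ are gradient column vectors, $\frac{\partial^2\phi}{\partial P^2},\frac{\partial^2\phi}{\partial Q^2}$ Hessian blocks, $(\frac{\partial^2\phi}{\partial P\partial Q})_{jl}=\frac{\partial^2\phi}{\partial P_j\partial Q_l}$. For vector-valued $\phi$, $\frac{\partial\phi}{\partial P}$ is the Jacobian with entries $\partial\phi_i/\partial P_j$, similarly for $Q$. The functions $H_0,H_1,H_2$ are regarded as functions of $(U_P,U_Q)$ with $(P,Q)=(P_t,Q_t)$ as time-dependent random parameters; $\frac{\partial H_i}{\partial U_P},\frac{\partial H_i}{\partial U_Q}$ are gradients in those variables. *)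

(* Defs.v *)
From HB Require Import structures.
From mathcomp Require Import all_boot all_order all_algebra.
From mathcomp Require Import all_classical all_reals all_analysis.

Set Implicit Arguments.
Unset Strict Implicit.
Unset Printing Implicit Defensive.

Import Order.TTheory GRing.Theory Num.Theory.
Import numFieldNormedType.Exports.

Local Open Scope classical_set_scope.
Local Open Scope ring_scope.

Notation phase R d := ('cV[R]_d * 'cV[R]_d)%type.

Section calculus.
Context {R : realType} {d : nat}.
Implicit Types (phi : phase R d -> R) (F : phase R d -> 'cV[R]_d).
Implicit Types (x : phase R d) (u v : 'cV[R]_d).

Definition dot u v : R := (u^T *m v) 0 0.

Definition bilin u (M : 'M[R]_d) v : R := (u^T *m M *m v) 0 0.

(* inl j is the j-th P-direction, inr j the j-th Q-direction. *)
Definition basis (j : 'I_d + 'I_d) : phase R d :=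
  match j with
  | inl j => (delta_mx j 0, 0)
  | inr j => (0, delta_mx j 0)
  end.

Definition partial (j : 'I_d + 'I_d) phi : phase R d -> R :=
  fun x => 'D_(basis j) phi x.

Definition gradP phi x : 'cV[R]_d := \col_j partial (inl j) phi x.
Definition gradQ phi x : 'cV[R]_d := \col_j partial (inr j) phi x.

Definition hessPP phi x : 'M[R]_d :=
  \matrix_(j, l) partial (inl j) (partial (inl l) phi) x.
Definition hessPQ phi x : 'M[R]_d :=
  \matrix_(j, l) partial (inl j) (partial (inr l) phi) x.
Definition hessQQ phi x : 'M[R]_d :=
  \matrix_(j, l) partial (inr j) (partial (inr l) phi) x.

Definition fcomp F (i : 'I_d) : phase R d -> R := fun x => F x i 0.

Definition jacP F x : 'M[R]_d := \matrix_(i, j) partial (inl j) (fcomp F i) x.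
Definition jacQ F x : 'M[R]_d := \matrix_(i, j) partial (inr j) (fcomp F i) x.

Fixpoint class_C (k : nat) phi : Prop :=
  continuous phi /\
  match k with
  | 0 => True
  | k'.+1 => forall j, (forall x, derivable phi x (basis j)) /\
                       class_C k' (partial j phi)
  end.

Definition iter_partial (s : seq ('I_d + 'I_d)) phi : phase R d -> R :=
  foldr partial phi s.

Definition poly_growth phi : Prop :=
  exists (C : R) (q : nat), forall x, `|phi x| <= C * (1 + `|x| ^+ q).

Definition deriv_poly_growth (k : nat) F : Prop :=
  forall (i : 'I_d) (s : k.-tuple ('I_d + 'I_d)),
    poly_growth (iter_partial s (fcomp F i)).

End calculus.

Section stochastic.
Context {R : realType} {dd : measure_display} {Omega : measurableType dd}.
Context (P : probability Omega R) (F : R -> set (set Omega)) (T : R).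

Local Notation mu := (@lebesgue_measure R).

(* Only the values at times in [0, T] matter. *)
Definition process := R -> Omega -> R.

Implicit Types (X H Z I V : process).

Definition complete_filtration : Prop :=
  [/\ forall t, 0 <= t <= T -> sigma_algebra [set: Omega] (F t),
      forall t, 0 <= t <= T -> F t `<=` measurable,
      forall s t, 0 <= s -> s <= t -> t <= T -> F s `<=` F t &
      forall N, P.-negligible N -> F 0 N].

Definition adapted X : Prop :=
  forall t, 0 <= t <= T -> forall E : set R, measurable E -> F t (X t @^-1` E).

Definition as_continuous X : Prop :=
  {ae P, forall w, {within `[0, T], continuous (fun t => X t w)}}.

Definition increment X (s t : R) : Omega -> R := fun w => X t w - X s w.

(* Relative to the filtration F. When B lives on an extension of the space
   carrying W, F is the filtration of the extended space and W, B are both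
   Brownian motions for it. *)
Definition brownian_motion (W : process) : Prop :=
  [/\ {ae P, forall w, W 0 w = 0}, adapted W, as_continuous W,
      forall s t, 0 <= s -> s < t -> t <= T ->
        forall E : set R, measurable E ->
          P (increment W s t @^-1` E) = normal_prob 0 (Num.sqrt (t - s)) E &
      forall s t, 0 <= s -> s < t -> t <= T ->
        forall (A : set Omega) (E : set R), F s A -> measurable E ->
          P (A `&` (increment W s t @^-1` E)) =
          (P A * P (increment W s t @^-1` E))%E].

Definition process_sigma X : set (set Omega) :=
  <<s [set A | exists t (E : set R),
         [/\ 0 <= t <= T, measurable E & A = X t @^-1` E] ]>>.

Definition independent_processes X Z : Prop :=
  forall A C, process_sigma X A -> process_sigma Z C ->
    P (A `&` C) = (P A * P C)%E.

Definition cvg_in_prob (Y : nat -> Omega -> R) (Y0 : Omega -> R) : Prop :=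
  forall eps : R, 0 < eps ->
    (fun n => P [set w | eps <= `|Y n w - Y0 w|]) @ \oo --> 0%E.

(* H = \sum_(i < n) xi_i 1_{]t_i, t_{i+1}]} with xi_i bounded and
   F_{t_i}-measurable. *)
Record simple_process := SimpleProcess {
  sp_size : nat;
  sp_time : nat -> R;
  sp_val : nat -> Omega -> R;
  sp_time_ge0 : 0 <= sp_time 0;
  sp_time_mono : forall i, (i < sp_size)%N -> sp_time i <= sp_time i.+1;
  sp_time_leT : sp_time sp_size <= T;
  sp_val_meas : forall i, (i < sp_size)%N ->
    forall E : set R, measurable E -> F (sp_time i) (sp_val i @^-1` E);
  sp_val_bounded : forall i, (i < sp_size)%N ->
    exists M : R, forall w, `|sp_val i w| <= M }.

Definition sp_fun (h : simple_process) : process := fun t w =>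
  \sum_(i < sp_size h)
    sp_val h i w * \1_(`]sp_time h i, sp_time h i.+1] : set R) t.

Definition sp_integral (h : simple_process) Z : process := fun t w =>
  \sum_(i < sp_size h)
    sp_val h i w *
    (Z (Num.min t (sp_time h i.+1)) w - Z (Num.min t (sp_time h i)) w).

Definition ito_integrable H : Prop :=
  [/\ measurable_fun (`[0, T] `*` [set: Omega])
        (fun z : R * Omega => H z.1 z.2),
      adapted H &
      {ae P, forall w, (\int[mu]_(s in `[0%R, T]) ((H s w) ^+ 2)%:E < +oo)%E}].

(* I_t is the Ito integral of H against Z over [0, t] for all t in [0, T],
   as a limit in probability of integrals of simple processes. *)
Definition ito_integral H Z I : Prop :=
  [/\ ito_integrable H, adapted I, as_continuous I &
   exists h : nat -> simple_process,
    (forall eps : R, 0 < eps ->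
      (fun n => P [set w | (eps%:E <=
         \int[mu]_(s in `[0%R, T]) ((sp_fun (h n) s w - H s w) ^+ 2)%:E)%E])
        @ \oo --> 0%E) /\
    (forall t, 0 <= t <= T ->
      cvg_in_prob (fun n => sp_integral (h n) Z t) (I t))].

Definition mesh (t0 : R) (s : seq R) : R :=
  \big[Num.max/0]_(i < size s) (nth t0 s i - nth t0 (t0 :: s) i).

Definition covariation_sum (s : seq R) X Z : Omega -> R := fun w =>
  \sum_(i < size s)
    (X (nth 0 s i) w - X (nth 0 (0 :: s) i) w) *
    (Z (nth 0 s i) w - Z (nth 0 (0 :: s) i) w).

(* V = [X, Z]. *)
Definition covariation X Z V : Prop :=
  [/\ adapted V, as_continuous V &
    forall t, 0 <= t <= T -> forall s : nat -> seq R,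
      (forall n, itv_partition 0 t (s n)) ->
      (fun n => mesh 0 (s n)) @ \oo --> (0 : R) ->
      cvg_in_prob (fun n => covariation_sum (s n) X Z) (V t)].

(* H o dZ = H dZ + d[H, Z] / 2. *)
Definition stratonovich_integral H Z S : Prop :=
  exists I V, [/\ ito_integral H Z I, covariation H Z V &
                  forall t w, S t w = I t w + V t w / 2].

(* M is the sum of the integrals of H against Z over the pairs (H, Z) of l. *)
Fixpoint noise (integral : process -> process -> process -> Prop)
    (l : seq (process * process)) (M : process) : Prop :=
  match l with
  | [::] => forall t w, M t w = 0
  | (H, Z) :: l' => exists I N, [/\ integral H Z I, noise integral l' N &
                                    forall t w, M t w = I t w + N t w]
  end.

(* X solves dX = b dt + \sum_((H, Z) in l) H dZ with X_0 = x0, the stochastic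
   integrals being understood in the sense of the argument integral. *)
Definition solves (integral : process -> process -> process -> Prop)
    (X : process) (x0 : R) (b : process) (l : seq (process * process)) : Prop :=
  [/\ adapted X, as_continuous X,
      {ae P, forall w, mu.-integrable `[0, T] (EFin \o (fun s => b s w))} &
      exists M, noise integral l M /\
        {ae P, forall w, forall t, 0 <= t <= T ->
           X t w = x0 + \int[mu]_(s in `[0, t]) b s w + M t w}].

End stochastic.

Section coefficients.
Context {R : realType} {d : nat}.
Context (theta : R) (f g : phase R d -> 'cV[R]_d) (a b : 'cV[R]_d).
Implicit Types (phi : phase R d -> R) (x u : phase R d).

(* Coefficients of the Ito equation of the component attached to phi = f^i or
   phi = g^i, at x = (P, Q) and u = (U_P, U_Q). *)
Definition ito_drift phi x u : R :=
  (dot (gradP phi x) u.1 + dot (gradQ phi x) u.2)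
  + (theta - 1 / 2) * (dot (gradP phi x) (f x) - dot (gradQ phi x) (g x))
  + ((theta ^+ 2 / 2 - 1 / 4) * bilin a (hessPP phi x) a
     + (theta * (1 - theta) - 1 / 2) * bilin a (hessPQ phi x) b
     + ((1 - theta) ^+ 2 / 2 - 1 / 4) * bilin b (hessQQ phi x) b).

Definition ito_diffW phi x : R :=
  (theta - 1 / 2) * (dot (gradP phi x) a - dot (gradQ phi x) b).

Definition ito_diffB phi x : R :=
  - (Num.sqrt 3 / 6) * (dot (gradP phi x) a + dot (gradQ phi x) b).

(* ham0, ham1, ham2 are functions of u = (U_P, U_Q) with parameter x = (P, Q);
   their gradients in U_P and U_Q are gradP and gradQ in the argument u. *)

Definition ham0 x u : R :=
  bilin u.1 (jacP g x) u.1 / 2 - bilin u.2 (jacP f x) u.1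
  - bilin u.2 (jacQ f x) u.2 / 2
  + (theta - 1 / 2) * (\sum_(i < d)
      ((dot (gradP (fcomp g i) x) (f x) - dot (gradQ (fcomp g i) x) (g x))
         * u.1 i 0
       - (dot (gradP (fcomp f i) x) (f x) - dot (gradQ (fcomp f i) x) (g x))
         * u.2 i 0))
  - \sum_(i < d)
      (theta * (1 - theta) / 2 * bilin a (hessPP (fcomp g i) x) a
       - (theta * (1 - theta) - 1 / 2) * bilin a (hessPQ (fcomp g i) x) b
       + theta * (1 - theta) / 2 * bilin b (hessQQ (fcomp g i) x) b) * u.1 i 0
  + \sum_(i < d)
      (theta * (1 - theta) / 2 * bilin a (hessPP (fcomp f i) x) a
       - (theta * (1 - theta) - 1 / 2) * bilin a (hessPQ (fcomp f i) x) b
       + theta * (1 - theta) / 2 * bilin b (hessQQ (fcomp f i) x) b) * u.2 i 0.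

Definition ham1 x u : R :=
  (theta - 1 / 2) * (\sum_(i < d)
    ((dot (gradP (fcomp g i) x) a - dot (gradQ (fcomp g i) x) b) * u.1 i 0
     - (dot (gradP (fcomp f i) x) a - dot (gradQ (fcomp f i) x) b) * u.2 i 0)).

Definition ham2 x u : R :=
  - (Num.sqrt 3 / 6) * (\sum_(i < d)
    ((dot (gradP (fcomp g i) x) a + dot (gradQ (fcomp g i) x) b) * u.1 i 0
     - (dot (gradP (fcomp f i) x) a + dot (gradQ (fcomp f i) x) b) * u.2 i 0)).

End coefficients.

(* Main.v *)
(* With additive noise every coordinate of [X] is, almost surely, a Lipschitz path
   plus a multiple of [W]. Hence for a C^1 function [psi] and a Brownian motion [Z] the
   bracket of [psi(X)] and [Z] is [kappa * int (D psi)(c) ds], with [c = (a, b)] and with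
   [kappa = 1] for [Z = W] and [kappa = 0] for [Z = B]. It is computed by freezing
   [D psi (X)] on a fixed number of coarse blocks and estimating, in L^2, the defects
   [(W_t - W_s) (Z_t - Z_s) - kappa (t - s)], which are orthogonal. Thus only the [dW] terms
   are corrected when passing from Ito to Stratonovich form, and the corrected coefficients
   are derivatives of [H0], [H1], [H2] because [f] and [g] have a common potential and the
   mixed derivatives are symmetric. *)
Require Import Defs.
From HB Require Import structures.
From mathcomp Require Import all_boot all_order all_algebra.
From mathcomp Require Import all_classical all_reals all_analysis.
From mathcomp Require Import measurable_realfun ring lra.
Import Order.TTheory GRing.Theory Num.Theory.
Import numFieldNormedType.Exports.
Local Open Scope classical_set_scope.
Local Open Scope ring_scope.
Set Implicit Arguments.
Unset Strict Implicit.
Unset Printing Implicit Defensive.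

(** * Calculus on phase space *)

(** The covariation is a limit in probability along every sequence of deterministic partitions with
    vanishing mesh, while [psi] is merely of class C^1 there, with no moment bound on its
    derivatives along [X]. An L^2 estimate of the whole sum is therefore out of reach. Instead every
    path gets its own deterministic estimate: from some random rank on, the error is at most
    [e * (1 + Q n)], for every [e > 0], where [Q n >= 0] has expectation bounded in [n]. Dominated
    convergence and Markov's inequality turn this into convergence in probability. Freezing the
    derivatives on blocks bounds the random weights pathwise, so that moments are taken only of
    Brownian increments. A second obstacle lies in the equation of [X]: its stochastic integrals are
    known only as limits in probability of unspecified simple processes, so even the integral of a
    constant has to be identified. This is done by truncating the integrand, since its L^2 norm
    tends to zero only in probability. *)

Lemma dist_le_split (R : realType) (V : normedModType R) (p q r : V) (e : R) :
  `|p - r| <= e / 2 -> `|q - r| <= e / 2 -> `|p - q| <= e.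
Proof.
move=> pr qr; rewrite [leRHS]splitr -(subrKA r) (le_trans (ler_normD _ _))//.
by rewrite lerD// distrC.
Qed.

Section phase_calculus.
Context {R : realType} {d : nat}.
Local Notation I := ('I_d + 'I_d)%type.
Local Notation axis := Defs.basis.
Implicit Types (phi : phase R d -> R) (x y v : phase R d) (j l : I).

Definition pcoord (j : I) (x : phase R d) : R :=
  match j with inl j => x.1 j 0 | inr j => x.2 j 0 end.

Lemma pcoordD j x y : pcoord j (x + y) = pcoord j x + pcoord j y.
Proof. by case: j => j /=; rewrite mxE. Qed.

Lemma pcoordN j x : pcoord j (- x) = - pcoord j x.
Proof. by case: j => j /=; rewrite mxE. Qed.

Lemma pcoordB j x y : pcoord j (x - y) = pcoord j x - pcoord j y.
Proof. by rewrite pcoordD pcoordN. Qed.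

Lemma pcoordZ j (k : R) x : pcoord j (k *: x) = k * pcoord j x.
Proof. by case: j => j /=; rewrite mxE. Qed.

Lemma pcoord_axis l j : pcoord l (axis j) = (l == j)%:R.
Proof.
case: l j => l [] j /=; rewrite ?mxE ?eqxx ?andbT //=.
Qed.

Lemma pcoordP x y : (forall j, pcoord j x = pcoord j y) -> x = y.
Proof.
case: x y => [x1 x2] [y1 y2] h; congr pair; apply/colP => j.
  exact: (h (inl j)).
exact: (h (inr j)).
Qed.

Lemma norm_coord_le j x : `|pcoord j x| <= `|x|.
Proof.
rewrite prod_normE le_max; case: j => j /=; apply/orP; [left|right];
 rewrite [leRHS]/Num.Def.normr/= mx_normrE; exact: (le_bigmax _ _ (j, 0)).
Qed.

Lemma norm_le_coord (r : R) x :
  0 <= r -> (forall j, `|pcoord j x| <= r) -> `|x| <= r.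
Proof.
move=> r0 h; rewrite prod_normE ge_max; apply/andP; split;
  rewrite [leLHS]/Num.Def.normr/= mx_normrE; apply: bigmax_le => // -[i k] _;
  rewrite (ord1 k).
  exact: (h (inl i)).
exact: (h (inr i)).
Qed.

Lemma is_derive_line phi x v (s : R) : derivable phi (x + s *: v) v ->
  is_derive s (1 : R) (fun t : R => phi (x + t *: v)) ('D_v phi (x + s *: v)).
Proof.
have E : (fun h : R => h^-1 *: (((fun t : R => phi (x + t *: v)) \o shift s) (h *: (1 : R))
   - phi (x + s *: v))) = (fun h => h^-1 *: ((phi \o shift (x + s *: v)) (h *: v) - phi (x + s *: v))).
  apply/funext => h /=; congr (_ *: (phi _ - _)).
  by rewrite [h *: 1]mulr1 scalerDl addrCA.
by move=> dphi; apply: DeriveDef; [rewrite /derivable E|rewrite /derive E].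
Qed.

Lemma line_continuous phi x v : continuous phi ->
  continuous (fun t : R => phi (x + t *: v)).
Proof.
move=> cphi t; apply: continuous_comp; last exact: cphi.
by apply: cvgD; [exact: cvg_cst|apply: cvgZr_tmp; exact: cvg_id].
Qed.

(** Both signs of [s] are covered at once, which is why the intermediate point is located only by
    [|u| <= |s|]. *)
Lemma MVT_line phi x v (s : R) : continuous phi ->
  (forall y, derivable phi y v) ->
  exists2 u : R, `|u| <= `|s| & phi (x + s *: v) - phi x = 'D_v phi (x + u *: v) * s.
Proof.
move=> cphi dphi.
pose g t := phi (x + t *: v).
have dg t : is_derive t (1 : R) g ('D_v phi (x + t *: v)) by exact: is_derive_line.
have cg (A : set R) : {within A, continuous g}.
  exact/continuous_subspaceT/line_continuous.
have g0 : phi x = g 0 by rewrite /g scale0r addr0.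
rewrite g0 -/(g s); have [s0|s0] := leP 0 s.
  have [u us ->] := MVT_segment s0 (fun t _ => dg t) (cg _).
  exists u; last by rewrite subr0.
  by move: us; rewrite in_itv/= => /andP[u0 us]; rewrite !ger0_norm.
have [u us E] := MVT_segment (ltW s0) (fun t _ => dg t) (cg _).
exists u; last by rewrite -[LHS]opprB E sub0r mulrN opprK.
move: us; rewrite in_itv/= => /andP[us u0].
by rewrite !ler0_norm ?lerN2// ltW.
Qed.

Lemma class_C_continuous k phi : class_C k phi -> continuous phi.
Proof. by case: k => [|k] []. Qed.

Lemma class_C_derivable k phi j x : class_C k.+1 phi -> derivable phi x (axis j).
Proof. by move=> [_ /(_ j)[]]. Qed.

Lemma class_C_partial k phi j : class_C k.+1 phi -> class_C k (partial j phi).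
Proof. by move=> [_ /(_ j)[]]. Qed.

Lemma class_CW k phi : class_C k.+1 phi -> class_C k phi.
Proof.
elim: k phi => [|k ih] phi [cphi h]; first by split.
by split => // j; have [dphi hj] := h j; split => //; exact: ih.
Qed.

Lemma class_C_cst k (r : R) : class_C k (fun _ : phase R d => r).
Proof.
elim: k r => [|k ih] r; split => //=; try by move=> ?; exact: cvg_cst.
move=> j; split; first by move=> x; exact: derivable_cst.
have -> : partial j (fun=> r) = fun=> 0.
  by apply/funext => x; rewrite /partial derive_cst.
exact: ih.
Qed.

Lemma partialD j phi psi x : derivable phi x (axis j) -> derivable psi x (axis j) ->
  partial j (fun y => phi y + psi y) x = partial j phi x + partial j psi x.
Proof. exact: deriveD. Qed.

Lemma partialZ j (r : R) phi x : derivable phi x (axis j) ->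
  partial j (fun y => r * phi y) x = r * partial j phi x.
Proof. by move=> h; rewrite /partial (deriveZ r h). Qed.

Lemma class_CD k phi psi : class_C k phi -> class_C k psi ->
  class_C k (fun y => phi y + psi y).
Proof.
elim: k phi psi => [|k ih] phi psi [c1 h1] [c2 h2]; split => //=;
  try by move=> x; apply: cvgD; [exact: c1|exact: c2].
move=> j; have [d1 e1] := h1 j; have [d2 e2] := h2 j; split.
  by move=> x; exact: (derivableD (d1 x) (d2 x)).
have -> : partial j (fun y => phi y + psi y) = fun y => partial j phi y + partial j psi y.
  by apply/funext => x; rewrite partialD.
exact: ih.
Qed.

Lemma class_CZ k r phi : class_C k phi -> class_C k (fun y => r * phi y).
Proof.
elim: k phi => [|k ih] phi [c1 h1]; split => //=;
  try by move=> x; apply: cvgM; [exact: cvg_cst|exact: c1].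
move=> j; have [d1 e1] := h1 j; split.
  by move=> x; exact: derivableZ.
have -> : partial j (fun y => r * phi y) = fun y => r * partial j phi y.
  by apply/funext => x; rewrite partialZ.
exact: ih.
Qed.

Lemma class_C_sum k (J : Type) (s : seq J) (F : J -> phase R d -> R) :
  (forall i, class_C k (F i)) -> class_C k (fun y => \sum_(i <- s) F i y).
Proof.
move=> h; elim: s => [|i s ih].
  have -> : (fun y => \sum_(i <- [::]) F i y) = fun=> 0.
    by apply/funext => y; rewrite big_nil.
  exact: class_C_cst.
have -> : (fun y => \sum_(i <- i :: s) F i y) = fun y => F i y + \sum_(i <- s) F i y.
  by apply/funext => y; rewrite big_cons.
exact: class_CD.
Qed.

Lemma derivable_sumf (J : Type) (s : seq J) (F : J -> phase R d -> R) x v :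
  (forall i, derivable (F i) x v) ->
  derivable (fun y => \sum_(i <- s) F i y) x v.
Proof.
move=> h; elim: s => [|i s ih].
  have -> : (fun y => \sum_(i <- [::]) F i y) = fun=> 0.
    by apply/funext => y; rewrite big_nil.
  exact: derivable_cst.
have -> : (fun y => \sum_(i <- i :: s) F i y) = fun y => F i y + \sum_(i <- s) F i y.
  by apply/funext => y; rewrite big_cons.
exact: derivableD.
Qed.

Lemma partial_sum j (J : Type) (s : seq J) (F : J -> phase R d -> R) x :
  (forall i, derivable (F i) x (axis j)) ->
  partial j (fun y => \sum_(i <- s) F i y) x = \sum_(i <- s) partial j (F i) x.
Proof.
move=> h; elim: s => [|i s ih].
  have -> : (fun y => \sum_(i <- [::]) F i y) = fun=> 0.
    by apply/funext => y; rewrite big_nil.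
  by rewrite big_nil /partial derive_cst.
have -> : (fun y => \sum_(i <- i :: s) F i y) = fun y => F i y + \sum_(i <- s) F i y.
  by apply/funext => y; rewrite big_cons.
by rewrite partialD// ?big_cons ?ih//; exact: derivable_sumf.
Qed.

(* Moving along one coordinate axis at a time, only partial derivatives enter. *)
Lemma MVT_partial phi x y : class_C 1 phi ->
  exists xi : I -> phase R d, (forall j, `|xi j - x| <= `|y - x|) /\
    phi y - phi x = \sum_j partial j phi (xi j) * pcoord j (y - x).
Proof.
move=> C1; have cphi := class_C_continuous C1.
(* [z s] is [x] with the coordinates in [s] moved to those of [y]. Running through all coordinates
   leads from [x] to [y], and every intermediate point stays in the sup-norm ball of radius
   [|y - x|] around [x]. *)
pose z (s : seq I) : phase R d := x + \sum_(j <- s) pcoord j (y - x) *: axis j.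
have coordz l s : uniq s -> pcoord l (z s - x) = (l \in s)%:R * pcoord l (y - x).
  rewrite /z addrAC subrr add0r; elim: s => [|j s ih] /=.
    by rewrite big_nil mul0r; case: l => l; rewrite /= mxE.
  move=> /andP[js us]; rewrite big_cons [LHS]pcoordD pcoordZ pcoord_axis ih// in_cons.
  have [->|_] /= := eqVneq l j; last by rewrite mulr0 add0r.
  by rewrite (negbTE js) mul0r addr0 mulr1 mul1r.
have step s : uniq s -> exists xi : I -> phase R d, (forall j, `|xi j - x| <= `|y - x|) /\
    phi (z s) - phi x = \sum_(j <- s) partial j phi (xi j) * pcoord j (y - x).
  elim: s => [|j s ih] /=.
    by exists (fun=> x); split=> [j|]; rewrite ?subrr ?normr0// /z !big_nil addr0 subrr.
  move=> /andP[js us]; have [xi [xi1 xi2]] := ih us.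
  have [u us1 E] := @MVT_line phi (z s) (axis j) (pcoord j (y - x)) cphi
    (fun y => class_C_derivable (x := y) (j := j) C1).
  exists (fun l => if l == j then z s + u *: axis j else xi l); split.
    move=> l; case: eqP => // _; apply: norm_le_coord => // k.
    rewrite addrAC pcoordD pcoordZ pcoord_axis coordz//.
    have [->|_] := eqVneq k j.
      by rewrite (negbTE js) mul0r add0r mulr1 (le_trans us1)// norm_coord_le.
    rewrite mulr0 addr0 normrM (le_trans _ (norm_coord_le k _))//.
    by case: (k \in s); rewrite ?normr1 ?mul1r// normr0 mul0r.
  rewrite big_cons eqxx; have -> : z (j :: s) = z s + pcoord j (y - x) *: axis j.
    by rewrite /z big_cons -addrA [_ + \sum_(_ <- _) _]addrC.
  rewrite -(subrK (phi (z s)) (phi (z s + _))) -addrA E xi2 /partial; congr (_ + _).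
  rewrite !big_seq; apply: eq_bigr => l ls; case: eqP => // lj.
  by rewrite -lj ls in js.
have [xi [xi1 xi2]] := step _ (enum_uniq {: I}).
exists xi; split => //; rewrite -big_enum -xi2; congr (phi _ - _).
apply: pcoordP => j; apply: (addIr (- pcoord j x)).
by rewrite -!pcoordB coordz ?enum_uniq// mem_enum mul1r.
Qed.

(** The mean value theorem is applied along axis [i] to the first difference in direction [j], then
    along axis [j] to the partial derivative so obtained. The left-hand side is symmetric in [i] and
    [j], which is what the symmetry of mixed derivatives rests on. *)
Lemma second_difference phi x i j (h : R) : class_C 2 phi ->
  exists u u' : R, [/\ `|u| <= `|h|, `|u'| <= `|h| &
    phi (x + h *: axis j + h *: axis i) - phi (x + h *: axis i)
      - (phi (x + h *: axis j) - phi x)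
    = partial j (partial i phi) (x + u *: axis i + u' *: axis j) * h * h].
Proof.
move=> C2; have C1 := class_CW C2.
pose D y := phi (y + h *: axis j) - phi y.
have dphi y := class_C_derivable (x := y) (j := i) C1.
have sh y : derivable (fun z => phi (z + h *: axis j)) y (axis i) /\
   'D_(axis i) (fun z => phi (z + h *: axis j)) y = partial i phi (y + h *: axis j).
  have E : (fun k => k^-1 *: (((fun z => phi (z + h *: axis j)) \o shift y) (k *: axis i) - phi (y + h *: axis j)))
   = (fun k => k^-1 *: ((phi \o shift (y + h *: axis j)) (k *: axis i) - phi (y + h *: axis j))).
    by apply/funext => k /=; rewrite addrA.
  by rewrite /derivable /partial /derive E; split => //; exact: dphi.
have dD y : derivable D y (axis i) by apply: derivableB => //; exact: (sh y).1.
have cD : continuous D.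
  move=> y; apply: cvgB; last exact: (class_C_continuous C1).
  apply: continuous_comp; last exact: (class_C_continuous C1).
  by apply: cvgD; [exact: cvg_id|exact: cvg_cst].
have [u uh E] := MVT_line x h cD dD.
have DE : 'D_(axis i) D (x + u *: axis i) =
   partial i phi (x + u *: axis i + h *: axis j) - partial i phi (x + u *: axis i).
  by rewrite deriveB ?(sh _).2//; exact: (sh _).1.
have C1i := class_C_partial i C2.
have [u' u'h E'] := MVT_line (x + u *: axis i) h (class_C_continuous C1i)
   (fun y => class_C_derivable (x := y) (j := j) C1i).
exists u, u'; split => //.
rewrite /partial in E' DE; rewrite E' in DE; rewrite DE in E.
by rewrite -[RHS]E /D; congr (phi _ - _ - _); rewrite addrAC.
Qed.

(** Evaluating the same second difference in both orders makes the two mixed derivatives agree at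
    two points close to [x]; their continuity at [x] does the rest. *)
Lemma partialC phi i j x : class_C 2 phi ->
  partial i (partial j phi) x = partial j (partial i phi) x.
Proof.
move=> C2; apply/eqP; rewrite -subr_eq0 -normr_le0; apply/ler_addgt0Pr => e e0.
rewrite add0r.
have c1 := class_C_continuous (class_C_partial j (class_C_partial i C2)).
have c2 := class_C_continuous (class_C_partial i (class_C_partial j C2)).
have e2 : 0 < e / 2 by rewrite divr_gt0.
have /cvgrPdist_le/(_ _ e2) := c1 x; have /cvgrPdist_le/(_ _ e2) := c2 x.
move=> /nbhs_normP[r1 /= r10 h1] /nbhs_normP[r2 /= r20 h2].
pose r := Num.min r1 r2; have r0 : 0 < r by rewrite lt_min r10.
(* The evaluation points are at distance at most [2 h] from [x], so [r / 3] keeps them strictly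
   inside the ball of radius [r]. *)
pose h := r / 3; have h0 : 0 < h by rewrite divr_gt0.
have close (u u' : R) i' j' : `|u| <= `|h| -> `|u'| <= `|h| ->
    `|x - (x + u *: axis i' + u' *: axis j')| < r.
  move=> uh u'h; rewrite opprD opprD addrA addrA subrr sub0r -opprD normrN.
  have h2r : h + h < r by rewrite /h; lra.
  apply: le_lt_trans h2r; rewrite (gtr0_norm h0) in uh u'h.
  apply: norm_le_coord; first by rewrite addr_ge0// ltW.
  move=> k; rewrite pcoordD !pcoordZ (le_trans (ler_normD _ _))// lerD//;
  by rewrite normrM pcoord_axis; case: eqP; rewrite ?normr1 ?mulr1// normr0 mulr0 ltW.
have [u [u' [uh u'h E1]]] := second_difference x i j h C2.
have [w [w' [wh w'h E2]]] := second_difference x j i h C2.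
have E : partial j (partial i phi) (x + u *: axis i + u' *: axis j) =
         partial i (partial j phi) (x + w *: axis j + w' *: axis i).
  have hh : h * h != 0 by rewrite mulf_neq0 ?gt_eqF.
  have AC (p q r3 r4 : R) : p - q - (r3 - r4) = p - r3 - (q - r4) by ring.
  rewrite -mulrA in E1; rewrite -mulrA in E2; apply: (mulIf hh).
  apply: (etrans (esym E1)); apply: (etrans _ E2).
  by rewrite (addrAC x (h *: axis i)); exact: AC.
apply: (@dist_le_split _ _ _ _ (partial i (partial j phi) (x + w *: axis j + w' *: axis i))).
  by apply: h1; apply: lt_le_trans (close _ _ _ _ wh w'h) _; rewrite /r ge_min lexx.
rewrite -E; apply: h2.
by apply: lt_le_trans (close _ _ _ _ uh u'h) _; rewrite /r ge_min lexx orbT.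
Qed.

(** The Hamiltonians are polynomials of degree at most two in [u]. Their gradients are read off an
    exact expansion, with no product rule for matrices. *)
Lemma derive_quadratic (q : phase R d -> R) u v (L K : R) :
  (forall h : R, q (h *: v + u) = q u + h * L + h ^+ 2 * K) -> 'D_v q u = L.
Proof.
move=> E; apply/cvg_lim => //.
have : (fun h : R => L + h * K) @ 0^' --> L.
  rewrite -[X in _ --> X]addr0 -[X in _ + X](mul0r K).
  apply: cvgD; first exact: cvg_cst.
  by apply: cvgM; [exact: nbhs_dnbhs|exact: cvg_cst].
apply: cvg_trans; apply: near_eq_cvg; near=> h.
rewrite /= E; have h0 : h != 0 by near: h; exact: nbhs_dnbhs_neq.
by rewrite /GRing.scale/=; field.
Unshelve. all: by end_near. Qed.

End phase_calculus.

(** * The Hamiltonians and the Ito correction *)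

(** The heart is the pair of identities th^2/2 - 1/4 = - th(1-th)/2 + (th - 1/2)/2 and (1-th)^2/2 -
    1/4 = - th(1-th)/2 - (th - 1/2)/2: the Ito and the Hamiltonian weights of the pure second
    derivatives differ by half the Ito correction, and those of the mixed one agree. *)
Lemma drift_algebra_f (R : realType) (th eP eQ pp pq qq dP dQ S1 S2 : R) :
  dP = S1 -> dQ = S2 ->
  (dP + dQ) + (th - 1 / 2) * (eP - eQ)
  + ((th ^+ 2 / 2 - 1 / 4) * pp + (th * (1 - th) - 1 / 2) * pq
     + ((1 - th) ^+ 2 / 2 - 1 / 4) * qq) =
  - (- S1 - (S2 + S2) / 2 - (th - 1 / 2) * (eP - eQ)
     + (th * (1 - th) / 2 * pp - (th * (1 - th) - 1 / 2) * pq
        + th * (1 - th) / 2 * qq))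
  + (th - 1 / 2) * (pp - qq) / 2.
Proof. by move=> -> ->; field. Qed.

Lemma drift_algebra_g (R : realType) (th eP eQ pp pq qq dP dQ S1 S2 : R) :
  dP = S1 -> dQ = - S2 ->
  (dP + dQ) + (th - 1 / 2) * (eP - eQ)
  + ((th ^+ 2 / 2 - 1 / 4) * pp + (th * (1 - th) - 1 / 2) * pq
     + ((1 - th) ^+ 2 / 2 - 1 / 4) * qq) =
  (S1 + S1) / 2 - S2 + (th - 1 / 2) * (eP - eQ)
  - (th * (1 - th) / 2 * pp - (th * (1 - th) - 1 / 2) * pq
     + th * (1 - th) / 2 * qq)
  + (th - 1 / 2) * (pp - qq) / 2.
Proof. by move=> -> ->; field. Qed.

Section hamiltonians.
Context {R : realType} {d : nat}.
Local Notation I := ('I_d + 'I_d)%type.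
Local Notation axis := Defs.basis.
Implicit Types (phi : phase R d -> R) (x u : phase R d) (v w : 'cV[R]_d) (j l : I).

Lemma big_sum_I (F : I -> R) : \sum_j F j = \sum_j F (inl j) + \sum_j F (inr j).
Proof. by rewrite big_sumType. Qed.

Lemma dotE v w : dot v w = \sum_j v j 0 * w j 0.
Proof. by rewrite /dot mxE; apply: eq_bigr => j _; rewrite mxE. Qed.

Lemma bilinE v (M : 'M[R]_d) w : bilin v M w = \sum_j \sum_l v j 0 * M j l * w l 0.
Proof.
rewrite /bilin -mulmxA mxE; apply: eq_bigr => j _; rewrite !mxE mulr_sumr.
by apply: eq_bigr => l _; rewrite mulrA.
Qed.

Lemma bilinDl (h : R) v v' (M : 'M[R]_d) w :
  bilin (h *: v + v') M w = h * bilin v M w + bilin v' M w.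
Proof. by rewrite /bilin linearP /= !mulmxDl -!scalemxAl !mxE. Qed.

Lemma bilinDr (h : R) v (M : 'M[R]_d) w w' :
  bilin v M (h *: w + w') = h * bilin v M w + bilin v M w'.
Proof. by rewrite /bilin mulmxDr -scalemxAr !mxE. Qed.

Lemma sum_delta (F : 'I_d -> R) i : \sum_j F j * (delta_mx i 0 : 'cV[R]_d) j 0 = F i.
Proof.
rewrite (bigD1 i)//= mxE !eqxx mulr1 big1 ?addr0// => j ji.
by rewrite mxE (negbTE ji) mulr0.
Qed.

Lemma bilin_deltal i (M : 'M[R]_d) w : bilin (delta_mx i 0) M w = \sum_l M i l * w l 0.
Proof.
rewrite bilinE -[RHS](sum_delta (fun i => \sum_l M i l * w l 0)).
apply: eq_bigr => j _; rewrite mulr_suml; apply: eq_bigr => l _.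
by ring.
Qed.

Lemma bilin_deltar i (M : 'M[R]_d) v : bilin v M (delta_mx i 0) = \sum_l v l 0 * M l i.
Proof. by rewrite bilinE; apply: eq_bigr => j _; rewrite (sum_delta (fun k : 'I_d => v j 0 * M j k)). Qed.

Lemma sum_shift (F : 'I_d -> R) (h : R) i v :
  \sum_j F j * (h *: (delta_mx i 0 : 'cV[R]_d) + v) j 0 = h * F i + \sum_j F j * v j 0.
Proof.
rewrite -(sum_delta F) mulr_sumr -big_split/=; apply: eq_bigr => j _.
by rewrite !mxE mulrDr mulrCA.
Qed.

(** Density of the bracket of the [dW] coefficient with [W]; half of it is the difference between
    the two drifts. *)
Definition ito_correction (theta : R) (a b : 'cV[R]_d) phi x : R :=
  (theta - 1 / 2) * (bilin a (hessPP phi x) a - bilin b (hessQQ phi x) b).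

(** A single sum over all phase coordinates lets the lemmas on sums of C^k functions apply; the sign
    of the Q block is carried by [(a, - b)]. *)
Lemma ito_diffWE (theta : R) (a b : 'cV[R]_d) phi :
  ito_diffW theta a b phi =
  fun x => (theta - 1 / 2) * \sum_l pcoord l (a, - b) * partial l phi x.
Proof.
apply/funext => x; rewrite /ito_diffW big_sum_I !dotE; congr (_ * (_ + _)).
  by apply: eq_bigr => j _; rewrite mxE mulrC.
by rewrite -sumrN; apply: eq_bigr => j _; rewrite /= !mxE mulNr mulrC.
Qed.

Lemma ito_diffBE (a b : 'cV[R]_d) phi :
  ito_diffB a b phi =
  fun x => - (Num.sqrt 3 / 6) * \sum_l pcoord l (a, b) * partial l phi x.
Proof.
apply/funext => x; rewrite /ito_diffB big_sum_I !dotE; congr (_ * (_ + _));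
by apply: eq_bigr => j _; rewrite mxE mulrC.
Qed.

Lemma class_C_ito_diffW k (theta : R) (a b : 'cV[R]_d) phi :
  class_C k.+1 phi -> class_C k (ito_diffW theta a b phi).
Proof.
move=> C; rewrite ito_diffWE; apply: class_CZ; apply: class_C_sum => l.
by apply: class_CZ; exact: class_C_partial.
Qed.

Lemma class_C_ito_diffB k (a b : 'cV[R]_d) phi :
  class_C k.+1 phi -> class_C k (ito_diffB a b phi).
Proof.
move=> C; rewrite ito_diffBE; apply: class_CZ; apply: class_C_sum => l.
by apply: class_CZ; exact: class_C_partial.
Qed.

(* The mixed terms cancel by symmetry. *)
Lemma sum_sym_signed (D : I -> I -> R) (v w : 'cV[R]_d) : (forall j l, D j l = D l j) ->
  \sum_j (\sum_l pcoord l (v, - w) * D j l) * pcoord j (v, w) =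
  \sum_j \sum_l v j 0 * D (inl j) (inl l) * v l 0
  - \sum_j \sum_l w j 0 * D (inr j) (inr l) * w l 0.
Proof.
move=> Dsym; under eq_bigr do rewrite big_sum_I mulrDl.
rewrite big_split/= !big_sum_I /=.
have -> : \sum_(i < d) (\sum_(j < d) (- w) j 0 * D (inl i) (inr j)) * v i 0 =
  - \sum_(i < d) (\sum_(j < d) v j 0 * D (inr i) (inl j)) * w i 0.
  rewrite -sumrN; under eq_bigr do rewrite mulr_suml.
  under [RHS]eq_bigr do rewrite mulr_suml -sumrN.
  rewrite exchange_big /=; apply: eq_bigr => i _; apply: eq_bigr => j _.
  by rewrite mxE Dsym; ring.
rewrite addrA addrK; congr (_ + _).
  by apply: eq_bigr => i _; rewrite mulr_suml; apply: eq_bigr => l _; rewrite Dsym; ring.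
rewrite -sumrN; apply: eq_bigr => i _; rewrite mulr_suml -sumrN; apply: eq_bigr => l _.
by rewrite !mxE Dsym; ring.
Qed.

Lemma partial_ito_diffW (theta : R) (a b : 'cV[R]_d) phi x j : class_C 2 phi ->
  partial j (ito_diffW theta a b phi) x =
    (theta - 1 / 2) * \sum_l pcoord l (a, - b) * partial j (partial l phi) x.
Proof.
move=> C2; have dp l : derivable (partial l phi) x (axis j).
  exact: (class_C_derivable (class_C_partial l C2)).
rewrite ito_diffWE partialZ; last by apply: derivable_sumf => l; exact: derivableZ.
rewrite partial_sum; last by move=> l; exact: derivableZ.
by congr (_ * _); apply: eq_bigr => l _; rewrite partialZ.
Qed.

Lemma ito_diffW_derivative (theta : R) (a b : 'cV[R]_d) phi x : class_C 2 phi ->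
  \sum_j partial j (ito_diffW theta a b phi) x * pcoord j (a, b) =
  ito_correction theta a b phi x.
Proof.
move=> C2; under eq_bigr do rewrite partial_ito_diffW// -mulrA.
rewrite -mulr_sumr; congr (_ * _).
rewrite (sum_sym_signed (D := fun j l => partial j (partial l phi) x)); last first.
  by move=> j l; exact: partialC.
rewrite !bilinE; congr (_ - _); apply: eq_bigr => i _; apply: eq_bigr => l _;
by rewrite [in RHS]mxE.
Qed.

(** Common shape of [ham1], [ham2] and of the linear part of [ham0]. The minus sign makes [- gradQ]
    return [lQ] itself. *)
Definition linear_form (lP lQ : 'I_d -> R) u : R :=
  \sum_(i < d) (lP i * u.1 i 0 - lQ i * u.2 i 0).

Lemma linear_formE lP lQ u : linear_form lP lQ u =
  \sum_i lP i * u.1 i 0 - \sum_i lQ i * u.2 i 0.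
Proof. by rewrite /linear_form sumrB. Qed.

Lemma linear_form_shift_inl lP lQ (h : R) i u :
  linear_form lP lQ (h *: axis (inl i) + u) = linear_form lP lQ u + h * lP i.
Proof. by rewrite !linear_formE /= scaler0 add0r sum_shift; ring. Qed.

Lemma linear_form_shift_inr lP lQ (h : R) i u :
  linear_form lP lQ (h *: axis (inr i) + u) = linear_form lP lQ u - h * lQ i.
Proof. by rewrite !linear_formE /= scaler0 add0r sum_shift; ring. Qed.

Lemma gradP_linear_form (k : R) lP lQ u i :
  gradP (fun u => k * linear_form lP lQ u) u i 0 = k * lP i.
Proof.
rewrite mxE; apply: (@derive_quadratic _ _ _ _ _ _ 0) => h.
by rewrite linear_form_shift_inl; ring.
Qed.

Lemma gradQ_linear_form (k : R) lP lQ u i :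
  gradQ (fun u => k * linear_form lP lQ u) u i 0 = - (k * lQ i).
Proof.
rewrite mxE; apply: (@derive_quadratic _ _ _ _ _ _ 0) => h.
by rewrite linear_form_shift_inr; ring.
Qed.

(** Arranged to be convertible with [ham0] at a frozen [x], as [ham0E] checks. *)
Definition quadratic_form (A B C : 'M[R]_d) (k : R) (lP lQ mP mQ : 'I_d -> R) u : R :=
  bilin u.1 A u.1 / 2 - bilin u.2 B u.1 - bilin u.2 C u.2 / 2
  + k * linear_form lP lQ u
  - \sum_(i < d) mP i * u.1 i 0 + \sum_(i < d) mQ i * u.2 i 0.

(** [A] is not assumed symmetric here, so its row and its column both appear. The existence of a
    potential merges them later. *)
Lemma gradP_quadratic_form A B C k lP lQ mP mQ u i :
  gradP (quadratic_form A B C k lP lQ mP mQ) u i 0 =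
  (\sum_l A i l * u.1 l 0 + \sum_l u.1 l 0 * A l i) / 2
  - \sum_l u.2 l 0 * B l i + k * lP i - mP i.
Proof.
rewrite mxE; apply: (@derive_quadratic _ _ _ _ _ _ (A i i / 2)) => h.
rewrite /quadratic_form linear_form_shift_inl /= scaler0 add0r sum_shift.
rewrite !(bilinDl, bilinDr) !bilin_deltal !bilin_deltar sum_delta.
by ring.
Qed.

Lemma gradQ_quadratic_form A B C k lP lQ mP mQ u i :
  gradQ (quadratic_form A B C k lP lQ mP mQ) u i 0 =
  - (\sum_l B i l * u.1 l 0)
  - (\sum_l C i l * u.2 l 0 + \sum_l u.2 l 0 * C l i) / 2
  - k * lQ i + mQ i.
Proof.
rewrite mxE; apply: (@derive_quadratic _ _ _ _ _ _ (- C i i / 2)) => h.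
rewrite /quadratic_form linear_form_shift_inr /= scaler0 add0r sum_shift.
rewrite !(bilinDl, bilinDr) !bilin_deltal !bilin_deltar sum_delta.
by ring.
Qed.

Variables (theta : R) (H : phase R d -> R) (f g : phase R d -> 'cV[R]_d) (a b : 'cV[R]_d).

Definition strat_quad phi x : R :=
  theta * (1 - theta) / 2 * bilin a (hessPP phi x) a
  - (theta * (1 - theta) - 1 / 2) * bilin a (hessPQ phi x) b
  + theta * (1 - theta) / 2 * bilin b (hessQQ phi x) b.

Definition drift_diff phi x : R := dot (gradP phi x) (f x) - dot (gradQ phi x) (g x).

Lemma ham0E x : ham0 theta f g a b x =
  quadratic_form (jacP g x) (jacP f x) (jacQ f x) (theta - 1 / 2)
    (fun i => drift_diff (fcomp g i) x) (fun i => drift_diff (fcomp f i) x)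
    (fun i => strat_quad (fcomp g i) x) (fun i => strat_quad (fcomp f i) x).
Proof. by []. Qed.

Lemma gradQ_ham1 x u i : - gradQ (ham1 theta f g a b x) u i 0 =
  ito_diffW theta a b (fcomp f i) x.
Proof. by apply: (canLR (@opprK _)); exact: gradQ_linear_form. Qed.

Lemma gradP_ham1 x u i : gradP (ham1 theta f g a b x) u i 0 =
  ito_diffW theta a b (fcomp g i) x.
Proof. exact: gradP_linear_form. Qed.

Lemma gradQ_ham2 x u i : - gradQ (ham2 f g a b x) u i 0 =
  ito_diffB a b (fcomp f i) x.
Proof. by apply: (canLR (@opprK _)); exact: gradQ_linear_form. Qed.

Lemma gradP_ham2 x u i : gradP (ham2 f g a b x) u i 0 =
  ito_diffB a b (fcomp g i) x.
Proof. exact: gradP_linear_form. Qed.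

Hypothesis H_diff : forall x, differentiable H x.
Hypothesis f_def : forall x, f x = - gradQ H x.
Hypothesis g_def : forall x, g x = gradP H x.
Hypothesis f_C1 : forall i, class_C 1 (fcomp f i).
Hypothesis g_C1 : forall i, class_C 1 (fcomp g i).

Lemma fcomp_fE i : fcomp f i = fun x => -1 * partial (inr i) H x.
Proof. by apply/funext => x; rewrite /fcomp f_def !mxE mulN1r. Qed.

Lemma fcomp_gE i : fcomp g i = partial (inl i) H.
Proof. by apply/funext => x; rewrite /fcomp g_def !mxE. Qed.

(** [H] is only assumed differentiable; the additional regularity is inherited from its partial
    derivatives, which are the components of [g] and of [- f]. *)
Lemma H_class_C2 : class_C 2 H.
Proof.
split; first by move=> x; exact: differentiable_continuous.
move=> j; split; first by move=> x; exact: diff_derivable.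
case: j => i.
  by rewrite -fcomp_gE.
have -> : partial (inr i) H = fun x => -1 * fcomp f i x.
  by apply/funext => x; rewrite fcomp_fE mulN1r mulN1r opprK.
exact: class_CZ.
Qed.

Lemma partial_fcomp_f j i x : partial j (fcomp f i) x = - partial j (partial (inr i) H) x.
Proof.
rewrite fcomp_fE partialZ ?mulN1r//.
exact: (class_C_derivable (class_C_partial _ H_class_C2)).
Qed.

Lemma jacQ_f_sym x (i l : 'I_d) : jacQ f x l i = jacQ f x i l.
Proof. by rewrite !mxE !partial_fcomp_f (partialC _ _ _ H_class_C2). Qed.

Lemma jacP_g_sym x (i l : 'I_d) : jacP g x l i = jacP g x i l.
Proof. by rewrite !mxE !fcomp_gE (partialC _ _ _ H_class_C2). Qed.

(** This relation between the two Jacobians is why the single cross term of [ham0], built from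
    [jacP f], yields the right linear drift in both equations. *)
Lemma jacQ_g x (i l : 'I_d) : jacQ g x i l = - jacP f x l i.
Proof. by rewrite !mxE partial_fcomp_f fcomp_gE opprK (partialC _ _ _ H_class_C2). Qed.

Lemma ito_drift_f x u i : ito_drift theta f g a b (fcomp f i) x u =
  - gradQ (ham0 theta f g a b x) u i 0 + ito_correction theta a b (fcomp f i) x / 2.
Proof.
have E1 : dot (gradP (fcomp f i) x) u.1 = \sum_l jacP f x i l * u.1 l 0.
  by rewrite dotE; apply: eq_bigr => l _; rewrite !mxE.
have E2 : dot (gradQ (fcomp f i) x) u.2 = \sum_l jacQ f x i l * u.2 l 0.
  by rewrite dotE; apply: eq_bigr => l _; rewrite !mxE.
have E3 : \sum_l u.2 l 0 * jacQ f x l i = \sum_l jacQ f x i l * u.2 l 0.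
  by apply: eq_bigr => l _; rewrite jacQ_f_sym mulrC.
rewrite ham0E gradQ_quadratic_form E3.
exact: (drift_algebra_f _ _ _ _ _ _ E1 E2).
Qed.

Lemma ito_drift_g x u i : ito_drift theta f g a b (fcomp g i) x u =
  gradP (ham0 theta f g a b x) u i 0 + ito_correction theta a b (fcomp g i) x / 2.
Proof.
have E1 : dot (gradP (fcomp g i) x) u.1 = \sum_l jacP g x i l * u.1 l 0.
  by rewrite dotE; apply: eq_bigr => l _; rewrite !mxE.
have E2 : dot (gradQ (fcomp g i) x) u.2 = - \sum_l u.2 l 0 * jacP f x l i.
  rewrite dotE -sumrN; apply: eq_bigr => l _.
  by rewrite -mulrN -jacQ_g mulrC !mxE.
have E3 : \sum_l u.1 l 0 * jacP g x l i = \sum_l jacP g x i l * u.1 l 0.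
  by apply: eq_bigr => l _; rewrite jacP_g_sym mulrC.
rewrite ham0E gradP_quadratic_form E3.
exact: (drift_algebra_g _ _ _ _ _ _ E1 E2).
Qed.

End hamiltonians.

(** * Gaussian moments *)

Lemma normal_pdf_val (R : realType) (s x : R) : s != 0 ->
  normal_pdf 0 s x = normal_peak s * normal_fun 0 s x.
Proof. by move=> s0; rewrite normal_pdfE. Qed.

Section gaussian.
Context {R : realType}.
Local Notation mu := (@lebesgue_measure R).
Variable s : R.
Hypothesis s0 : 0 < s.
Local Notation N := (normal_prob (0 : R) s).
Local Notation pdf := (normal_pdf (0 : R) s).
Local Notation e := (normal_fun (0 : R) s).

Let sn0 : s != 0. Proof. by rewrite gt_eqF. Qed.

(** Change of measure goes through the Radon-Nikodym derivative, which equals the Gaussian density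
    almost everywhere because both have the same integral over every measurable set. *)
Lemma ge0_integral_normal (f : R -> R) : (forall x, 0 <= f x) ->
  measurable_fun setT f ->
  (\int[N]_x (f x)%:E = \int[mu]_x (f x * pdf x)%:E)%E.
Proof.
move=> f0 mf; have dom := @normal_prob_dominates R 0 s.
rewrite -(Radon_Nikodym_SigmaFinite.change_of_variables dom)//=; last exact/measurable_EFinP.
apply: ae_eq_integral => //.
- apply: emeasurable_funM; first exact/measurable_EFinP.
  exact: measurable_int (Radon_Nikodym_SigmaFinite.f_integrable dom).
- apply/measurable_EFinP/measurable_funM => //; exact: measurable_normal_pdf.
under [X in ae_eq _ _ _ X]eq_fun do rewrite EFinM.
apply: ae_eqe_mul2l; apply: integral_ae_eq => //.
- exact: Radon_Nikodym_SigmaFinite.f_integrable.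
- by apply/measurable_EFinP; exact: measurable_normal_pdf.
- by move=> A _ mA; rewrite -Radon_Nikodym_SigmaFinite.f_integral.
Qed.

Lemma normal_fun_even x : e (- x) = e x.
Proof. by rewrite /normal_fun !subr0 sqrrN. Qed.

Lemma continuous_normal_fun : continuous e.
Proof.
move=> x; apply: continuous_comp; last exact: continuous_expR.
apply: cvgM; last exact: cvg_cst.
apply: cvgN; apply: cvgM; apply: cvgB; try exact: cvg_id; exact: cvg_cst.
Qed.

Let G (x : R) : R := - (s ^+ 2 * (x * e x)).

Let dG (x : R) : is_derive x (1 : R) G ((x ^+ 2 - s ^+ 2) * e x).
Proof.
have h : is_derive x (1 : R) (fun x : R => - (x - 0) ^+ 2 / (s ^+ 2 *+ 2)) (- x / s ^+ 2).
  have -> : (fun x : R => - (x - 0) ^+ 2 / (s ^+ 2 *+ 2)) =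
      (- (s ^+ 2 *+ 2)^-1) *: (fun y : R => y ^+ 2 : R^o).
    by apply/funext => y; rewrite subr0 fctE/= /GRing.scale/=; ring. 
  have h2 : is_derive x (1 : R) (fun y : R => y ^+ 2) (2%:R *: x ^+ 1 *: (1 : R)).
    by apply: DeriveDef; [exact: exprn_derivable|exact: exp_derive].
  apply: is_derive_eq.
  by rewrite /GRing.scale/= -mulr_natr; field.
rewrite /G.
have he : is_derive x (1 : R) e (e x * (- x / s ^+ 2)).
  exact: (@is_derive1_comp _ expR _ _ _ _ (is_derive_expR _) h).
have -> : (fun x => - (s ^+ 2 * (x * e x))) = (- s ^+ 2) *: ((@id R : R -> R^o) * (e : R -> R^o)).
  by apply/funext => y; rewrite -mulNr.
apply: is_derive_eq.
by rewrite /GRing.scale/=; field.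
Qed.

Let cG : continuous G.
Proof.
by move=> x; apply/differentiable_continuous/derivable1_diffP; have [] := dG x.
Qed.

Let G_cvg : G x @[x --> +oo%R] --> (0 : R).
Proof.
(* From u exp(-u) <= 1 at u = x^2 / (2 s^2) one gets [x * |G x| <= K] for [x > 0], hence decay like
   [K / x]. *)
pose K := s ^+ 2 * (2 * s ^+ 2).
have K0 : 0 < K by rewrite !mulr_gt0 ?exprn_gt0.
apply/cvgr0Pnorm_le => eps eps0; near=> x.
have x0 : 0 < x by near: x; apply: nbhs_pinfty_gt; rewrite num_real.
have xK : K / eps <= x by near: x; apply: nbhs_pinfty_ge; rewrite num_real.
rewrite /G normrN ger0_norm; last by rewrite !mulr_ge0 ?sqr_ge0 ?expR_ge0// ltW.
rewrite ler_pdivrMr// in xK; rewrite -(ler_pM2l x0); apply: le_trans xK.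
rewrite mulrCA /K ler_wpM2l ?sqr_ge0// mulrA -expr2.
have : (x ^+ 2 / (s ^+ 2 *+ 2)) * e x <= 1.
  rewrite /normal_fun subr0 mulNr expRN ler_pdivrMr ?expR_gt0// mul1r.
  by rewrite (le_trans _ (expR_ge1Dx _))// lerDr.
by rewrite mulrAC ler_pdivrMr ?pmulrn_lgt0 ?exprn_gt0// mul1r mulr_natl.
Unshelve. all: by end_near. Qed.

Let c_x2e : continuous (fun x : R => x ^+ 2 * e x).
Proof.
move=> x; apply: cvgM; last exact: continuous_normal_fun.
exact: exprn_continuous.
Qed.

Let c_s2e : continuous (fun x : R => s ^+ 2 * e x).
Proof. by move=> x; apply: cvgM; [exact: cvg_cst|exact: continuous_normal_fun]. Qed.

Let meas (h : R -> R) A : continuous h -> measurable_fun A (EFin \o h).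
Proof.
move=> ch; apply/measurable_EFinP; apply: measurable_funTS.
exact: continuous_measurable_fun.
Qed.

Let intD (A : set R) (h1 h2 h3 : R -> R) : measurable A ->
  continuous h1 -> continuous h2 ->
  (forall x, A x -> 0 <= h1 x) -> (forall x, A x -> 0 <= h2 x) ->
  (forall x, h3 x = h1 x + h2 x) ->
  (\int[mu]_(x in A) (h3 x)%:E =
   \int[mu]_(x in A) (h1 x)%:E + \int[mu]_(x in A) (h2 x)%:E)%E.
Proof.
move=> mA c1 c2 h10 h20 E.
have h10' x : A x -> (0 <= (EFin \o h1) x)%E by move=> /h10; rewrite lee_fin.
have h20' x : A x -> (0 <= (EFin \o h2) x)%E by move=> /h20; rewrite lee_fin.
rewrite -(@ge0_integralD _ _ _ mu A mA _ _ h10' (meas c1) h20' (meas c2)).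
by apply: eq_integral => x _; rewrite E.
Qed.

(* The primitive [G] of [(x^2 - s^2) e x] vanishes at [0] and at infinity;
   splitting at [s] keeps all integrands nonnegative. *)
Let half_line : (\int[mu]_(x in `[0%R, +oo[) (x ^+ 2 * e x)%:E =
  \int[mu]_(x in `[0%R, +oo[) (s ^+ 2 * e x)%:E)%E.
Proof.
have x2e0 x : 0 <= x ^+ 2 * e x by rewrite mulr_ge0 ?sqr_ge0 ?expR_ge0.
have s2e0 x : 0 <= s ^+ 2 * e x by rewrite mulr_ge0 ?sqr_ge0 ?expR_ge0.
have cd1 : continuous (fun x : R => (x ^+ 2 - s ^+ 2) * e x).
  move=> x; apply: cvgM; last exact: continuous_normal_fun.
  by apply: cvgB; [exact: exprn_continuous|exact: cvg_cst].
have cd2 : continuous (fun x : R => (s ^+ 2 - x ^+ 2) * e x).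
  move=> x; apply: cvgM; last exact: continuous_normal_fun.
  by apply: cvgB; [exact: cvg_cst|exact: exprn_continuous].
have pos1 x : `[s, +oo[%classic x -> 0 <= (x ^+ 2 - s ^+ 2) * e x.
  rewrite /= in_itv/= andbT => sx; rewrite mulr_ge0 ?expR_ge0//.
  by rewrite subr_ge0 ler_sqr ?nnegrE// ltW// (lt_le_trans s0).
have pos2 x : `[0, s]%classic x -> 0 <= (s ^+ 2 - x ^+ 2) * e x.
  rewrite /= in_itv/= => /andP[x0 xs]; rewrite mulr_ge0 ?expR_ge0//.
  by rewrite subr_ge0 ler_sqr ?nnegrE// ltW.
have up : (\int[mu]_(x in `[s, +oo[) (x ^+ 2 * e x)%:E =
    (- G s)%:E + \int[mu]_(x in `[s, +oo[) (s ^+ 2 * e x)%:E)%E.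
  have <- : (\int[mu]_(x in `[s, +oo[) ((x ^+ 2 - s ^+ 2) * e x)%:E = (- G s)%:E)%E.
    rewrite (@ge0_continuous_FTC2y _ _ G _ 0)//.
    - by rewrite sub0e.
    - by move=> x sx; apply: pos1; rewrite /= in_itv/= andbT.
    - exact: continuous_subspaceT.
    - exact/cvg_at_right_filter/cG.
    - by move=> x _; rewrite derive1E; have [_ ->] := dG x.
  by apply: intD => // x; rewrite mulrBl subrK.
have lo : (\int[mu]_(x in `[0%R, s]) (s ^+ 2 * e x)%:E =
    (- G s)%:E + \int[mu]_(x in `[0%R, s]) (x ^+ 2 * e x)%:E)%E.
  have <- : (\int[mu]_(x in `[0%R, s]) ((s ^+ 2 - x ^+ 2) * e x)%:E = (- G s)%:E)%E.
    have dN x : is_derive x (1 : R) (\- G) (- ((x ^+ 2 - s ^+ 2) * e x)).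
      exact: is_deriveN.
    rewrite (@continuous_FTC2 _ _ (\- G))//.
    - by have -> : (\- G) 0 = 0 by [rewrite /= /G mul0r mulr0 !oppr0]; rewrite sube0.
    - exact: continuous_subspaceT.
    - split; first by move=> x _; have [] := dN x.
      + by apply: cvgN; exact/cvg_at_right_filter/cG.
      + by apply: cvgN; exact/cvg_at_left_filter/cG.
    - by move=> x _; rewrite derive1E; have [_ ->] := dN x; rewrite -mulNr opprB.
  by apply: intD => // x; rewrite mulrBl subrK.
have split_at (h : R -> R) : continuous h -> (forall x, 0 <= h x) ->
  (\int[mu]_(x in `[0%R, +oo[) (h x)%:E =
   \int[mu]_(x in `[0%R, s]) (h x)%:E + \int[mu]_(x in `[s, +oo[) (h x)%:E)%E.
  move=> ch h0; rewrite -integral_itv_bndo_bndc; last exact: meas.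
  rewrite -ge0_integral_setU//=.
  - by rewrite -itv_bndbnd_setU// bnd_simp ltW.
  - exact: meas.
  - by move=> x _; rewrite lee_fin.
  - apply/disj_setPS => x /= []; rewrite !in_itv/= andbT => /andP[_ xs] sx.
    by rewrite ltNge sx in xs.
by rewrite split_at// [RHS]split_at// up lo addeCA addeA.
Qed.

(** Both the integrand and the density are even. On the half line the factor [x ^+ 2] may be traded
    for the constant [s ^+ 2] by [half_line], after which only the total mass of the density is
    left. *)
Lemma integral_normal_sqr : (\int[N]_x (x ^+ 2)%:E = (s ^+ 2)%:E)%E.
Proof.
rewrite ge0_integral_normal; last 2 first.
- by move=> x; exact: sqr_ge0.
- by apply: continuous_measurable_fun; exact: exprn_continuous.
have sym (h : R -> R) : continuous h -> (forall x, 0 <= h x) -> (forall x, h (- x) = h x) ->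
    (\int[mu]_x (h x)%:E = 2%:E * \int[mu]_(x in `[0%R, +oo[) (h x)%:E)%E.
  move=> ch h0 hN; rewrite (ge0_symfun_integralT h0 ch) ?set_itvcy// => x /=; by rewrite hN.
have p0 := @normal_peak_ge0 R s.
have E (h : R -> R) : continuous h -> (forall x, 0 <= h x) -> (forall x, h (- x) = h x) ->
  (\int[mu]_x (h x * pdf x)%:E =
   (normal_peak s)%:E * (2%:E * \int[mu]_(x in `[0%R, +oo[) (h x * e x)%:E))%E.
  move=> ch h0 hN.
  have che : continuous (fun x => h x * e x).
    by move=> x; apply: cvgM; [exact: ch|exact: continuous_normal_fun].
  rewrite -sym//; last 2 first.
  - by move=> x; rewrite mulr_ge0 ?expR_ge0.
  - by move=> x; rewrite hN normal_fun_even.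
  rewrite -ge0_integralZl ?lee_fin//; last 2 first.
  - exact: meas.
  - by move=> x _; rewrite lee_fin mulr_ge0 ?expR_ge0.
  by apply: eq_integral => x _; rewrite -EFinM normal_pdf_val// mulrCA.
rewrite E; last 3 first.
- exact: exprn_continuous.
- by move=> x; exact: sqr_ge0.
- by move=> x; rewrite sqrrN.
rewrite half_line -(E (fun=> s ^+ 2)); last 3 first.
- by move=> x; exact: cvg_cst.
- by move=> x; exact: sqr_ge0.
- by [].
under eq_integral do rewrite EFinM.
rewrite integralZl//; last exact: integrable_normal_pdf.
by rewrite integral_normal_pdf mule1.
Qed.

End gaussian.

Lemma normrM_le_sqrD (R : realDomainType) (x y : R) : `|x * y| <= x ^+ 2 + y ^+ 2.
Proof. by rewrite ler_norml; apply/andP; split; nra. Qed.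

Section square_integrable.
Context dd (T : measurableType dd) (R : realType) (Q : probability T R).
Implicit Types X Y : T -> R.

Lemma integrable_mul_sqr X Y : measurable_fun setT X -> measurable_fun setT Y ->
  (\int[Q]_w (X w ^+ 2)%:E < +oo)%E -> (\int[Q]_w (Y w ^+ 2)%:E < +oo)%E ->
  Q.-integrable setT (fun w => (X w * Y w)%:E).
Proof.
move=> mX mY X2 Y2.
have mX2 : measurable_fun setT (fun w => X w ^+ 2) by exact: measurable_funX.
have mY2 : measurable_fun setT (fun w => Y w ^+ 2) by exact: measurable_funX.
have iX : Q.-integrable setT (fun w => (X w ^+ 2)%:E).
  apply/integrableP; split; first exact/measurable_EFinP.
  by under eq_integral do rewrite /= ger0_norm ?sqr_ge0//.
have iY : Q.-integrable setT (fun w => (Y w ^+ 2)%:E).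
  apply/integrableP; split; first exact/measurable_EFinP.
  by under eq_integral do rewrite /= ger0_norm ?sqr_ge0//.
apply: le_integrable (integrableD _ iX iY) => //.
  by apply/measurable_EFinP; exact: measurable_funM.
move=> w _ /=; rewrite lee_fin (le_trans (normrM_le_sqrD _ _))//.
exact: ler_norm.
Qed.

Lemma integrable_sqr X : measurable_fun setT X ->
  (\int[Q]_w (X w ^+ 2)%:E < +oo)%E -> Q.-integrable setT (fun w => (X w)%:E).
Proof.
move=> mX X2.
have : Q.-integrable setT (fun w => (X w * 1)%:E).
  apply: (@integrable_mul_sqr X (fun=> 1)) => //.
  rewrite integral_cst// expr1n mul1e.
  by have := @probability_setT _ _ _ Q => /= ->; exact: ltry.
by under eq_fun do rewrite mulr1.
Qed.

End square_integrable.

Section gaussian_moments.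
Context {R : realType}.
Local Notation mu := (@lebesgue_measure R).
Variable s : R.
Hypothesis s0 : 0 < s.
Local Notation N := (normal_prob (0 : R) s).

(** The integrand is dominated by a multiple of the density of standard deviation [Num.sqrt 2 * s].
    With t = x^2 / (4 s^2) one has x^4 = 16 s^4 t^2 and exp(-2t) = exp(-t) exp(-t), while t^2
    exp(-t) <= 2. The factors 16 and 2, and the ratio of the normalizing constants, give 32 sqrt
    2. *)
Lemma integral_normal_pow4 :
  (\int[N]_x (x ^+ 4)%:E <= (32 * Num.sqrt 2 * (s ^+ 2) ^+ 2)%:E)%E.
Proof.
have q0 : 0 < Num.sqrt 2 * s by rewrite mulr_gt0 ?sqrtr_gt0.
rewrite ge0_integral_normal//; last by move=> x; rewrite exprn_even_ge0.
pose c := 32 * Num.sqrt 2 * (s ^+ 2) ^+ 2.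
have -> : c%:E = (\int[mu]_x (c * normal_pdf 0 (Num.sqrt 2 * s) x)%:E)%E.
  under eq_integral do rewrite EFinM.
  rewrite integralZl//; last exact: integrable_normal_pdf.
  by rewrite integral_normal_pdf mule1.
have c0 : 0 <= c by rewrite /c mulr_ge0 ?sqr_ge0// mulr_ge0 ?sqrtr_ge0.
apply: ge0_le_integral => //.
- move=> x _; rewrite lee_fin mulr_ge0 ?normal_pdf_ge0//.
  by rewrite exprn_even_ge0.
- apply/measurable_EFinP/measurable_funM; last exact: measurable_normal_pdf.
  by apply: continuous_measurable_fun; exact: exprn_continuous.
- apply/measurable_EFinP/measurable_funM => //; exact: measurable_normal_pdf.
move=> x _; rewrite lee_fin !normal_pdf_val ?gt_eqF// /normal_peak /normal_fun !subr0.
have -> : (Num.sqrt 2 * s) ^+ 2 = 2 * s ^+ 2 by rewrite exprMn sqr_sqrtr.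
have -> : Num.sqrt (2 * s ^+ 2 * pi *+ 2) = Num.sqrt 2 * Num.sqrt (s ^+ 2 * pi *+ 2).
  by rewrite -sqrtrM//; congr Num.sqrt; ring.
pose t := x ^+ 2 / (4 * s ^+ 2).
have s2 : 0 < s ^+ 2 by rewrite exprn_gt0.
have t0 : 0 <= t by rewrite divr_ge0 ?sqr_ge0// mulr_ge0// ltW.
have e1 : - x ^+ 2 / (s ^+ 2 *+ 2) = - t + - t.
  by rewrite /t -mulr_natr; field; rewrite gt_eqF.
have e2 : - x ^+ 2 / (2 * s ^+ 2 *+ 2) = - t.
  by rewrite /t -mulr_natr; field; rewrite gt_eqF.
rewrite [X in _ * (_ * expR X) <= _]e1 [X in _ <= _ * (_ * expR X)]e2.
have x4 : x ^+ 4 = 16 * (s ^+ 2) ^+ 2 * t ^+ 2 by rewrite /t; field; rewrite gt_eqF.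
have key : t ^+ 2 * expR (- t) <= 2.
  rewrite expRN ler_pdivrMr ?expR_gt0//.
  have := @expR_ge1Dxn R t 1 t0; have -> : (2`!)%N = 2%N by [].
  move: (expR t) (t ^+ 2) => ? ?; lra.
rewrite expRD x4 invfM; set p := (Num.sqrt _)^-1; set q := Num.sqrt 2.
have q0' : q != 0 by rewrite gt_eqF// sqrtr_gt0.
have -> : c * (q^-1 * p * expR (- t)) = 16 * (s ^+ 2) ^+ 2 * (p * expR (- t)) * 2.
  by rewrite /c -/q; field.
have -> : 16 * (s ^+ 2) ^+ 2 * t ^+ 2 * (p * (expR (- t) * expR (- t))) =
  16 * (s ^+ 2) ^+ 2 * (p * expR (- t)) * (t ^+ 2 * expR (- t)) by ring.
apply: ler_wpM2l => //.
apply: mulr_ge0; first by rewrite mulr_ge0 ?sqr_ge0.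
by rewrite mulr_ge0 ?expR_ge0// /p invr_ge0 sqrtr_ge0.
Qed.

(** Reflection exchanges the positive and the negative part, and their common integral is finite, so
    the difference is zero. *)
Lemma integral_normal_id : (\int[N]_x (x : R)%:E = 0)%E.
Proof.
have iN : (N : probability _ _).-integrable setT (fun x : R => (x : R)%:E).
  apply: (@integrable_sqr _ _ _ (N : probability _ _) (fun x : R => x)) => //.
  by rewrite (integral_normal_sqr s0) ltry.
have opp (h : R -> R) : (forall x, 0 <= h x) -> measurable_fun setT h ->
    (\int[mu]_x (h (- x))%:E = \int[mu]_x (h x)%:E)%E.
  move=> h0 mh.
  have mN : measurable_fun setT (-%R : measurableTypeR R -> measurableTypeR R) by exact: oppr_measurable.
  have := @ge0_integral_pushforward _ _ (measurableTypeR R) (measurableTypeR R) R _ mN mu setT (EFin \o h)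
    measurableT.
  rewrite preimage_setT => <-//.
  - by apply: eq_measure_integral => A mA _; exact: lebesgue_measureN.
  - exact/measurable_EFinP.
  - by move=> x _; rewrite lee_fin.
have mM : measurable_fun setT (fun x : R => Num.max x 0) by exact: measurable_maxr.
have mMN : measurable_fun setT (fun x : R => Num.max (- x) 0).
  by apply: measurable_maxr => //; exact: oppr_measurable.
have pos : (\int[N]_x (Num.max x 0)%:E \is a fin_num)%E.
  apply: integrable_fin_num => //; apply: le_integrable iN => //.
    exact/measurable_EFinP.
  move=> x _ /=; rewrite lee_fin [leLHS]ger0_norm ?le_max ?lexx ?orbT//.
  by rewrite ge_max ler_norm normr_ge0.
have neg : (\int[N]_x (Num.max (- x) 0)%:E = \int[N]_x (Num.max x 0)%:E)%E.
  rewrite !ge0_integral_normal//; try by move=> x; rewrite le_max lexx orbT.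
  rewrite -(@opp (fun x => Num.max x 0 * normal_pdf 0 s x)); last 2 first.
  - by move=> x; rewrite mulr_ge0 ?normal_pdf_ge0// le_max lexx orbT.
  - by apply: measurable_funM => //; exact: measurable_normal_pdf.
  apply: eq_integral => x _.
  by rewrite !normal_pdf_val ?gt_eqF// normal_fun_even.
rewrite integralE.
have -> : (\int[N]_x (((fun x : R => (x : R)%:E)^\+)%E x) = \int[N]_x (Num.max x 0)%:E)%E.
  by apply: eq_integral => x _; rewrite funeposE EFin_max.
have -> : (\int[N]_x (((fun x : R => (x : R)%:E)^\-)%E x) = \int[N]_x (Num.max (- x) 0)%:E)%E.
  by apply: eq_integral => x _; rewrite funenegE EFin_max.
by rewrite neg subee.
Qed.

End gaussian_moments.

(** * Expectation and convergence in probability *)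

Section expectation.
Context dd (T : measurableType dd) (R : realType) (P : probability T R).
Implicit Types X Y : T -> R.

(* The joint law of two independent variables is the product of their laws. *)
Lemma expectation_independent X Y : measurable_fun setT X -> measurable_fun setT Y ->
  (forall A B : set R, measurable A -> measurable B ->
    P ((X @^-1` A) `&` (Y @^-1` B)) = (P (X @^-1` A) * P (Y @^-1` B))%E) ->
  P.-integrable setT (EFin \o X) -> P.-integrable setT (EFin \o Y) ->
  P.-integrable setT (fun w => (X w * Y w)%:E) /\
  (\int[P]_w (X w * Y w)%:E = \int[P]_w (X w)%:E * \int[P]_w (Y w)%:E)%E.
Proof.
move=> mX mY ind iX iY.
pose X' : {RV P >-> R} := HB.pack_for {RV P >-> R} X (isMeasurableFun.Build _ _ _ _ _ mX).
pose Y' : {RV P >-> R} := HB.pack_for {RV P >-> R} Y (isMeasurableFun.Build _ _ _ _ _ mY).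
pose mu1 : probability _ _ := distribution P X'.
pose mu2 : probability _ _ := distribution P Y'.
have mXY : measurable_fun setT (fun w => (X w, Y w)) by exact: measurable_fun_pair.
pose XY : {RV P >-> (R * R)%type} :=
  HB.pack_for {RV P >-> (R * R)%type} (fun w => (X w, Y w)) (isMeasurableFun.Build _ _ _ _ _ mXY).
pose nu : probability _ _ := distribution P XY.
have joint A : measurable A -> (mu1 \x mu2)%E A = nu A.
  by move=> mA; apply: product_measure_unique => // A1 A2 mA1 mA2; exact: ind.
pose f (z : R * R) : \bar R := (z.1 * z.2)%:E.
have mf : measurable_fun setT f.
  by apply/measurable_EFinP; exact: measurable_funM.
have absprod : (\int[P]_w `|(X w * Y w)%:E| =
    \int[P]_w `|(X w)%:E| * \int[P]_w `|(Y w)%:E|)%E.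
  transitivity (\int[nu]_z `|f z|)%E.
    by rewrite ge0_integral_distribution//; exact: measurableT_comp.
  rewrite (eq_measure_integral (mu1 \x mu2)%E); last by move=> A mA _; exact/esym/joint.
  rewrite fubini_tonelli1//; last exact: measurableT_comp.
  rewrite /fubini_F.
  transitivity (\int[mu1]_x (`|x%:E| * \int[mu2]_y `|y%:E|))%E.
    apply: eq_integral => x _; rewrite -ge0_integralZl//.
    - by apply: eq_integral => y _; rewrite /f /= normrM.
    - exact: measurableT_comp.
  rewrite ge0_integralZr//; [|exact: measurableT_comp|exact: integral_ge0].
  by rewrite !ge0_integral_distribution//; exact: measurableT_comp.
have iXY : P.-integrable setT (fun w => (X w * Y w)%:E).
  apply/integrableP; split; first by apply/measurable_EFinP; exact: measurable_funM.
  rewrite absprod; move/integrableP : iX => [_ iX]; move/integrableP : iY => [_ iY].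
  by rewrite lte_mul_pinfty ?integral_ge0// ge0_fin_numE ?integral_ge0.
split => //.
have if1 : (mu1 \x mu2)%E.-integrable setT f.
  apply/integrableP; split => //.
  rewrite (eq_measure_integral nu); last by move=> A mA _; exact: joint.
  rewrite ge0_integral_distribution//; last exact: measurableT_comp.
  by move/integrableP : iXY => [].
have id1 : mu1.-integrable setT (fun x : R => x%:E).
  apply/integrableP; split; first exact/measurable_EFinP.
  rewrite ge0_integral_distribution//; last exact: measurableT_comp.
  by move/integrableP : iX => [].
have id2 : mu2.-integrable setT (fun x : R => x%:E).
  apply/integrableP; split; first exact/measurable_EFinP.
  rewrite ge0_integral_distribution//; last exact: measurableT_comp.
  by move/integrableP : iY => [].
transitivity (\int[nu]_z f z)%E.
  by rewrite integral_distribution.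
rewrite (eq_measure_integral (mu1 \x mu2)%E); last by move=> A mA _; exact/esym/joint.
rewrite -integral12_prod_meas1// /fubini_F.
transitivity (\int[mu1]_x (x%:E * \int[mu2]_y y%:E))%E.
  by apply: eq_integral => x _; rewrite -integralZl//. 
rewrite -(fineK (integrable_fin_num measurableT id2)) integralZr//.
rewrite fineK ?(integrable_fin_num measurableT id2)//.
by rewrite !integral_distribution.
Qed.

(* Pairwise orthogonality suffices for the second moment of a sum. *)
Lemma expectation_sum_sqr_le (n : nat) (D : nat -> T -> R) (v : nat -> R) :
  (forall i, (i < n)%N -> measurable_fun setT (D i)) ->
  (forall i, (i < n)%N -> (\int[P]_w (D i w ^+ 2)%:E <= (v i)%:E)%E) ->
  (forall i j, (i < j)%N -> (j < n)%N -> (\int[P]_w (D i w * D j w)%:E = 0)%E) ->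
  (\int[P]_w ((\sum_(i < n) D i w) ^+ 2)%:E <= (\sum_(i < n) v i)%:E)%E.
Proof.
move=> mD vD oD.
have iDD (i j : 'I_n) : P.-integrable setT (fun w => (D i w * D j w)%:E).
  by apply: integrable_mul_sqr; [exact: mD|exact: mD| |];
    apply: le_lt_trans (vD _ _) (ltry _).
have E w : ((\sum_(i < n) D i w) ^+ 2)%:E = (\sum_(i < n) \sum_(j < n) (D i w * D j w)%:E)%E.
  rewrite expr2 mulr_suml -sumEFin; apply: eq_bigr => i _.
  by rewrite mulr_sumr -sumEFin.
under eq_integral do rewrite E.
rewrite integral_sum//; last by move=> i; exact: integrable_sum.
rewrite -sumEFin; apply: lee_sum => i _.
rewrite integral_sum// (bigD1 i)//= big1 ?adde0.
  by under eq_integral do rewrite -expr2; exact: vD.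
move=> j ji; case: (ltngtP i j) => ij.
- exact: oD.
- by under eq_integral do rewrite mulrC; exact: oD.
- by move: ji; rewrite (val_inj ij) eqxx.
Qed.

Lemma measurable_ge_set (l : R) X : measurable_fun setT X ->
  measurable [set w | l <= X w].
Proof.
move=> mX; have := @measurable_fun_le _ T R setT (fun=> l) X.
rewrite setTI; apply => //; exact: measurable_cst.
Qed.

Lemma markov_ge0 X (l : R) : measurable_fun setT X -> (forall w, 0 <= X w) -> 0 < l ->
  (P [set w | (l <= X w)%R] <= (l^-1)%:E * \int[P]_w (X w)%:E)%E.
Proof.
move=> mX X0 l0; have mA := measurable_ge_set l mX.
have -> : P [set w | l <= X w] = (\int[P]_w (\1_[set w | (l <= X w)%R] w)%:E)%E.
  by rewrite integral_indic// setIT.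
rewrite lee_pdivlMl// muleC.
rewrite -ge0_integralZr//=; last 2 first.
- by apply/measurable_EFinP; exact: measurable_indic.
- by rewrite lee_fin ltW.
apply: ge0_le_integral => //.
- by move=> w _; rewrite mule_ge0 ?lee_fin// ltW.
- by apply/measurable_EFinP; apply: measurable_funM => //; exact: measurable_indic.
- exact/measurable_EFinP.
move=> w _; rewrite -EFinM lee_fin indicE; case: (boolP (w \in _)) => [/set_mem /=|_].
  by rewrite mul1r.
by rewrite mul0r.
Qed.

Lemma markov_sqr X (eps : R) : measurable_fun setT X -> 0 < eps ->
  (P [set w | (eps <= `|X w|)%R] <= (eps ^- 2)%:E * \int[P]_w (X w ^+ 2)%:E)%E.
Proof.
move=> mX eps0.
have -> : [set w | eps <= `|X w|] = [set w | eps ^+ 2 <= X w ^+ 2].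
  apply/seteqP; split => w /=; rewrite -[X w ^+ 2](real_normK (num_real _)).
    by rewrite ler_sqr// nnegrE ltW.
  by rewrite ler_sqr// nnegrE ltW.
apply: markov_ge0; [exact: measurable_funX|by move=> w; exact: sqr_ge0|exact: exprn_gt0].
Qed.

Lemma ereal_cvg0 (u : nat -> \bar R) : (forall n, (0 <= u n)%E) ->
  (forall e : R, 0 < e -> \forall n \near \oo, (u n <= e%:E)%E) -> u @ \oo --> 0%E.
Proof.
move=> u0 ue; apply/fine_cvgP; split.
  near=> n; rewrite ge0_fin_numE// (@le_lt_trans _ _ 1%E) ?ltry//.
  by near: n; exact: ue.
apply/cvgr0Pnorm_le => e e0; near=> n.
have une : (u n <= e%:E)%E by near: n; exact: ue.
have ufin : u n \is a fin_num by rewrite ge0_fin_numE// (le_lt_trans une) ?ltry.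
by rewrite /= ger0_norm ?fine_ge0// -lee_fin fineK.
Unshelve. all: by end_near. Qed.

(** Dominated convergence for the indicators of the exceptional events, with majorant 1. *)
Lemma ae_cvg_in_prob (Z : nat -> T -> R) (eps : R) : 0 < eps ->
  (forall n, measurable_fun setT (Z n)) ->
  {ae P, forall w, Z ^~ w @ \oo --> (0 : R)} ->
  (fun n => P [set w | eps <= `|Z n w|]) @ \oo --> 0%E.
Proof.
move=> eps0 mZ Z0.
have mA n : measurable [set w | eps <= `|Z n w|].
  by apply: measurable_ge_set; exact: measurableT_comp.
pose I n w : \bar R := (\1_[set w | eps <= `|Z n w|] w)%:E.
have [] := @dominated_convergence _ T R P setT measurableT I (fun=> 0%E) (fun=> 1%E).
- by move=> n; apply/measurable_EFinP; exact: measurable_indic.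
- exact: measurable_cst.
- apply: filterS Z0 => w Zw _.
  have /cvgr0Pnorm_lt/(_ _ eps0) Zw' := Zw.
  apply: cvg_near_cst; apply: filterS Zw' => n Zn.
  rewrite /I indicE memNset//=; apply/negP; by rewrite -ltNge.
- by apply/integrableP; split=> //; under eq_integral do rewrite abse1;
    rewrite integral_cst// mul1e; have := @probability_setT _ _ _ P => /= ->; exact: ltry.
- apply: aeW => w n _; by rewrite /I gee0_abs ?lee_fin// indicE lern1 leq_b1.
move=> _ _; rewrite integral0; apply: cvg_trans; apply: near_eq_cvg; near=> n.
by rewrite /= /I integral_indic// setIT.
Unshelve. all: by end_near. Qed.

(* The random factor [1 + Q n] is bounded in probability by Markov. *)
Lemma cvg_in_prob_random_bound (Y Q : nat -> T -> R) (c : R) :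
  (forall n, measurable_fun setT (Y n)) -> (forall n, measurable_fun setT (Q n)) ->
  (forall n w, 0 <= Q n w) -> (forall n, (\int[P]_w (Q n w)%:E <= c%:E)%E) ->
  {ae P, forall w, forall e : R, 0 < e ->
     \forall n \near \oo, `|Y n w| <= e * (1 + Q n w)} ->
  forall eps : R, 0 < eps -> (fun n => P [set w | eps <= `|Y n w|]) @ \oo --> 0%E.
Proof.
move=> mY mQ Q0 Qc YQ eps eps0.
have c0 : 0 <= c.
  by rewrite -lee_fin (le_trans _ (Qc 0%N))// integral_ge0// => w _; rewrite lee_fin.
(* Dividing by the random factor turns the pathwise bound into almost sure convergence to zero. *)
pose Z n w := Y n w * (1 + Q n w)^-1.
have Q1 n w : 0 < 1 + Q n w by rewrite ltr_wpDr.
have ch : continuous (fun y : R => (1 + `|y|)^-1).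
  move=> y; apply: cvgV; first by rewrite gt_eqF// ltr_wpDr.
  by apply: cvgD; [exact: cvg_cst|exact: norm_continuous].
have mZ n : measurable_fun setT (Z n).
  have -> : Z n = fun w => Y n w * (1 + `|Q n w|)^-1.
    by apply/funext => w; rewrite ger0_norm.
  apply: measurable_funM => //.
  exact: (measurableT_comp (continuous_measurable_fun ch)).
have Z0 : {ae P, forall w, Z ^~ w @ \oo --> (0 : R)}.
  apply: filterS YQ => w YQw; apply/cvgr0Pnorm_le => e e0.
  apply: filterS (YQw e e0) => n Yn.
  by rewrite /Z normrM normfV (gtr0_norm (Q1 n w)) ler_pdivrMr.
apply: ereal_cvg0 => // e e0.
(* If [|Y n|] reaches [eps], then either [|Z n|] reaches [eps / l] or [1 + Q n] reaches [l]. Markov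
   bounds the second event by [(1 + c) / l], which is [e / 2] for this [l]. *)
pose l := 2 * (1 + c) / e.
have l0 : 0 < l by rewrite divr_gt0// mulr_gt0// ltr_wpDr.
have el0 : 0 < eps / l by rewrite divr_gt0.
have e2 : (0 < (e / 2)%:E)%E by rewrite lte_fin divr_gt0.
have cvgZ := ae_cvg_in_prob el0 mZ Z0.
have Zlt : \forall n \near \oo, (P [set w | (eps / l <= `|Z n w|)%R] < (e / 2)%:E)%E.
  exact: (cvgZ _ (open_ereal_lt' e2)).
apply: filterS Zlt => n Zn.
have m1 : measurable [set w | eps / l <= `|Z n w|].
  by apply: measurable_ge_set; exact: measurableT_comp.
have m2 : measurable [set w | l <= 1 + Q n w].
  by apply: measurable_ge_set; apply: measurable_funD => //; exact: measurable_cst.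
have m3 : measurable [set w | eps <= `|Y n w|].
  by apply: measurable_ge_set; exact: measurableT_comp.
apply: (@le_trans _ _ (P ([set w | eps / l <= `|Z n w|] `|` [set w | l <= 1 + Q n w]))).
  apply: le_measure; rewrite ?inE//; first exact: measurableU.
  move=> w /= Yw; have [Ql|Ql] := leP l (1 + Q n w); [by right|left].
  rewrite /Z normrM normfV (gtr0_norm (Q1 n w)) ler_pdivlMr// (le_trans _ Yw)//.
  by rewrite mulrAC ler_pdivrMr// ler_wpM2l// ltW.
apply: le_trans (measureU2 _ m1 m2) _; rewrite [e]splitr EFinD leeD// ?(ltW Zn)//.
apply: le_trans (markov_ge0 _ _ l0) _.
- by apply: measurable_funD => //; exact: measurable_cst.
- by move=> w; exact/ltW.
rewrite -lee_pdivlMl ?invr_gt0// invrK.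
under eq_integral do rewrite EFinD.
rewrite ge0_integralD//; last 2 first.
- by move=> w _; rewrite lee_fin.
- exact/measurable_EFinP.
rewrite integral_cst// mul1e; have := @probability_setT _ _ _ P => /= ->.
apply: (@le_trans _ _ (1 + c)%:E); first by rewrite EFinD leeD2l.
have -> : 1 + c = l * (e / 2) by rewrite /l; field; rewrite gt_eqF.
by rewrite EFinM.
Qed.

End expectation.

(** * Brownian increments *)

Section measurable_wrt.
Context {R : realType} {dd : measure_display} {Omega : measurableType dd}.
Implicit Types (G : set (set Omega)) (X Y : Omega -> R).

Definition measurable_wrt G X := forall E : set R, measurable E -> G (X @^-1` E).

(** The filtration consists of bare families of sets. This equivalence transfers the closure
    properties of measurable functions to each of them. *)
Lemma measurable_wrtP G X : sigma_algebra [set: Omega] G ->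
  measurable_wrt G X <->
  measurable_fun (T := g_sigma_algebraType G) (U := measurableTypeR R) setT X.
Proof.
move=> sG; have GE : <<s G >> = G by exact: sigma_algebra_id.
split => [h _ E mE|h E mE].
  by rewrite setTI /measurable/= GE; exact: h.
have := h measurableT E mE; by rewrite setTI /measurable/= GE.
Qed.

Variable G : set (set Omega).
Hypothesis sG : sigma_algebra [set: Omega] G.

Lemma measurable_wrt_comp (h : R -> R) X : measurable_fun setT h ->
  measurable_wrt G X -> measurable_wrt G (fun w => h (X w)).
Proof.
move=> mh /(measurable_wrtP _ sG) mX; apply/(measurable_wrtP _ sG).
exact: measurableT_comp mh mX.
Qed.

Lemma measurable_wrt_cst (r : R) : measurable_wrt G (fun=> r).
Proof. by apply/(measurable_wrtP _ sG); exact: measurable_cst. Qed.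

Lemma measurable_wrtB X Y : measurable_wrt G X -> measurable_wrt G Y ->
  measurable_wrt G (fun w => X w - Y w).
Proof.
move=> /(measurable_wrtP _ sG) mX /(measurable_wrtP _ sG) mY.
by apply/(measurable_wrtP _ sG); exact: measurable_funB.
Qed.

Lemma measurable_wrtM X Y : measurable_wrt G X -> measurable_wrt G Y ->
  measurable_wrt G (fun w => X w * Y w).
Proof.
move=> /(measurable_wrtP _ sG) mX /(measurable_wrtP _ sG) mY.
by apply/(measurable_wrtP _ sG); exact: measurable_funM.
Qed.

Lemma measurable_wrt_sum (n : nat) (X : 'I_n -> Omega -> R) :
  (forall i, measurable_wrt G (X i)) -> measurable_wrt G (fun w => \sum_(i < n) X i w).
Proof.
move=> mX; apply/(measurable_wrtP _ sG).
apply: measurable_sum => i; exact/(measurable_wrtP _ sG).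
Qed.

Lemma measurable_wrt_cvg (X : nat -> Omega -> R) Y :
  (forall n, measurable_wrt G (X n)) -> (forall w, X ^~ w @ \oo --> Y w) ->
  measurable_wrt G Y.
Proof.
move=> mX XY; apply/(measurable_wrtP _ sG).
apply: (@measurable_fun_cvg _ (g_sigma_algebraType G) R setT X) => //.
by move=> n; exact/(measurable_wrtP _ sG).
Qed.

End measurable_wrt.

Section brownian.
Context {R : realType} {dd : measure_display} {Omega : measurableType dd}.
Context (P : probability Omega R) (F : R -> set (set Omega)) (T : R).
Hypothesis FF : complete_filtration P F T.
Implicit Types (X Y Z W : R -> Omega -> R).
Local Notation increment := Defs.increment.

Lemma filtration_sigma t : 0 <= t <= T -> sigma_algebra [set: Omega] (F t).
Proof. by have [h _ _ _] := FF; exact: h. Qed.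

Lemma filtration_leW s t (X : Omega -> R) : 0 <= s -> s <= t -> t <= T ->
  measurable_wrt (F s) X -> measurable_wrt (F t) X.
Proof. by have [_ _ h _] := FF => s0 st tT mX E mE; apply: (h s t) => //; exact: mX. Qed.

Lemma filtration_measurable t (X : Omega -> R) : 0 <= t <= T ->
  measurable_wrt (F t) X -> measurable_fun setT X.
Proof. by have [_ h _ _] := FF => t0T mX _ E mE; rewrite setTI; apply: (h t t0T); exact: mX. Qed.

Lemma filtration_negligible t N : 0 <= t <= T -> P.-negligible N -> F t N.
Proof.
by have [_ _ h1 h2] := FF => /andP[t0 tT] NN; apply: (h1 0 t) => //; exact: h2.
Qed.

Lemma adapted_wrt X t : adapted F T X -> 0 <= t <= T -> measurable_wrt (F t) (X t).
Proof. by move=> aX tT E; exact: aX. Qed.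

Lemma adapted_measurable X t : adapted F T X -> 0 <= t <= T -> measurable_fun setT (X t).
Proof. by move=> aX tT; apply: (filtration_measurable tT); exact: adapted_wrt. Qed.

Lemma increment_wrt X s t u : adapted F T X -> 0 <= s -> s <= t -> t <= u -> u <= T ->
  measurable_wrt (F u) (increment X s t).
Proof.
move=> aX s0 st tu uT.
have t0 : 0 <= t by exact: le_trans st.
have tT : t <= T by exact: le_trans uT.
apply: measurable_wrtB; first by apply: filtration_sigma; rewrite (le_trans t0).
- by apply: (filtration_leW t0 tu uT); apply: adapted_wrt => //; rewrite t0.
- apply: (filtration_leW s0 (le_trans st tu) uT); apply: adapted_wrt => //.
  by rewrite s0 (le_trans st).
Qed.

Section one_brownian.
Variable W : R -> Omega -> R.
Hypothesis BW : brownian_motion P F T W.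
Variables s t : R.
Hypotheses (s0 : 0 <= s) (st : s < t) (tT : t <= T).
Local Notation dW := (increment W s t).
Local Notation sd := (Num.sqrt (t - s)).

Lemma bm_adapted : adapted F T W. Proof. by have [] := BW. Qed.

Lemma measurable_bm_increment : measurable_fun setT dW.
Proof.
have t0 : 0 <= t by rewrite ltW// (le_lt_trans s0).
apply: (@filtration_measurable t); first by rewrite t0.
by apply: increment_wrt => //; [exact: bm_adapted|exact: ltW].
Qed.

Let sd0 : 0 < sd. Proof. by rewrite sqrtr_gt0 subr_gt0. Qed.

Let lawE (A : set R) : measurable A -> pushforward P dW A = normal_prob 0 sd A.
Proof. by move=> mA; have [_ _ _ h _] := BW; rewrite /pushforward h. Qed.

Lemma ge0_integral_bm_increment (h : R -> R) : (forall x, 0 <= h x) ->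
  measurable_fun setT h ->
  (\int[P]_w (h (dW w))%:E = \int[normal_prob 0 sd]_x (h x)%:E)%E.
Proof.
move=> h0 mh.
pose D : {RV P >-> measurableTypeR R} :=
  HB.pack_for {RV P >-> measurableTypeR R} (dW : Omega -> measurableTypeR R)
    (isMeasurableFun.Build _ _ _ _ _
      (measurable_bm_increment : measurable_fun (U := measurableTypeR R) setT dW)).
transitivity (\int[distribution P D]_x (h x)%:E)%E; last first.
  by apply: eq_measure_integral => A mA _; exact: lawE.
by rewrite ge0_integral_distribution//; exact/measurable_EFinP.
Qed.

Lemma bm_increment_sqr : (\int[P]_w (dW w ^+ 2)%:E = (t - s)%:E)%E.
Proof.
rewrite (@ge0_integral_bm_increment (fun x => x ^+ 2)).
- by rewrite integral_normal_sqr// sqr_sqrtr// subr_ge0 ltW.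
- by move=> x; exact: sqr_ge0.
- exact: (continuous_measurable_fun (@exprn_continuous R 2)).
Qed.

Lemma bm_increment_pow4 :
  (\int[P]_w (dW w ^+ 4)%:E <= (32 * Num.sqrt 2 * (t - s) ^+ 2)%:E)%E.
Proof.
rewrite (@ge0_integral_bm_increment (fun x => x ^+ 4)).
- have ts0 : 0 <= t - s by rewrite subr_ge0 ltW.
  rewrite -[X in 32 * _ * X ^+ 2](sqr_sqrtr ts0).
  exact: (integral_normal_pow4 sd0).
- by move=> x; rewrite exprn_even_ge0.
- exact: (continuous_measurable_fun (@exprn_continuous R 4)).
Qed.

Lemma integrable_bm_increment : P.-integrable setT (EFin \o dW).
Proof.
apply: integrable_sqr; first exact: measurable_bm_increment.
by rewrite bm_increment_sqr ltry.
Qed.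

Lemma bm_increment_mean : (\int[P]_w (dW w)%:E = 0)%E.
Proof.
pose D : {RV P >-> measurableTypeR R} :=
  HB.pack_for {RV P >-> measurableTypeR R} (dW : Omega -> measurableTypeR R)
    (isMeasurableFun.Build _ _ _ _ _
      (measurable_bm_increment : measurable_fun (U := measurableTypeR R) setT dW)).
rewrite -(integral_normal_id sd0).
transitivity (\int[distribution P D]_x x%:E)%E; last first.
  by apply: eq_measure_integral => A mA _; exact: lawE.
by rewrite integral_distribution//; exact: integrable_bm_increment.
Qed.

(** Used with [h] the identity, the square and the centred square: the three cases behind
    orthogonality and the Ito isometry. *)
Lemma bm_increment_independent (X : Omega -> R) (h : R -> R) :
  measurable_wrt (F s) X -> measurable_fun setT h ->
  P.-integrable setT (EFin \o X) -> P.-integrable setT (fun w => (h (dW w))%:E) ->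
  P.-integrable setT (fun w => (X w * h (dW w))%:E) /\
  (\int[P]_w (X w * h (dW w))%:E = \int[P]_w (X w)%:E * \int[P]_w (h (dW w))%:E)%E.
Proof.
move=> mX mh iX ih; have s0T : 0 <= s <= T by rewrite s0 (le_trans (ltW st)).
apply: (@expectation_independent _ _ _ _ X (h \o dW)) => //.
- exact: filtration_measurable mX.
- exact: measurableT_comp mh measurable_bm_increment.
move=> A B mA mB; have [_ _ _ _ ind] := BW.
rewrite comp_preimage; apply: ind => //; first exact: mX.
by rewrite -[X in measurable X]setTI; exact: mh.
Qed.

End one_brownian.
End brownian.

(** * Second moments and orthogonality of the bracket defects *)

Section brackets.
Context {R : realType} {dd : measure_display} {Omega : measurableType dd}.
Context (P : probability Omega R) (F : R -> set (set Omega)) (T : R).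
Hypothesis FF : complete_filtration P F T.
Local Notation increment := Defs.increment.
Implicit Types (W Z : R -> Omega -> R).

Definition bracket_defect W Z (kappa : R) (s t : R) (w : Omega) : R :=
  increment W s t w * increment Z s t w - kappa * (t - s).

(* The only facts about the pair [W, Z] used to compute brackets against [Z]. *)
Definition orthogonal_defects W Z (kappa C : R) : Prop :=
  (forall s t, 0 <= s -> s < t -> t <= T ->
     (\int[P]_w (bracket_defect W Z kappa s t w ^+ 2)%:E <= (C * (t - s) ^+ 2)%:E)%E) /\
  (forall s t s' t', 0 <= s -> s < t -> t <= s' -> s' < t' -> t' <= T ->
     (\int[P]_w (bracket_defect W Z kappa s t w * bracket_defect W Z kappa s' t' w)%:E
      = 0)%E).

Lemma measurable_bracket_defect W Z kappa s t : adapted F T W -> adapted F T Z ->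
  0 <= s -> s <= t -> t <= T -> measurable_wrt (F t) (bracket_defect W Z kappa s t).
Proof.
move=> aW aZ s0 st tT; have t0T : 0 <= t <= T by rewrite (le_trans s0).
have sG := filtration_sigma FF t0T.
apply: (measurable_wrtB sG); last exact: measurable_wrt_cst.
by apply: (measurable_wrtM sG); apply: (increment_wrt FF).
Qed.

(** The constant comes from (x - y)^2 <= 2 x^2 + 2 y^2 with x the squared increment and y = t - s,
    together with the fourth moment bound 32 sqrt 2 (t - s)^2. For orthogonality, the earlier defect
    is known at time [s'] and the later one is centred and independent of [F s']. *)
Lemma brownian_defects W : brownian_motion P F T W ->
  orthogonal_defects W W 1 (64 * Num.sqrt 2 + 2).
Proof.
move=> BW; have aW := bm_adapted BW; split.
  move=> s t s0 st tT.
  have mdW := measurable_bm_increment FF BW s0 st tT.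
  have ts0 : 0 <= t - s by rewrite subr_ge0 ltW.
  apply: (@le_trans _ _ (\int[P]_w (2%:E * (increment W s t w ^+ 4)%:E + (2 * (t - s) ^+ 2)%:E))%E).
    apply: ge0_le_integral => //.
    - by move=> w _; rewrite lee_fin sqr_ge0.
    - apply/measurable_EFinP/measurable_funX; apply: measurable_funB => //.
      exact: measurable_funM.
    - apply/measurable_EFinP; apply: measurable_funD => //.
      by apply: measurable_funM => //; exact: measurable_funX.
    move=> w _; rewrite -EFinM -EFinD lee_fin /bracket_defect mul1r.
    rewrite (_ : _ ^+ 4 = (increment W s t w ^+ 2) ^+ 2); last by rewrite -exprM.
    rewrite -expr2; move: (increment W s t w ^+ 2) (t - s) => x y.
    by have := sqr_ge0 (x + y); nra.
  rewrite ge0_integralD//=.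
  - rewrite ge0_integralZl//.
    + rewrite integral_cst//; have := @probability_setT _ _ _ P => /= ->; rewrite mule1.
      apply: (@le_trans _ _ (2%:E * (32 * Num.sqrt 2 * (t - s) ^+ 2)%:E + (2 * (t - s) ^+ 2)%:E)%E).
        by rewrite leeD2r// lee_pmul2l// (bm_increment_pow4 FF BW s0 st tT).
      by rewrite -EFinM -EFinD lee_fin le_eqVlt; apply/orP; left; apply/eqP; ring.
    + by apply/measurable_EFinP; exact: measurable_funX.
    + by move=> w _; rewrite lee_fin exprn_even_ge0.
  - by move=> w _; rewrite mule_ge0// lee_fin exprn_even_ge0.
  - apply/measurable_EFinP; apply: measurable_funM => //; exact: measurable_funX.
  - by move=> w _; rewrite lee_fin mulr_ge0// sqr_ge0.
move=> s t s' t' s0 st ts' s't' t'T.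
have s'0 : 0 <= s' by rewrite (le_trans (le_trans s0 (ltW st))).
have tT : t <= T by rewrite (le_trans ts')// (le_trans (ltW s't')).
have t0 : 0 <= t by rewrite (le_trans s0)// ltW.
have s'T : s' <= T by rewrite (le_trans (ltW s't')).
have mX : measurable_wrt (F s') (bracket_defect W W 1 s t).
  apply: (filtration_leW FF t0 ts' s'T); apply: measurable_bracket_defect => //; exact: ltW.
have isq (u v : R) : 0 <= u -> u < v -> v <= T ->
    P.-integrable setT (fun w => (increment W u v w ^+ 2 - (v - u))%:E).
  move=> u0 uv vT; have mdW := measurable_bm_increment FF BW u0 uv vT.
  have i1 : P.-integrable setT (fun w => (increment W u v w ^+ 2)%:E).
    apply/integrableP; split; first by apply/measurable_EFinP; exact: measurable_funX.
    under eq_integral do rewrite /= ger0_norm ?sqr_ge0//.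
    by rewrite (bm_increment_sqr FF BW u0 uv vT) ltry.
  have i2 : P.-integrable setT (fun w : Omega => (v - u)%:E).
    exact: finite_measure_integrable_cst.
  exact: (integrableB measurableT i1 i2).
have iX : P.-integrable setT (EFin \o bracket_defect W W 1 s t).
  have -> : EFin \o bracket_defect W W 1 s t =
      fun w => (increment W s t w ^+ 2 - (t - s))%:E.
    by apply/funext => w; rewrite /bracket_defect /= mul1r expr2.
  exact: isq.
have mh : measurable_fun setT (fun x : R => x ^+ 2 - (t' - s')).
  apply: measurable_funB; last exact: measurable_cst.
  exact: (continuous_measurable_fun (@exprn_continuous R 2)).
have [_ E] := bm_increment_independent FF BW s'0 s't' t'T mX mh iX (isq s' t' s'0 s't' t'T).
transitivity (\int[P]_w (bracket_defect W W 1 s t w * (increment W s' t' w ^+ 2 - (t' - s')))%:E)%E.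
  by apply: eq_integral => w _; rewrite {2}/bracket_defect mul1r -expr2.
rewrite E.
have -> : (\int[P]_w (increment W s' t' w ^+ 2 - (t' - s'))%:E = 0)%E.
  have mdW := measurable_bm_increment FF BW s'0 s't' t'T.
  under eq_integral do rewrite EFinB.
  rewrite integralB//.
  - rewrite (bm_increment_sqr FF BW s'0 s't' t'T) integral_cst//.
    by have := @probability_setT _ _ _ P => /= ->; rewrite mule1 subee.
  - apply/integrableP; split; first by apply/measurable_EFinP; exact: measurable_funX.
    under eq_integral do rewrite /= ger0_norm ?sqr_ge0//.
    by rewrite (bm_increment_sqr FF BW s'0 s't' t'T) ltry.
  - exact: finite_measure_integrable_cst.
by rewrite mule0.
Qed.

Lemma process_sigma_wrt W t : 0 <= t <= T -> measurable_wrt (process_sigma T W) (W t).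
Proof. by move=> tT E mE; apply: sub_sigma_algebra; exists t, E. Qed.

Lemma process_sigma_increment W s t : 0 <= s -> s < t -> t <= T ->
  measurable_wrt (process_sigma T W) (increment W s t).
Proof.
move=> s0 st tT; apply: measurable_wrtB; first exact: smallest_sigma_algebra.
- by apply: process_sigma_wrt; rewrite tT (le_trans s0)// ltW.
- by apply: process_sigma_wrt; rewrite s0 (le_trans (ltW st)).
Qed.

Lemma expectation_independent_processes W B (X Y : Omega -> R) :
  independent_processes P T W B ->
  measurable_wrt (process_sigma T W) X -> measurable_wrt (process_sigma T B) Y ->
  P.-integrable setT (EFin \o X) -> P.-integrable setT (EFin \o Y) ->
  (\int[P]_w (X w * Y w)%:E = \int[P]_w (X w)%:E * \int[P]_w (Y w)%:E)%E.
Proof.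
move=> ind mX mY iX iY; apply: (expectation_independent _ _ _ iX iY).2.
- by apply/measurable_EFinP; exact: measurable_int iX.
- by apply/measurable_EFinP; exact: measurable_int iY.
- by move=> A C mA mC; apply: ind; [exact: mX|exact: mY].
Qed.

(** With [kappa = 0] the defect is the plain product of two increments. By independence of the
    processes its second moment is exactly the square of the interval length, hence the constant
    1. *)
Lemma independent_defects W B : brownian_motion P F T W -> brownian_motion P F T B ->
  independent_processes P T W B -> orthogonal_defects W B 0 1.
Proof.
move=> BW BB ind.
have aW := bm_adapted BW; have aB := bm_adapted BB.
have sW : sigma_algebra setT (process_sigma T W) by exact: smallest_sigma_algebra.
have sB : sigma_algebra setT (process_sigma T B) by exact: smallest_sigma_algebra.
have isq Z (u v : R) : brownian_motion P F T Z -> 0 <= u -> u < v -> v <= T ->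
    P.-integrable setT (fun w => (increment Z u v w ^+ 2)%:E).
  move=> BZ u0 uv vT; have mdW := measurable_bm_increment FF BZ u0 uv vT.
  apply/integrableP; split; first by apply/measurable_EFinP; exact: measurable_funX.
  under eq_integral do rewrite /= ger0_norm ?sqr_ge0//.
  by rewrite (bm_increment_sqr FF BZ u0 uv vT) ltry.
split.
  move=> s t s0 st tT.
  have E w : bracket_defect W B 0 s t w ^+ 2 = increment W s t w ^+ 2 * increment B s t w ^+ 2.
    by rewrite /bracket_defect mul0r subr0 exprMn.
  under eq_integral do rewrite E.
  rewrite (@expectation_independent_processes W B (fun w => increment W s t w ^+ 2)
     (fun w => increment B s t w ^+ 2) ind).
  - rewrite (bm_increment_sqr FF BW s0 st tT) (bm_increment_sqr FF BB s0 st tT).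
    by rewrite mul1r -EFinM expr2.
  - apply: (measurable_wrt_comp sW (h := fun x => x ^+ 2)).
      exact: (continuous_measurable_fun (@exprn_continuous R 2)).
    exact: process_sigma_increment.
  - apply: (measurable_wrt_comp sB (h := fun x => x ^+ 2)).
      exact: (continuous_measurable_fun (@exprn_continuous R 2)).
    exact: process_sigma_increment.
  - exact: isq.
  - exact: isq.
move=> s t s' t' s0 st ts' s't' t'T.
have s'0 : 0 <= s' by rewrite (le_trans (le_trans s0 (ltW st))).
have tT : t <= T by rewrite (le_trans ts')// (le_trans (ltW s't')).
have t0 : 0 <= t by rewrite (le_trans s0)// ltW.
have s'T : s' <= T by rewrite (le_trans (ltW s't')).
(* The factors of a product of two defects are regrouped by process; each group has mean zero by the
   independence of the increments of that one process. *)
have cross Z : brownian_motion P F T Z ->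
    P.-integrable setT (fun w => (increment Z s t w * increment Z s' t' w)%:E) /\
    (\int[P]_w (increment Z s t w * increment Z s' t' w)%:E = 0)%E.
  move=> BZ.
  have mX : measurable_wrt (F s') (increment Z s t).
    by apply: (increment_wrt FF (bm_adapted BZ)) => //; exact: ltW.
  have [i E] := bm_increment_independent FF BZ s'0 s't' t'T (h := id) mX
    (@measurable_id _ _ setT) (integrable_bm_increment FF BZ s0 st tT)
    (integrable_bm_increment FF BZ s'0 s't' t'T).
  by split => //; rewrite E (bm_increment_mean FF BZ s'0 s't' t'T) mule0.
have E w : bracket_defect W B 0 s t w * bracket_defect W B 0 s' t' w =
    (increment W s t w * increment W s' t' w) * (increment B s t w * increment B s' t' w).
  by rewrite /bracket_defect !mul0r !subr0 mulrACA.
under eq_integral do rewrite E.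
have [iW EW] := cross _ BW; have [iB EB] := cross _ BB.
rewrite (@expectation_independent_processes W B
  (fun w => increment W s t w * increment W s' t' w)
  (fun w => increment B s t w * increment B s' t' w) ind)//.
- by rewrite EW mul0e.
- by apply: (measurable_wrtM sW); exact: process_sigma_increment.
- by apply: (measurable_wrtM sB); exact: process_sigma_increment.
Qed.

End brackets.

(** * Ito integrals of constants *)

Section truncated_isometry.
Context {R : realType} {dd : measure_display} {Omega : measurableType dd}.
Context (P : probability Omega R) (F : R -> set (set Omega)) (T : R).
Hypothesis FF : complete_filtration P F T.
Variable W : R -> Omega -> R.
Hypothesis BW : brownian_motion P F T W.
Local Notation increment := Defs.increment.

(** Equal end points must be allowed: capping the grid at [t] makes intervals degenerate. *)
Lemma bm_increment_sqr_le s t : 0 <= s -> s <= t -> t <= T ->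
  measurable_fun setT (increment W s t) /\
  (\int[P]_w (increment W s t w ^+ 2)%:E = (t - s)%:E)%E.
Proof.
move=> s0; rewrite le_eqVlt => /predU1P[<-{t} _|st tT]; last first.
  by split; [exact: (measurable_bm_increment FF BW)|exact: (bm_increment_sqr FF BW)].
have -> : increment W s s = fun=> 0 by apply/funext => w; rewrite /Defs.increment subrr.
by split => //; under eq_integral do rewrite expr0n/=; rewrite integral0 subrr.
Qed.

Variables (N : nat) (p : nat -> R) (eta : nat -> Omega -> R) (M : nat -> R) (t : R).
Hypothesis p0 : 0 <= p 0%N.
Hypothesis p_mono : forall i, (i < N)%N -> p i <= p i.+1.
Hypothesis pT : p N <= T.
Hypothesis eta_meas : forall i, (i < N)%N -> measurable_wrt (F (p i)) (eta i).
Hypothesis eta_bnd : forall i w, (i < N)%N -> `|eta i w| <= M i.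
Hypothesis tT : 0 <= t <= T.

Lemma mono_le i j : (i <= j)%N -> (j <= N)%N -> p i <= p j.
Proof.
elim: j => [|j ih]; first by rewrite leqn0 => /eqP ->.
rewrite leq_eqVlt => /predU1P[->//|ij jN].
by apply: le_trans (p_mono jN); apply: ih => //; exact: ltnW.
Qed.

Let p_ge0 i : (i <= N)%N -> 0 <= p i.
Proof. by move=> iN; apply: le_trans p0 _; exact: mono_le. Qed.

Let p_leT i : (i <= N)%N -> p i <= T.
Proof. by move=> iN; apply: le_trans pT; exact: mono_le. Qed.

Let p_itv i : (i <= N)%N -> 0 <= p i <= T.
Proof. by move=> iN; rewrite p_ge0// p_leT. Qed.

Let q i := Num.min t (p i).
Let dW i := increment W (q i) (q i.+1).
Let S k w := \sum_(i < k) eta i w ^+ 2 * (p i.+1 - p i).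
Variable delta : R.
Hypothesis delta0 : 0 < delta.
(* Stopping the integrand as soon as its accumulated square exceeds [delta]. *)
Let stop i w : R := \1_[set x : R | x <= delta] (S i.+1 w).
Let zeta i w := eta i w * stop i w.

Let stop01 i w : 0 <= stop i w <= 1.
Proof. by rewrite /stop indicE; case: (_ \in _); rewrite ?lexx ler01. Qed.

Let S_step k w : (k < N)%N -> S k w <= S k.+1 w.
Proof.
move=> kN; rewrite /S big_ord_recr/= lerDl mulr_ge0 ?sqr_ge0// subr_ge0.
exact: p_mono.
Qed.

Let S_mono k w : (k <= N)%N -> S k w <= S N w.
Proof.
move=> kN; have : forall m, (k + m <= N)%N -> S k w <= S (k + m) w.
  elim=> [|m ih]; first by rewrite addn0.
  rewrite addnS => h; apply: le_trans (ih (ltnW h)) _; exact: S_step.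
by move=> /(_ (N - k)%N); rewrite subnKC//; apply.
Qed.

(** The bound by [S k] makes the induction work: as long as nothing is stopped, the new partial sum
    is compared with [S k.+1], which is then at most [delta]; a stopped term adds nothing. *)
Let zeta_sum_le k w : (k <= N)%N ->
  \sum_(i < k) zeta i w ^+ 2 * (p i.+1 - p i) <= Num.min (S k w) delta.
Proof.
elim: k => [|k ih] kN; first by rewrite big_ord0 /S big_ord0 le_min lexx ltW.
have {}ih := ih (ltnW kN); rewrite le_min in ih; case/andP: ih => ih1 ih2.
rewrite big_ord_recr/= {2}/zeta /stop indicE.
case: (boolP (_ \in _)) => [/set_mem /= h|_].
  rewrite mulr1 min_l//; rewrite /S big_ord_recr/= lerD2r; exact: ih1.
rewrite mulr0 expr0n/= mul0r addr0 le_min ih2 andbT.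
exact: le_trans ih1 (S_step _ kN).
Qed.

(** [S k.+1] involves [eta] only up to index [k], hence is known at the left end [p k] of the
    interval. Stopping may thus look at the current term and still be nonanticipating. *)
Let S_meas k : (k < N)%N -> measurable_wrt (F (p k)) (S k.+1).
Proof.
move=> kN; have sG := filtration_sigma FF (p_itv (ltnW kN)).
apply: (measurable_wrt_sum sG) => i; apply: (measurable_wrtM sG); last exact: measurable_wrt_cst.
have iN : (i < N)%N by apply: leq_ltn_trans kN; rewrite -ltnS.
apply: (filtration_leW FF (s := p i)).
- exact/p_ge0/ltnW.
- by apply: mono_le; [rewrite -ltnS|exact: ltnW].
- exact/p_leT/ltnW.
- apply: (measurable_wrt_comp _ (h := fun x => x ^+ 2)).
  + exact: (filtration_sigma FF (p_itv (ltnW iN))).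
  + exact: (continuous_measurable_fun (@exprn_continuous R 2)).
  + exact: eta_meas.
Qed.

Let zeta_meas k : (k < N)%N -> measurable_wrt (F (p k)) (zeta k).
Proof.
move=> kN; have sG := filtration_sigma FF (p_itv (ltnW kN)).
apply: (measurable_wrtM sG); first exact: eta_meas.
apply: (measurable_wrt_comp sG) (S_meas kN); apply: measurable_indic.
by rewrite -[X in measurable X]/([set x : R | x <= delta]) -set_itvNyc.
Qed.

Let zeta_bnd i w : (i < N)%N -> `|zeta i w| <= M i.
Proof.
move=> iN; rewrite normrM (le_trans _ (eta_bnd w iN))// ler_piMr//.
by have /andP[s0 s1] := stop01 i w; rewrite ger0_norm.
Qed.

Let q0 i : (i <= N)%N -> 0 <= q i.
Proof. by move=> iN; rewrite le_min p_ge0// andbT; case/andP: tT. Qed.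

Let q_mono i : (i < N)%N -> q i <= q i.+1.
Proof. by move=> iN; rewrite le_min ge_min lexx/= ge_min p_mono// orbT. Qed.

Let qT i : q i <= T.
Proof. by rewrite ge_min; case/andP: tT => _ ->. Qed.

(** A nondegenerate capped interval begins at a genuine grid point, where [zeta i] is measurable; on
    all other intervals the increment vanishes. *)
Let q_lt i : q i < q i.+1 -> q i = p i.
Proof. by rewrite /q lt_min => /andP[+ _]; rewrite gt_min ltxx/= => h; rewrite min_r// ltW. Qed.

Let dW_eq0 i w : (i < N)%N -> ~~ (q i < q i.+1) -> dW i w = 0.
Proof.
move=> iN; rewrite -leNgt => h; rewrite /dW.
have -> : q i.+1 = q i by apply/eqP; rewrite eq_le h q_mono.
by rewrite /Defs.increment subrr.
Qed.

Let zeta_mfun i : (i < N)%N -> measurable_fun setT (zeta i).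
Proof. by move=> iN; apply: (filtration_measurable FF (p_itv (ltnW iN))); exact: zeta_meas. Qed.

Let integrable_bounded (X : Omega -> R) (c : R) : measurable_fun setT X ->
  (forall w, `|X w| <= c) -> P.-integrable setT (EFin \o X).
Proof.
move=> mX Xc; apply: (@le_integrable _ _ _ P setT measurableT _ (fun=> c%:E)).
- exact/measurable_EFinP.
- move=> w _ /=; rewrite lee_fin (le_trans (Xc w))//; exact: ler_norm.
- exact: finite_measure_integrable_cst.
Qed.

Let zeta2_integrable i : (i < N)%N -> P.-integrable setT (fun w => (zeta i w ^+ 2)%:E).
Proof.
move=> iN; apply: (@integrable_bounded (fun w => zeta i w ^+ 2) (M i ^+ 2)).
  by apply: measurable_funX; exact: zeta_mfun.
move=> w; rewrite normrX ler_sqr ?nnegrE//; first exact: zeta_bnd.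
exact: le_trans (normr_ge0 _) (zeta_bnd w iN).
Qed.

Let Dm i : (i < N)%N -> measurable_fun setT (fun w => zeta i w * dW i w).
Proof.
move=> iN; apply: measurable_funM; first exact: zeta_mfun.
exact: (bm_increment_sqr_le (q0 (ltnW iN)) (q_mono iN) (qT _)).1.
Qed.

Let D_sqr i : (i < N)%N ->
  (\int[P]_w ((zeta i w * dW i w) ^+ 2)%:E <=
   (p i.+1 - p i)%:E * \int[P]_w (zeta i w ^+ 2)%:E)%E.
Proof.
move=> iN; have Z0 : (0 <= \int[P]_w (zeta i w ^+ 2)%:E)%E.
  by apply: integral_ge0 => w _; rewrite lee_fin sqr_ge0.
have [qq|qq] := boolP (q i < q i.+1); last first.
  rewrite [X in (X <= _)%E](_ : _ = 0)%E; last first.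
    rewrite -[RHS](integral0 P setT); apply: eq_integral => w _.
    by rewrite dW_eq0// mulr0 expr0n.
  by rewrite mule_ge0// lee_fin subr_ge0 p_mono.
have qp := q_lt qq.
have mz : measurable_wrt (F (q i)) (fun w => zeta i w ^+ 2).
  rewrite qp; apply: (measurable_wrt_comp (filtration_sigma FF (p_itv (ltnW iN))) (h := fun x => x ^+ 2)).
    exact: (continuous_measurable_fun (@exprn_continuous R 2)).
  exact: zeta_meas.
have E2 := bm_increment_sqr FF BW (q0 (ltnW iN)) qq (qT _).
have i2 : P.-integrable setT (fun w => (dW i w ^+ 2)%:E).
  apply/integrableP; split.
    by apply/measurable_EFinP/measurable_funX; exact: (measurable_bm_increment FF BW (q0 (ltnW iN)) qq (qT _)).
  by under eq_integral do rewrite /= ger0_norm ?sqr_ge0//; rewrite E2 ltry.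
have [_ E] := bm_increment_independent FF BW (q0 (ltnW iN)) qq (qT _) mz (h := fun x => x ^+ 2)
  (continuous_measurable_fun (@exprn_continuous R 2)) (zeta2_integrable iN) i2.
under eq_integral do rewrite exprMn.
rewrite E E2 muleC lee_wpmul2r// lee_fin qp lerD2r /q ge_min lexx.
by rewrite orbT.
Qed.

(** Every factor except the last increment is known at time [p j], and that increment is independent
    of the past with mean zero. *)
Let D_cross i j : (i < j)%N -> (j < N)%N ->
  (\int[P]_w ((zeta i w * dW i w) * (zeta j w * dW j w))%:E = 0)%E.
Proof.
move=> ij jN; have iN := ltn_trans ij jN.
have [qq|qq] := boolP (q j < q j.+1); last first.
  rewrite -[RHS](integral0 P setT); apply: eq_integral => w _.
  by rewrite (dW_eq0 _ jN)// !mulr0.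
have qp := q_lt qq; have pjT := p_itv (ltnW jN).
have sG := filtration_sigma FF pjT.
have [mdi sqi] := bm_increment_sqr_le (q0 (ltnW iN)) (q_mono iN) (qT _).
have X1 : measurable_wrt (F (p j)) (fun w => zeta i w * dW i w * zeta j w).
  apply: (measurable_wrtM sG); last exact: zeta_meas.
  apply: (measurable_wrtM sG).
    apply: (filtration_leW FF (s := p i)) (zeta_meas iN).
    - exact/p_ge0/ltnW.
    - by apply: mono_le; exact: ltnW.
    - exact/p_leT/ltnW.
  apply: (increment_wrt FF (bm_adapted BW)).
  - exact/q0/ltnW.
  - exact: q_mono.
  - by rewrite /q ge_min mono_le ?orbT// ltnW.
  - exact/p_leT/ltnW.
rewrite -qp in X1.
have iX : P.-integrable setT (EFin \o (fun w => zeta i w * dW i w * zeta j w)).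
  have idW : P.-integrable setT (fun w => (dW i w)%:E).
    by apply: integrable_sqr => //; rewrite sqi ltry.
  apply: (@le_integrable _ _ _ P setT measurableT _ (fun w => (M i * M j)%:E * (dW i w)%:E)%E).
  - apply/measurable_EFinP; apply: measurable_funM; first exact: Dm.
    exact: zeta_mfun.
  - move=> w _; rewrite /= lee_fin mulrAC [leLHS]normrM [leRHS]normrM ler_wpM2r// [leLHS]normrM.
    have Mi := zeta_bnd w iN; have Mj := zeta_bnd w jN.
    by apply: le_trans (ler_pM _ _ Mi Mj) _ => //; exact: ler_norm.
  - exact: integrableZl.
have [_ E] := bm_increment_independent FF BW (q0 (ltnW jN)) qq (qT _) (h := id) X1
  (@measurable_id _ _ setT) iX (integrable_bm_increment FF BW (q0 (ltnW jN)) qq (qT _)).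
under eq_integral do rewrite mulrA.
by rewrite E (bm_increment_mean FF BW (q0 (ltnW jN)) qq (qT _)) mule0.
Qed.

(** Off the event that the accumulated square reaches [delta], the stopped sum coincides with the
    original one. Its terms are orthogonal and its accumulated square never exceeds [delta], so its
    second moment is at most [delta], and Chebyshev gives the last summand. *)
Lemma simple_integral_tail (eps : R) : 0 < eps ->
  (P [set w | (eps <= `|\sum_(i < N) eta i w * (W (Num.min t (p i.+1)) w - W (Num.min t (p i)) w)|)%R]
   <= P [set w | (delta <= \sum_(i < N) eta i w ^+ 2 * (p i.+1 - p i))%R]
      + (delta / eps ^+ 2)%:E)%E.
Proof.
move=> eps0.
have m1 : measurable [set w | delta <= S N w].
  apply: measurable_ge_set; apply: measurable_sum => i.
  apply: measurable_funM => //; apply: measurable_funX.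
  by apply: (filtration_measurable FF (p_itv (ltnW (ltn_ord i)))); exact: eta_meas.
pose Y w := \sum_(i < N) zeta i w * dW i w.
have mY : measurable_fun setT Y by apply: measurable_sum => i; exact: Dm.
have m2 : measurable [set w | eps <= `|Y w|].
  by apply: measurable_ge_set; exact: measurableT_comp.
have m3 : measurable [set w | eps <= `|\sum_(i < N) eta i w * dW i w|].
  apply: measurable_ge_set; apply: measurableT_comp => //; apply: measurable_sum => i.
  apply: measurable_funM.
    by apply: (filtration_measurable FF (p_itv (ltnW (ltn_ord i)))); exact: eta_meas.
  exact: (bm_increment_sqr_le (q0 (ltnW (ltn_ord i))) (q_mono (ltn_ord i)) (qT _)).1.
apply: (@le_trans _ _ (P ([set w | delta <= S N w] `|` [set w | eps <= `|Y w|]))).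
  apply: le_measure; rewrite ?inE//; first exact: measurableU.
  move=> w /= h; have [|SN] := leP delta (S N w); [by left|right].
  rewrite /Y (eq_bigr (fun i : 'I_N => eta i w * dW i w))// => i _.
  rewrite /zeta /stop indicE mem_set ?mulr1//=.
  by apply: le_trans (ltW SN); exact: S_mono.
apply: le_trans (measureU2 _ m1 m2) _; rewrite leeD2l//.
have := markov_sqr P mY eps0; move/le_trans; apply.
rewrite mulrC EFinM lee_pmul2l ?lte_fin ?invr_gt0 ?exprn_gt0//.
pose v i := fine ((p i.+1 - p i)%:E * \int[P]_w (zeta i w ^+ 2)%:E)%E.
have vE i : (i < N)%N -> (v i)%:E = ((p i.+1 - p i)%:E * \int[P]_w (zeta i w ^+ 2)%:E)%E.
  move=> iN; rewrite /v fineK// fin_numM//; exact: integrable_fin_num (zeta2_integrable iN).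
have := @expectation_sum_sqr_le _ _ _ P N (fun i w => zeta i w * dW i w) v Dm.
move=> /(_ _ D_cross) h; apply: le_trans (h _) _.
  by move=> i iN; rewrite vE//; exact: D_sqr.
rewrite -sumEFin.
rewrite (eq_bigr (fun i : 'I_N => \int[P]_w (zeta i w ^+ 2 * (p i.+1 - p i))%:E)%E); last first.
  move=> i _; rewrite vE// -integralZl//; last exact: zeta2_integrable.
  by apply: eq_integral => w _; rewrite mulrC.
rewrite -integral_sum//; last first.
  move=> i; under eq_fun do rewrite mulrC EFinM.
  by apply: integrableZl => //; exact: zeta2_integrable.
apply: (@le_trans _ _ (\int[P]_w delta%:E)%E).
  apply: ge0_le_integral => //.
  - move=> w _; apply: sume_ge0 => i _.
    by rewrite lee_fin mulr_ge0 ?sqr_ge0// subr_ge0 p_mono.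
  - apply: emeasurable_sum => i; apply/measurable_EFinP; apply: measurable_funM => //.
    by apply: measurable_funX; exact: zeta_mfun.
  move=> w _; rewrite sumEFin lee_fin (le_trans (zeta_sum_le w (leqnn N)))//.
  by rewrite ge_min lexx orbT.
by rewrite integral_cst//; have := @probability_setT _ _ _ P => /= ->; rewrite mule1.
Qed.

End truncated_isometry.

Section ito_constant.
Context {R : realType} {dd : measure_display} {Omega : measurableType dd}.
Context (P : probability Omega R) (F : R -> set (set Omega)) (T : R).
Hypothesis FF : complete_filtration P F T.
Hypothesis T0 : 0 < T.
Local Notation mu := (@lebesgue_measure R).

Section grid.
Variables (h : simple_process F T) (a : R).
Local Notation m := (sp_size h).
Local Notation u := (sp_time h).

(* The partition of [h] completed by the end points [0] and [T]. *)
Definition grid (i : nat) : R :=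
  match i with 0 => 0 | i'.+1 => if (i' <= m)%N then u i' else T end.

(** The value of [h - a] on the [i]-th of the [m + 2] intervals of [grid]. On the first and the last
    one [h] is zero, which leaves [- a]. *)
Definition grid_val (i : nat) (w : Omega) : R :=
  match i with 0 => - a | i'.+1 => if (i' < m)%N then sp_val h i' w - a else - a end.

Lemma grid_mono i : (i < m.+2)%N -> grid i <= grid i.+1.
Proof.
case: i => [_|i] /=; first exact: sp_time_ge0.
rewrite ltnS leq_eqVlt => /predU1P[[->]|]; first by rewrite leqnn ltnn; exact: sp_time_leT.
by rewrite ltnS => im; rewrite im (ltnW im); exact: sp_time_mono.
Qed.

Lemma gridT : grid m.+2 = T. Proof. by rewrite /= ltnn. Qed.

Lemma grid_ge0 i : (i <= m.+2)%N -> 0 <= grid i.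
Proof. by move=> im; apply: (@mono_le _ m.+2 grid grid_mono 0 i). Qed.

Lemma grid_leT i : (i <= m.+2)%N -> grid i <= T.
Proof. by move=> im; rewrite -gridT; apply: (@mono_le _ m.+2 grid grid_mono i m.+2). Qed.

Lemma grid_val_meas i : (i < m.+2)%N -> measurable_wrt (F (grid i)) (grid_val i).
Proof.
move=> im; have sG : sigma_algebra setT (F (grid i)).
  by apply: (filtration_sigma FF); rewrite grid_ge0 ?grid_leT// ltnW.
case: i im sG => [|i] im sG; first exact: (measurable_wrt_cst sG).
have [im'|im'] := ltnP i m; last first.
  have -> : grid_val i.+1 = fun=> - a by apply/funext => w /=; rewrite ltnNge im'.
  exact: (measurable_wrt_cst sG).
have -> : grid_val i.+1 = fun w => sp_val h i w - a by apply/funext => w /=; rewrite im'.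
apply: (measurable_wrtB sG); last exact: (measurable_wrt_cst sG).
by move=> E mE; rewrite /grid (ltnW im'); exact: sp_val_meas.
Qed.

Lemma grid_val_bounded : exists M : nat -> R, forall i w, (i < m.+2)%N -> `|grid_val i w| <= M i.
Proof.
have bnd i : exists Mi : R, forall w, (i < m.+2)%N -> `|grid_val i w| <= Mi.
  case: i => [|i]; first by exists `|a| => w _ /=; rewrite normrN.
  have [im|im] := ltnP i m; last by exists `|a| => w _; rewrite /= ltnNge im normrN.
  have [Mi Mb] := sp_val_bounded im.
  by exists (Mi + `|a|) => w _; rewrite /= im (le_trans (ler_normB _ _))// lerD2r.
by exists (fun i => sval (cid (bnd i))) => i w; exact: (svalP (cid (bnd i))).
Qed.

(** The constant part telescopes because the completed grid runs from 0 to [T], and capping at [t]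
    turns the last value into [W t]. *)
Lemma grid_sum (W : R -> Omega -> R) t w : 0 <= t <= T ->
  \sum_(i < m.+2) grid_val i w * (W (Num.min t (grid i.+1)) w - W (Num.min t (grid i)) w)
  = sp_integral h W t w - a * (W t w - W 0 w).
Proof.
move=> /andP[t0 tT]; pose q i := W (Num.min t (grid i)) w.
have -> : W t w - W 0 w = \sum_(i < m.+2) (q i.+1 - q i).
  rewrite -(big_mkord xpredT (fun i => q i.+1 - q i)) telescope_sumr// /q gridT.
  by rewrite min_l// /grid min_r.
rewrite mulr_sumr big_ord_recl [X in _ = _ - X]big_ord_recl /=.
rewrite big_ord_recr [X in _ = _ - (_ + X)]big_ord_recr /=.
rewrite /bump /= !add1n leqnn ltnn.
have -> : sp_integral h W t w = \sum_(i < m) sp_val h i w * (q i.+2 - q i.+1).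
  apply: eq_bigr => i _; rewrite /q /grid /=.
  by rewrite (ltn_ord i) (ltnW (ltn_ord i)).
have -> : \sum_(i < m) (if (i < m)%N then sp_val h i w - a else - a) *
    (W (Num.min t (if (i.+1 <= m)%N then u i.+1 else T)) w -
     W (Num.min t (if (i <= m)%N then u i else T)) w) =
   \sum_(i < m) sp_val h i w * (q i.+2 - q i.+1) - \sum_(i < m) a * (q i.+2 - q i.+1).
  rewrite -sumrB; apply: eq_bigr => i _; rewrite /q /grid /=.
  by rewrite (ltn_ord i) (ltnW (ltn_ord i)) mulrBl.
rewrite /q /grid /= leqnn ltnn; ring.
Qed.

Lemma time_mono i j : (i <= j)%N -> (j <= m)%N -> u i <= u j.
Proof. exact: (@mono_le _ m u (@sp_time_mono _ _ _ _ _ h)). Qed.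

Lemma sp_fun_grid i s w : (i < m.+2)%N -> grid i < s <= grid i.+1 ->
  sp_fun h s w - a = grid_val i w.
Proof.
move=> im /andP[is1 is2].
have ind0 (j : 'I_m) : s <= u j \/ u j.+1 < s ->
    sp_val h j w * \1_(`]u j, u j.+1] : set R) s = 0.
  move=> sj; rewrite indicE memNset ?mulr0//= in_itv/= => /andP[a1 a2].
  by case: sj => a3; [rewrite ltNge a3 in a1|rewrite leNgt a3 in a2].
case: i im is1 is2 => [_ /= _ is2|i im].
  rewrite /sp_fun big1 ?sub0r// => j _; apply: ind0; left.
  by apply: le_trans is2 _; apply: time_mono => //; exact: ltnW.
rewrite /grid /grid_val; rewrite ltnS in im; rewrite -ltnS im.
have [im'|mi] := ltnP i m => is1 is2; last first.
  rewrite /sp_fun big1 ?sub0r// => j _; apply: ind0; right.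
  by apply: le_lt_trans is1; apply: time_mono; [apply: leq_trans mi|rewrite -ltnS].
rewrite /sp_fun (bigD1 (Ordinal im'))//= big1 ?addr0.
  by rewrite indicE mem_set ?mulr1//= in_itv/= is1.
move=> j ji; apply: ind0; have [ij|ji'] := ltnP i j.
  by left; apply: le_trans is2 _; apply: time_mono => //; exact: ltnW.
right; apply: le_lt_trans is1; apply: time_mono; last exact: ltnW.
by rewrite ltn_neqAle ji' andbT; apply: contra ji => /eqP ji; apply/eqP/val_inj.
Qed.

Lemma sp_fun_measurable w : measurable_fun setT (fun s => sp_fun h s w).
Proof.
by apply: measurable_sum => i; apply: measurable_funM.
Qed.

(** The integrand is constant on each left-open grid interval, so the intervals are added one by one
    from []0, 0]]; the point 0 missing at the end is negligible. *)
Lemma grid_sqr_integral w :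
  (\int[mu]_(s in `[0%R, T]) ((sp_fun h s w - a) ^+ 2)%:E =
   (\sum_(i < m.+2) grid_val i w ^+ 2 * (grid i.+1 - grid i))%:E)%E.
Proof.
pose G s := (sp_fun h s w - a) ^+ 2.
have mG A : measurable_fun A (EFin \o G).
  apply/measurable_EFinP/measurable_funTS/measurable_funX/measurable_funB => //.
  exact: sp_fun_measurable.
have step k : (k <= m.+2)%N -> (\int[mu]_(s in `]0%R, grid k]) (G s)%:E =
    (\sum_(i < k) grid_val i w ^+ 2 * (grid i.+1 - grid i))%:E)%E.
  elim: k => [_|k ih km]; first by rewrite big_ord0 set_itvoc0 integral_set0.
  have gk := grid_mono km.
  have -> : `]0%R, grid k.+1]%classic = (`]0%R, grid k] `|` `]grid k, grid k.+1])%classic.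
    by rewrite -itv_bndbnd_setU// ?bnd_simp ?grid_ge0// ltnW.
  rewrite ge0_integral_setU//.
  - have -> : \sum_(i < k.+1) grid_val i w ^+ 2 * (grid i.+1 - grid i) =
        \sum_(i < k) grid_val i w ^+ 2 * (grid i.+1 - grid i)
        + grid_val k w ^+ 2 * (grid k.+1 - grid k) by rewrite big_ord_recr.
    rewrite (ih (ltnW km)) [in RHS]EFinD; congr (_ + _)%E.
    rewrite (eq_integral (fun=> (grid_val k w ^+ 2)%:E)); last first.
      by move=> s /set_mem sk; rewrite /G (sp_fun_grid w km sk).
    move: (grid k.+1) gk => g gk.
    rewrite integral_cst//= lebesgue_measure_itv/= lte_fin; case: ltP => // gk'.
    have -> : g = grid k by apply/eqP; rewrite eq_le gk' gk.
    by rewrite subrr mulr0 mule0.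
  - exact: mG.
  - by move=> s _; rewrite lee_fin sqr_ge0.
  - apply/disj_setPS => s /= []; rewrite !in_itv/= => /andP[_ sk] /andP[ks _].
    by rewrite ltNge sk in ks.
have := step _ (leqnn m.+2); rewrite gridT => <-.
by rewrite integral_itv_obnd_cbnd//; exact: mG.
Qed.

End grid.

Variables (W : R -> Omega -> R).
Hypothesis BW : brownian_motion P F T W.

Lemma sp_integral_measurable (h : simple_process F T) t : 0 <= t <= T ->
  measurable_fun setT (sp_integral h W t).
Proof.
move=> /andP[t0 tT]; apply: measurable_sum => i.
have im := ltn_ord i.
have u0 j : (j <= sp_size h)%N -> 0 <= sp_time h j.
  by move=> jm; apply: le_trans (sp_time_ge0 h) _; exact: time_mono.
have uT j : (j <= sp_size h)%N -> sp_time h j <= T.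
  by move=> jm; apply: le_trans (sp_time_leT h); exact: time_mono.
have mW j : (j <= sp_size h)%N -> measurable_fun setT (W (Num.min t (sp_time h j))).
  move=> jm; apply: (adapted_measurable FF (bm_adapted BW)).
  by rewrite le_min t0 u0//= ge_min tT.
apply: measurable_funM; last by apply: measurable_funB; apply: mW => //; exact: ltnW.
apply: (@filtration_measurable _ _ _ P F T FF (sp_time h i)).
  by rewrite u0 ?uT// ltnW.
by move=> E mE; exact: sp_val_meas.
Qed.

(** The tail estimate applied to [h n - a] shows that the approximating integrals also tend to
    [a * (W t - W 0)] in probability. The two limits agree almost surely, whatever the approximating
    sequence. *)
Lemma ito_integral_constant (a : R) I t : ito_integral P F T (fun _ _ => a) W I ->
  0 <= t <= T -> {ae P, forall w, I t w = a * W t w}.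
Proof.
move=> [_ aI _ [h [hL2 hI]]] tT.
have mI := adapted_measurable FF aI tT.
have zT : 0 <= (0 : R) <= T by rewrite lexx ltW.
have mWt := adapted_measurable FF (bm_adapted BW) tT.
have mW0 := adapted_measurable FF (bm_adapted BW) zT.
pose D w := I t w - a * (W t w - W 0 w).
have mD : measurable_fun setT D.
  by apply: measurable_funB => //; apply: measurable_funM => //; exact: measurable_funB.
have D0 (eps : R) : 0 < eps -> P [set w | eps <= `|D w|] = 0%E.
  move=> eps0; apply/eqP; rewrite eq_le measure_ge0 andbT; apply/lee_addgt0Pr => e e0.
  rewrite add0e.
  have eps2 : 0 < eps / 2 by rewrite divr_gt0.
  (* Makes the Chebyshev term [delta / (eps / 2) ^+ 2] equal to [e / 3]. *)
  pose delta := e / 3 * (eps / 2) ^+ 2.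
  have delta0 : 0 < delta by rewrite mulr_gt0 ?exprn_gt0// divr_gt0.
  have e3 : (0 < (e / 3)%:E)%E by rewrite lte_fin divr_gt0.
  have n1 := hI t tT (eps / 2) eps2 _ (open_ereal_lt' e3).
  have n2 := hL2 delta delta0 _ (open_ereal_lt' e3).
  have [n [/= h1 h2]] : exists n, (P [set w | (eps / 2 <= `|sp_integral (h n) W t w - I t w|)%R] < (e / 3)%:E)%E /\
     (P [set w | (delta%:E <= \int[mu]_(s in `[0%R, T]) ((sp_fun (h n) s w - a) ^+ 2)%:E)%E] < (e / 3)%:E)%E.
    near \oo => n; exists n; split; near: n; [exact: n1|exact: n2].
  have [M Mb] := grid_val_bounded (h n) a.
  have tail := @simple_integral_tail R dd Omega P F T FF W BW (sp_size (h n)).+2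
    (grid (h n)) (grid_val (h n) a) M t (lexx 0) (@grid_mono (h n))
    (grid_leT (leqnn _)) (@grid_val_meas (h n) a) Mb tT delta delta0 (eps / 2) eps2.
  have E1 : [set w | delta%:E <= \int[mu]_(s in `[0%R, T]) ((sp_fun (h n) s w - a) ^+ 2)%:E]%E =
     [set w | delta <= \sum_(i < (sp_size (h n)).+2) grid_val (h n) a i w ^+ 2 * (grid (h n) i.+1 - grid (h n) i)].
    by apply/seteqP; split => w /=; rewrite grid_sqr_integral lee_fin.
  rewrite -E1 in tail.
  have E2 : [set w | eps / 2 <= `|\sum_(i < (sp_size (h n)).+2) grid_val (h n) a i w *
      (W (Num.min t (grid (h n) i.+1)) w - W (Num.min t (grid (h n) i)) w)|] =
     [set w | eps / 2 <= `|sp_integral (h n) W t w - a * (W t w - W 0 w)|].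
    by apply/seteqP; split => w /=; rewrite grid_sum.
  rewrite E2 in tail.
  have msp := sp_integral_measurable (h n) tT.
  have m1 : measurable [set w | eps / 2 <= `|sp_integral (h n) W t w - I t w|].
    by apply: measurable_ge_set; apply: measurableT_comp => //; exact: measurable_funB.
  have m2 : measurable [set w | eps / 2 <= `|sp_integral (h n) W t w - a * (W t w - W 0 w)|].
    apply: measurable_ge_set; apply: measurableT_comp => //; apply: measurable_funB => //.
    by apply: measurable_funM => //; exact: measurable_funB.
  apply: (@le_trans _ _ (P ([set w | eps / 2 <= `|sp_integral (h n) W t w - I t w|] `|`
     [set w | eps / 2 <= `|sp_integral (h n) W t w - a * (W t w - W 0 w)|]))).
    apply: le_measure; rewrite ?inE//; [|exact: measurableU|].
      by apply: measurable_ge_set; exact: measurableT_comp.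
    move=> w /= Dw; have [|lt1] := leP (eps / 2) `|sp_integral (h n) W t w - I t w|; first by left.
    right; rewrite leNgt; apply/negP => lt2; move: Dw; apply/negP; rewrite -ltNge.
    rewrite /D -(subrKA (sp_integral (h n) W t w)) (le_lt_trans (ler_normD _ _))//.
    by rewrite [ltRHS]splitr ltrD// distrC.
  apply: le_trans (measureU2 _ m1 m2) _.
  have -> : e = e / 3 + (e / 3 + e / 3) by field.
  rewrite !EFinD leeD ?(ltW h1)//; apply: le_trans tail _; rewrite leeD ?(ltW h2)// lee_fin.
  by rewrite /delta mulfK// gt_eqF// exprn_gt0.
(* The event that [D] is nonzero is covered by the countably many null events on which [|D|] is at
   least [k.+1%:R^-1]. *)
have Dae : {ae P, forall w, D w = 0}.
  have : P.-negligible (\bigcup_k [set w | k.+1%:R^-1 <= `|D w|]).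
    apply: negligible_bigcup => k; exists [set w | k.+1%:R^-1 <= `|D w|]; split => //.
    - by apply: measurable_ge_set; exact: measurableT_comp.
    - by apply: D0; rewrite invr_gt0.
  apply: negligibleS => w /= Dw.
  have Dw0 : 0 < `|D w| by rewrite normr_gt0; apply/eqP.
  exists (Num.truncn `|D w|^-1) => //=.
  rewrite -[leRHS]invrK lef_pV2 ?posrE ?invr_gt0// ltW//.
  exact: truncnS_gt.
have [W0 _ _ _ _] := BW.
apply: filterS2 Dae W0 => w; rewrite /D => Dw W0w.
by apply/eqP; rewrite -subr_eq0 -[X in a * X]subr0 -{1}W0w Dw.
Unshelve. all: by end_near. Qed.

End ito_constant.

(** * Brackets of sampled paths *)

Section compactness.
Context {R : realType}.

Lemma within_continuous_modulus (V : normedModType R) (u : R -> V) (T e : R) :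
  {within `[0, T], continuous u} -> 0 < e ->
  exists2 r : R, 0 < r & forall s t, 0 <= s <= T -> 0 <= t <= T -> `|s - t| < r ->
    `|u s - u t| <= e.
Proof.
move=> cu e0; have e2 : 0 < e / 2 by rewrite divr_gt0.
have /compact_near_coveringP cK : compact `[0, T]%classic by exact: segment_compact.
pose Q (r s : R) := forall t, 0 <= s <= T -> 0 <= t <= T -> `|t - s| < r -> `|u t - u s| <= e.
have h : \forall r \near (0:R)^'+, `[0, T] `<=` Q r.
  apply: cK => s /=; rewrite in_itv/= => sT.
  have /subspace_continuousP/(_ s) := cu; rewrite /= in_itv/= => /(_ sT).
  move=> /cvgrPdist_le/(_ _ e2); rewrite /within/= => /nbhs_normP[r /= r0 hr].
  have r2 : 0 < r / 2 by rewrite divr_gt0.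
  exists (ball s (r / 2), [set x | 0 < x < r / 2]).
    split; first exact: nbhsx_ballx.
    by near=> x; apply/andP; split; near: x; [exact: nbhs_right_gt|exact: nbhs_right_lt].
  move=> [s' x] [/= ss' /andP[x0 xr]] t s'T tT ts'.
  have close v : 0 <= v <= T -> `|s - v| < r -> `|u s - u v| <= e / 2.
    by move=> vT sv; apply: hr => //; rewrite in_itv.
  rewrite -ball_normE/= in ss'.
  have st : `|s - t| < r.
    rewrite -(subrKA s') (le_lt_trans (ler_normD _ _))// [ltRHS]splitr ltrD//.
    by rewrite distrC (lt_trans ts').
  have ss'r : `|s - s'| < r by apply: lt_trans ss' _; rewrite ltr_pdivrMr// ltr_pMr// ltr1n.
  have ut := close t tT st; have us' := close s' s'T ss'r.
  by rewrite distrC in ut; rewrite distrC in us'; exact: dist_le_split ut us'.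
near (0:R)^'+ => r; exists r; first by near: r; exact: nbhs_right_gt.
move=> s t sT tT st; have : `[0, T] `<=` Q r by near: r; exact: h.
by move=> /(_ t); rewrite /= in_itv/= => /(_ tT s tT sT st).
Unshelve. all: by end_near. Qed.

Lemma within_continuous_bounded (u : R -> R) (T : R) :
  {within `[0, T], continuous u} -> exists2 M : R, 0 <= M & forall s, 0 <= s <= T -> `|u s| <= M.
Proof.
move=> cu; have [T0|T0] := leP 0 T; last first.
  by exists 0 => // s /andP[s0 sT]; move: T0; rewrite ltNge (le_trans s0 sT).
have cn : {within `[0, T], continuous (fun s => `|u s|)}.
  by move=> s; apply: continuous_comp (cu s) _; exact: norm_continuous.
have [c _ cmax] := EVT_max T0 cn.
by exists `|u c| => // s sT; apply: cmax; rewrite in_itv.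
Qed.

Context {d : nat}.
Local Notation I := ('I_d + 'I_d)%type.
Implicit Types (x : R -> phase R d) (chi : phase R d -> R).

Lemma within_continuous_phase x (A : set R) :
  (forall j, {within A, continuous (fun s => pcoord j (x s))}) -> {within A, continuous x}.
Proof.
move=> cx; apply/subspace_continuousP => s As; apply/cvgrPdist_le => e e0.
have : \forall t \near within A (nbhs s), forall j : I, `|pcoord j (x s) - pcoord j (x t)| <= e.
  apply: filter_forall => j; have /subspace_continuousP/(_ s As) := cx j.
  by move=> /cvgrPdist_le/(_ _ e0).
apply: filterS => t h; apply: norm_le_coord; first exact: ltW.
by move=> j; rewrite pcoordB.
Qed.

Lemma continuous_path chi x (A : set R) : continuous chi ->
  {within A, continuous x} -> {within A, continuous (chi \o x)}.
Proof. by move=> cchi cx s; apply: continuous_comp (cx s) _; exact: cchi. Qed.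

(** Uniformity is needed in a neighbourhood of the compact image of the path, with [y] off the path:
    the intermediate points of the mean value theorem need not lie on it. *)
Lemma uniform_near_path chi x (T e : R) : continuous chi ->
  {within `[0, T], continuous x} -> 0 < e ->
  exists2 r : R, 0 < r & forall s y, 0 <= s <= T -> `|y - x s| < r ->
    `|chi y - chi (x s)| <= e.
Proof.
move=> cchi cx e0; have e2 : 0 < e / 2 by rewrite divr_gt0.
have /compact_near_coveringP cK : compact (x @` `[0, T]%classic).
  by apply: continuous_compact => //; exact: segment_compact.
pose Q (r : R) (z : phase R d) := forall y, `|y - z| < r -> `|chi y - chi z| <= e.
have h : \forall r \near (0:R)^'+, (x @` `[0, T]%classic) `<=` Q r.
  apply: cK => z _.
  have /cvgrPdist_le/(_ _ e2) := cchi z; move=> /nbhs_normP[r /= r0 hr].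
  have r2 : 0 < r / 2 by rewrite divr_gt0.
  exists (ball z (r / 2), [set t | 0 < t < r / 2]).
    split; first exact: nbhsx_ballx.
    by near=> t; apply/andP; split; near: t; [exact: nbhs_right_gt|exact: nbhs_right_lt].
  move=> [z' t] [/= zz' /andP[t0 tr]] y yz'.
  rewrite -ball_normE/= in zz'.
  have zy : `|z - y| < r.
    rewrite -(subrKA z') (le_lt_trans (ler_normD _ _))// [ltRHS]splitr ltrD//.
    by rewrite distrC (lt_trans yz').
  have zz'r : `|z - z'| < r by apply: lt_trans zz' _; rewrite ltr_pdivrMr// ltr_pMr// ltr1n.
  have c1 := hr y zy; have c2 := hr z' zz'r.
  by rewrite distrC in c1; rewrite distrC in c2; exact: dist_le_split c1 c2.
near (0:R)^'+ => r; exists r; first by near: r; exact: nbhs_right_gt.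
move=> s y sT ys; have : (x @` `[0, T]%classic) `<=` Q r by near: r; exact: h.
by apply => //; exists s => //=; rewrite in_itv.
Unshelve. all: by end_near. Qed.

End compactness.

Section partitions.
Context {R : realType}.
Local Notation mu := (@lebesgue_measure R).
Variables (t : R) (s : seq R).
Hypothesis ps : itv_partition 0 t s.

(** [itv_partition 0 t s] lists only the points after 0. Prepending 0 gives [size s] intervals with
    end points indexed from 0 to [size s]. *)
Definition ppt (s : seq R) (i : nat) : R := nth 0 (0 :: s) i.
Local Notation p := (ppt s).
Local Notation N := (size s).

Lemma ppt0 : p 0 = 0. Proof. by []. Qed.

Lemma pptN : p N = t.
Proof. by have [_ /eqP <-] := ps; rewrite /ppt -nth_last; case: (s) => //=. Qed.

Lemma ppt_lt i : (i < N)%N -> p i < p i.+1.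
Proof. by have [/pathP h _] := ps; move=> iN; exact: (h 0 i iN). Qed.

Lemma ppt_le i j : (i <= j)%N -> (j <= N)%N -> p i <= p j.
Proof.
elim: j => [|j ih]; first by rewrite leqn0 => /eqP ->.
rewrite leq_eqVlt => /predU1P[->//|ij jN].
by apply: le_trans (ltW (ppt_lt jN)); apply: ih => //; exact: ltnW.
Qed.

Lemma ppt_ge0 i : (i <= N)%N -> 0 <= p i.
Proof. by move=> iN; rewrite -ppt0; exact: ppt_le. Qed.

Lemma ppt_let i : (i <= N)%N -> p i <= t.
Proof. by move=> iN; rewrite -pptN; exact: ppt_le. Qed.

Lemma ppt_mesh i : (i < N)%N -> p i.+1 - p i <= mesh 0 s.
Proof.
move=> iN; rewrite /mesh.
exact: (@le_bigmax _ _ _ 0 (fun j : 'I_N => nth 0 s j - nth 0 (0 :: s) j) (Ordinal iN)).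
Qed.

Lemma mesh_ge0 : 0 <= mesh 0 s.
Proof. exact: bigmax_ge_id. Qed.

Lemma sum_ppt : \sum_(i < N) (p i.+1 - p i) = t.
Proof.
by rewrite -(big_mkord xpredT (fun i => p i.+1 - p i)) telescope_sumr// pptN ppt0 subr0.
Qed.

End partitions.

(** Stated for a function [p] instead of a list so as to serve both arbitrary partitions and the
    uniform grids used for adaptedness. *)
Lemma riemann_sum_bound (R : realType) (N : nat) (p : nat -> R) (u : R -> R) (t T e : R) :
  p 0%N = 0 -> p N = t -> (forall i, (i < N)%N -> p i < p i.+1) -> t <= T ->
  {within `[0, T], continuous u} -> 0 <= e ->
  (forall i v, (i < N)%N -> p i <= v <= p i.+1 -> `|u v - u (p i)| <= e) ->
  `|\sum_(i < N) u (p i) * (p i.+1 - p i) - \int[lebesgue_measure]_(v in `[0, t]) u v| <= e * t.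
Proof.
move=> ppt0 pptN ppt_lt tT cu e0 ue.
have ppt_le i j : (i <= j)%N -> (j <= N)%N -> p i <= p j.
  elim: j => [|j ih]; first by rewrite leqn0 => /eqP ->.
  rewrite leq_eqVlt => /predU1P[->//|ij jN].
  by apply: le_trans (ltW (ppt_lt _ jN)); apply: ih => //; exact: ltnW.
have ppt_ge0 i : (i <= N)%N -> 0 <= p i by move=> iN; rewrite -ppt0; exact: ppt_le.
have ppt_let i : (i <= N)%N -> p i <= t by move=> iN; rewrite -pptN; exact: ppt_le.
have iu (a b : R) : 0 <= a -> b <= T -> lebesgue_measure.-integrable `[a, b] (EFin \o u).
  move=> a0 bT; apply: continuous_compact_integrable; first exact: segment_compact.
  by apply: continuous_subspaceW cu => v /=; rewrite !in_itv/= => /andP[av vb];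
    rewrite (le_trans a0)//= (le_trans vb).
have step k : (k <= N)%N ->
   `|\sum_(i < k) u (p i) * (p i.+1 - p i) - \int[lebesgue_measure]_(v in `[0, p k]) u v| <= e * p k.
  elim: k => [_|k ih kN].
    by rewrite big_ord0 ppt0 mulr0 set_itv1 Rintegral_set1 subrr normr0.
  have pk := ppt_lt _ kN.
  have pk0 := ppt_ge0 _ (ltnW kN).
  have pkT : p k.+1 <= T by apply: le_trans tT; exact: ppt_let.
  have E : \int[lebesgue_measure]_(v in `[0, p k.+1]) u v =
      \int[lebesgue_measure]_(v in `[0, p k]) u v + \int[lebesgue_measure]_(v in `[p k, p k.+1]) u v.
    apply/eqP; rewrite addrC -subr_eq; apply/eqP.
    rewrite Rintegral_itvB ?bnd_simp//; [|exact: iu|exact: ltW].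
    by rewrite Rintegral_itv_obnd_cbnd//; apply: (integrableS _ _ _ (iu _ _ pk0 pkT)) => //;
      exact: subset_itv_oc_cc.
  have i1 := iu _ _ pk0 pkT.
  have C : \int[lebesgue_measure]_(v in `[p k, p k.+1]) u (p k) = u (p k) * (p k.+1 - p k).
    by rewrite Rintegral_cst//= lebesgue_measure_itv/= lte_fin pk.
  have ic : lebesgue_measure.-integrable `[p k, p k.+1] (EFin \o (fun=> u (p k))).
    apply: continuous_compact_integrable; first exact: segment_compact.
    by apply: continuous_subspaceT => v; exact: cvg_cst.
  have B : `|u (p k) * (p k.+1 - p k) - \int[lebesgue_measure]_(v in `[p k, p k.+1]) u v| <= e * (p k.+1 - p k).
    rewrite distrC -C -RintegralB//.
    have iB : lebesgue_measure.-integrable `[p k, p k.+1] (EFin \o (fun v => u v - u (p k))).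
      exact: (integrableB _ i1 ic).
    apply: le_trans (le_normr_Rintegral _ iB) _ => //.
    have -> : e * (p k.+1 - p k) = \int[lebesgue_measure]_(v in `[p k, p k.+1]) e.
      by rewrite Rintegral_cst//= lebesgue_measure_itv/= lte_fin pk.
    apply: le_Rintegral => //.
    - exact: (integrable_norm iB).
    - apply: continuous_compact_integrable; first exact: segment_compact.
      by apply: continuous_subspaceT => v; exact: cvg_cst.
    - by move=> v /=; rewrite in_itv/= => vp; exact: ue.
  rewrite big_ord_recr E opprD addrACA (le_trans (ler_normD _ _))//.
  have -> : e * p k.+1 = e * p k + e * (p k.+1 - p k) by ring.
  by rewrite lerD// ih// ltnW.
by have := step N (leqnn N); rewrite pptN.
Qed.

(** * Pathwise estimate of covariation sums *)

Section path_expansion.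
Context {R : realType} {d : nat}.
Local Notation I := ('I_d + 'I_d)%type.
Local Notation mu := (@lebesgue_measure R).

(** Two errors add up: the oscillation of the derivatives, multiplied by the noise, and the drift
    increment [l], multiplied by the derivatives at intermediate points. The latter are at most
    [b j + 1] because [e <= 1]. *)
Lemma increment_expand (psi : phase R d -> R) (c : I -> R) (y z : phase R d)
  (dw e l : R) (b : I -> R) : class_C 1 psi -> 0 <= e <= 1 ->
  (forall j xi, `|xi - y| <= `|z - y| -> `|partial j psi xi - partial j psi y| <= e) ->
  (forall j, `|partial j psi y| <= b j) ->
  (forall j, `|pcoord j (z - y) - c j * dw| <= l) ->
  `|psi z - psi y - (\sum_j partial j psi y * c j) * dw| <=
  e * (\sum_j `|c j|) * `|dw| + (\sum_j (b j + 1)) * l.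
Proof.
move=> C1 /andP[e0 e1] osc bnd lip.
have [xi [xi1 ->]] := MVT_partial y z C1.
rewrite mulr_suml -sumrB mulr_sumr !mulr_suml -big_split/=.
apply: le_trans (ler_norm_sum _ _ _) _; apply: ler_sum => j _.
have o := osc j (xi j) (xi1 j).
have -> : partial j psi (xi j) * pcoord j (z - y) - partial j psi y * c j * dw =
  (partial j psi (xi j) - partial j psi y) * c j * dw
  + partial j psi (xi j) * (pcoord j (z - y) - c j * dw) by ring.
apply: le_trans (ler_normD _ _) _; rewrite !normrM; apply: lerD.
  by rewrite -!mulrA ler_wpM2r// mulr_ge0.
apply: ler_pM => //.
rewrite -(subrK (partial j psi y) (partial j psi (xi j))) addrC.
by apply: le_trans (ler_normD _ _) _; rewrite lerD// (le_trans o).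
Qed.

Variables (psi : phase R d -> R) (c : I -> R) (x : R -> phase R d) (Wp Zp : R -> R).
Variables (L T kappa : R).
Hypothesis T0 : 0 < T.
Hypothesis L0 : 0 <= L.
Hypothesis C1 : class_C 1 psi.
Hypothesis cx : {within `[0, T], continuous x}.
Hypothesis cZ : {within `[0, T], continuous Zp}.
Definition noise_derivative (y : phase R d) : R := \sum_j partial j psi y * c j.
Local Notation phi := noise_derivative.

Lemma continuous_noise_derivative : continuous phi.
Proof.
apply: (@class_C_continuous _ _ 0); apply: class_C_sum => j.
have -> : (fun y => partial j psi y * c j) = fun y => c j * partial j psi y.
  by apply/funext => y; rewrite mulrC.
by apply: class_CZ; exact: class_C_partial.
Qed.

(** Index of the interval of length [T / K] containing [v], closed on the left. The point [v = T]
    gets index [K], whence the [K.+1] blocks in the sums. *)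
Definition block (K : nat) (v : R) : nat := Num.truncn (v * K%:R / T).
Definition dinc (f : R -> R) (s : seq R) (i : nat) : R := f (ppt s i.+1) - f (ppt s i).
Definition defect (s : seq R) (i : nat) : R :=
  dinc Wp s i * dinc Zp s i - kappa * (ppt s i.+1 - ppt s i).
Definition block_defect (K : nat) (s : seq R) (k : nat) : R :=
  \sum_(i < size s) (block K (ppt s i) == k)%:R * defect s i.
Definition sqr_variation (s : seq R) : R :=
  \sum_(i < size s) (dinc Wp s i ^+ 2 + dinc Zp s i ^+ 2).

Lemma block_bounds K v : (0 < K)%N -> 0 <= v <= T ->
  [/\ (block K v <= K)%N, (block K v)%:R * T / K%:R <= v &
      v - (block K v)%:R * T / K%:R < T / K%:R].
Proof.
move=> K0 /andP[v0 vT]; have KR : 0 < K%:R :> R by rewrite ltr0n.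
have w0 : 0 <= v * K%:R / T by rewrite divr_ge0 ?mulr_ge0// ltW.
have /andP[b1 b2] := truncn_itv w0; rewrite -/(block K v) in b1 b2.
have b1' : (block K v)%:R * T <= v * K%:R by rewrite -ler_pdivlMr.
have b2' : v * K%:R < ((block K v)%:R + 1) * T by rewrite natr1 -ltr_pdivrMr.
split.
- rewrite -(ler_nat R) -(ler_pM2r T0) (le_trans b1')// mulrC ler_wpM2l// ltW.
- by rewrite ler_pdivrMr.
- by rewrite ltrBlDr -mulrDl ltr_pdivlMr// mulrDl mul1r addrC in b2' *.
Qed.

(** A statement about one path. [B] bounds the noise derivative along the path and is chosen before
    [e], so that the block defects can be made small relative to it. The remaining path dependence
    of the bound lies in quantities whose expectations are under control. *)
Lemma path_covariation_bound :
  exists2 B : R, 0 <= B & forall e : R, 0 < e -> exists2 del : R, 0 < del &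
  forall t s K, 0 <= t <= T -> itv_partition 0 t s -> mesh 0 s < del -> (0 < K)%N ->
    T / K%:R < del ->
    (forall i j, (i < size s)%N ->
      `|pcoord j (x (ppt s i.+1) - x (ppt s i)) - c j * dinc Wp s i| <=
        L * (ppt s i.+1 - ppt s i)) ->
    `|\sum_(i < size s) dinc (psi \o x) s i * dinc Zp s i
      - kappa * \int[mu]_(v in `[0, t]) phi (x v)| <=
    e * (1 + sqr_variation s) + B * \sum_(k < K.+1) `|block_defect K s k|.
Proof.
have cphix : {within `[0, T], continuous (phi \o x)}.
  exact: continuous_path continuous_noise_derivative cx.
have [B B0 HB] := within_continuous_bounded cphix.
exists B => // e e0.
have cpart j : continuous (partial j psi) by apply: (@class_C_continuous _ _ 0); exact: class_C_partial.
have /choice[b bP] : forall j : I, exists bj : R, 0 <= bj /\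
    forall s, 0 <= s <= T -> `|partial j psi (x s)| <= bj.
  move=> j; have [M M0 HM] := within_continuous_bounded (continuous_path (cpart j) cx).
  by exists M.
pose Cc := \sum_j `|c j|; pose D := \sum_j (b j + 1).
have Cc0 : 0 <= Cc by apply: sumr_ge0.
have D0 : 0 <= D by apply: sumr_ge0 => j _; rewrite addr_ge0//; exact: (bP j).1.
(* Collects the coefficients of [e'] in the error terms: [Cc] and [D * L * T] from [T1], [1] and
   [|kappa| * T] from [T2], and [|kappa| * T] again from [T4]. *)
pose C := Cc + 1 + D * L * T + 2 * `|kappa| * T.
have C0 : 0 < C.
  by rewrite /C -!addrA addrCA ltr_wpDr// ?addr_ge0// ?mulr_ge0// ?(ltW T0)// mulr_ge0.
pose e' := Num.min 1 (e / C).
have e'0 : 0 < e' by rewrite lt_min ltr01 divr_gt0.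
have e'1 : e' <= 1 by rewrite ge_min lexx.
have e'e : e' * C <= e by rewrite -ler_pdivlMr// ge_min lexx orbT.
have /choice[r rP] : forall j : I, exists rj : R, 0 < rj /\ forall s y, 0 <= s <= T ->
    `|y - x s| < rj -> `|partial j psi y - partial j psi (x s)| <= e'.
  by move=> j; have [rj rj0 h] := uniform_near_path (cpart j) cx e'0; exists rj.
pose rm := \big[Num.min/1]_j r j.
have rm0 : 0 < rm by apply: lt_bigmin => // j _; exact: (rP j).1.
have rmr j : rm <= r j by apply: bigmin_le_id || exact: bigmin_inf.
(* Halved because the modulus of [x] is a non-strict bound whereas [rP] asks for a strict one. *)
have rm2 : 0 < rm / 2 by rewrite divr_gt0.
have [r1 r10 H1] := within_continuous_modulus cZ e'0.
have [r2 r20 H2] := within_continuous_modulus cphix e'0.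
have [r3 r30 H3] := within_continuous_modulus cx rm2.
exists (Num.min r1 (Num.min r2 r3)); first by rewrite !lt_min r10 r20.
move=> t s K /andP[t0 tT] ps; rewrite !lt_min => /andP[m1 /andP[m2 m3]] K0 /andP[_ /andP[k2 _]] lip.
set N := size s; pose p := ppt s.
have pT i : (i <= N)%N -> 0 <= p i <= T.
  by move=> iN; rewrite (ppt_ge0 ps iN) (le_trans (ppt_let ps iN)).
have dp0 i : (i < N)%N -> 0 <= p i.+1 - p i by move=> iN; rewrite subr_ge0 ltW// (ppt_lt ps iN).
have dpm i : (i < N)%N -> `|p i.+1 - p i| <= mesh 0 s.
  by move=> iN; rewrite ger0_norm ?dp0// (ppt_mesh iN).
pose Q := sqr_variation s.
have Q0 : 0 <= Q by apply: sumr_ge0 => i _; rewrite addr_ge0// sqr_ge0.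
have WZ i : `|dinc Wp s i * dinc Zp s i| <= dinc Wp s i ^+ 2 + dinc Zp s i ^+ 2.
  exact: normrM_le_sqrD.
(* [y i] is the noise derivative at the left end of the interval, [z k] its frozen value at the left
   end of block [k]. *)
pose y i := phi (x (p i)); pose z k := phi (x (k%:R * T / K%:R)).
(* Linearization error. Its noise part is absorbed by the squared increments, while its drift part
   is small because the increments of [Zp] are at most [e']. *)
have T1 : `|\sum_(i < N) (dinc (psi \o x) s i - y i * dinc Wp s i) * dinc Zp s i| <=
    e' * Cc * Q + D * L * T * e'.
  have TT : \sum_(i < N) D * L * (p i.+1 - p i) * e' <= D * L * T * e'.
    rewrite -mulr_suml ler_wpM2r ?(ltW e'0)// -mulr_sumr (sum_ppt ps) ler_wpM2l//.
    by rewrite mulr_ge0.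
  apply: le_trans (lerD (lexx _) TT); rewrite mulr_sumr -big_split/=.
  apply: le_trans (ler_norm_sum _ _ _) _; apply: ler_sum => i _; have iN := ltn_ord i.
  have inc : `|dinc (psi \o x) s i - y i * dinc Wp s i| <=
     e' * Cc * `|dinc Wp s i| + D * (L * (p i.+1 - p i)).
    apply: increment_expand => //.
    - by rewrite ltW.
    - move=> j xi xij; apply: (rP j).2; first exact/pT/ltnW.
      apply: le_lt_trans xij _; apply: lt_le_trans (rmr j).
      apply: (@le_lt_trans _ _ (rm / 2)); last by rewrite ltr_pdivrMr// ltr_pMr// ltr1n.
      apply: H3; [exact: pT|exact/pT/ltnW|exact: le_lt_trans (dpm i iN) m3].
    - by move=> j; apply: (bP j).2; exact/pT/ltnW.
    - by move=> j; exact: lip.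
  have dz : `|dinc Zp s i| <= e'.
    apply: H1; [exact: pT|exact/pT/ltnW|exact: le_lt_trans (dpm i iN) m1].
  rewrite normrM; apply: le_trans (ler_wpM2r (normr_ge0 _) inc) _.
  rewrite mulrDl; apply: lerD.
    have := WZ i; rewrite normrM => WZi; rewrite -[leLHS]mulrA.
    by apply: ler_wpM2l WZi; rewrite mulr_ge0// ltW.
  rewrite mulrA; apply: ler_wpM2l dz.
  by rewrite mulr_ge0 ?dp0// mulr_ge0.
(* Freezing error: [e'] times the sum of the absolute defects, which the squared increments and
   [|kappa| * T] control. *)
have T2 : `|\sum_(i < N) (y i - z (block K (p i))) * defect s i| <= e' * (Q + `|kappa| * T).
  have kT : \sum_(i < N) `|kappa| * (p i.+1 - p i) <= `|kappa| * T.
    by rewrite -mulr_sumr (sum_ppt ps) ler_wpM2l.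
  apply: le_trans (ler_wpM2l (ltW e'0) (lerD (lexx Q) kT)).
  rewrite -big_split/= mulr_sumr.
  apply: le_trans (ler_norm_sum _ _ _) _; apply: ler_sum => i _; have iN := ltn_ord i.
  rewrite normrM; apply: ler_pM => //.
    have pi := pT i (ltnW iN); have [b1 b2 b3] := block_bounds K0 pi.
    have bT : 0 <= (block K (p i))%:R * T / K%:R <= T.
      rewrite divr_ge0 ?mulr_ge0 ?(ltW T0)//= (le_trans b2)//.
      by case/andP: pi.
    apply: H2 => //; rewrite ger0_norm ?subr_ge0//.
    exact: lt_trans k2.
  apply: le_trans (ler_normB _ _) _; apply: lerD; first exact: WZ.
  by rewrite normrM ler_wpM2l// ger0_norm// dp0.
have T3 : `|\sum_(i < N) z (block K (p i)) * defect s i| <=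
    B * \sum_(k < K.+1) `|block_defect K s k|.
  have -> : \sum_(i < N) z (block K (p i)) * defect s i = \sum_(k < K.+1) z k * block_defect K s k.
    rewrite [RHS](eq_bigr (fun k : 'I_K.+1 => \sum_(i < N) (block K (p i) == k)%:R * (z k * defect s i))); last first.
      by move=> k _; rewrite mulr_sumr; apply: eq_bigr => i _; rewrite mulrCA.
    rewrite exchange_big/=; apply: eq_bigr => i _.
    have [b1 _ _] := block_bounds K0 (pT i (ltnW (ltn_ord i))).
    rewrite (bigD1 (Ordinal (b1 : (block K (p i) < K.+1)%N)))//= eqxx mul1r big1 ?addr0//.
    move=> k ki; rewrite [_ == _](_ : _ = false) ?mul0r//.
    by apply: contraNF ki => /eqP ki; apply/eqP/val_inj.
  rewrite mulr_sumr; apply: le_trans (ler_norm_sum _ _ _) _; apply: ler_sum => k _.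
  rewrite normrM ler_wpM2r//; apply: HB.
  have KR : 0 < K%:R :> R by rewrite ltr0n.
  rewrite divr_ge0 ?mulr_ge0 ?(ltW T0)//= ler_pdivrMr// mulrC ler_wpM2l ?(ltW T0)//.
  by rewrite ler_nat -ltnS.
have T4 : `|kappa * (\sum_(i < N) y i * (p i.+1 - p i)) - kappa * \int[mu]_(v in `[0, t]) phi (x v)| <=
    `|kappa| * (e' * T).
  rewrite -mulrBr normrM ler_wpM2l//.
  apply: (@le_trans _ _ (e' * t)); last by rewrite ler_wpM2l// ltW.
  apply: (@riemann_sum_bound _ N p (phi \o x) t T e') => //.
  - exact: pptN ps.
  - by move=> i iN; rewrite /p; have := ppt_lt ps iN.
  - exact: ltW.
  - move=> i v iN /andP[pv vp]; apply: H2.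
    + have /andP[a1 _] := pT i (ltnW iN); have /andP[_ a2] := pT i.+1 iN.
      by rewrite (le_trans a1 pv) (le_trans vp a2).
    + exact/pT/ltnW.
    rewrite ger0_norm ?subr_ge0//; apply: le_lt_trans m2.
    by apply: le_trans (ppt_mesh iN); rewrite lerD2r.
(* Replaces the product of the two noise increments by the defect plus [kappa] times the interval
   length, the latter producing a Riemann sum. *)
have -> : \sum_(i < size s) dinc (psi \o x) s i * dinc Zp s i =
    \sum_(i < N) (dinc (psi \o x) s i - y i * dinc Wp s i) * dinc Zp s i
    + \sum_(i < N) (y i - z (block K (p i))) * defect s i
    + \sum_(i < N) z (block K (p i)) * defect s i
    + kappa * (\sum_(i < N) y i * (p i.+1 - p i)).
  rewrite mulr_sumr -!big_split/=; apply: eq_bigr => i _.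
  by rewrite /defect -/p; ring.
rewrite -addrA; apply: le_trans (ler_normD _ _) _.
apply: le_trans (lerD (le_trans (ler_normD _ _) (lerD (le_trans (ler_normD _ _) (lerD T1 T2)) T3)) T4) _.
have h : e' * C * (1 + Q) <= e * (1 + Q) by rewrite ler_wpM2r// addr_ge0.
have h2 : e' * Cc * Q + D * L * T * e' + e' * (Q + `|kappa| * T) + `|kappa| * (e' * T) <= e' * C * (1 + Q).
  have -> : e' * C * (1 + Q) = (e' * Cc * Q + D * L * T * e' + e' * (Q + `|kappa| * T) + `|kappa| * (e' * T))
    + e' * (Cc + 1 + (D * L * T + 2 * `|kappa| * T) * Q) by rewrite /C; ring.
  rewrite lerDl mulr_ge0 ?(ltW e'0)// addr_ge0//; first by rewrite addr_ge0.
  by rewrite mulr_ge0// addr_ge0// !mulr_ge0// ltW.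
move: (\sum_(k < K.+1) _) h h2 => S; move: (e' * C * (1 + Q)) => X0 h h2.
rewrite [X in X <= _](_ : _ = (e' * Cc * Q + D * L * T * e' + e' * (Q + `|kappa| * T) + `|kappa| * (e' * T)) + B * S); last by ring.
by rewrite lerD2r (le_trans h2).
Qed.

End path_expansion.

(** * Measurability of continuous functions of a phase-valued variable *)

Section continuous_measurable.
Context {R : realType} {d : nat}.
Local Notation I := ('I_d + 'I_d)%type.

Lemma rat_approx (x r : R) : 0 < r -> exists q : rat, `|x - ratr q| < r.
Proof.
move=> r0; have lt2 : x - r < x + r by lra.
have [q] := rat_in_itvoo lt2; rewrite in_itv/= => /andP[q1 q2].
exists q; move: (ratr q : R) q1 q2 => y q1 q2.
by rewrite ltr_norml; apply/andP; split; lra.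
Qed.

(** Only the coordinates of [X] are known to be measurable. The open set where [phi] exceeds [c] is
    therefore written as a countable union of coordinate boxes with rational centres, enumerated by
    [pickle]. *)
Lemma continuous_phase_measurable dd (O : measurableType dd) (X : O -> phase R d)
  (phi : phase R d -> R) : continuous phi ->
  (forall j, measurable_fun setT (fun w => pcoord j (X w))) ->
  measurable_fun setT (fun w => phi (X w)).
Proof.
move=> cphi mX; apply: (measurability _ (RGenOInfty.measurableE R)).
move=> _ [_ [c ->] <-]; rewrite setTI.
pose box (q : {ffun I -> rat} * nat) : set (phase R d) :=
  [set y | forall j, `|pcoord j y - ratr (q.1 j)| < q.2.+1%:R^-1].
pose good (q : {ffun I -> rat} * nat) := forall y, box q y -> c < phi y.
pose B (k : nat) : set O := if unpickle k is Some q then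
  (if `[< good q >] then (fun w => X w) @^-1` (box q) else set0) else set0.
have -> : (fun w => phi (X w)) @^-1` `]c, +oo[%classic = \bigcup_k B k.
  apply/seteqP; split => w /=; rewrite ?in_itv/= ?andbT.
    move=> cw; have dpos : 0 < phi (X w) - c by rewrite subr_gt0.
    have /cvgrPdist_lt/(_ _ dpos)/nbhs_normP[r /= r0 hr] := cphi (X w).
    (* A box of half-side [n.+1%:R^-1] whose centre is that close to [X w] lies within twice that
       distance of [X w], hence inside the ball of radius [r]. *)
    pose n := Num.truncn (2 / r).
    have n2 : 2 / n.+1%:R < r.
      by rewrite ltr_pdivrMr// mulrC -ltr_pdivrMr// truncnS_gt.
    have /choice[q qP] : forall j : I, exists q : rat, `|pcoord j (X w) - ratr q| < n.+1%:R^-1.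
      move=> j; have n0 : 0 < n.+1%:R^-1 :> R by rewrite invr_gt0.
      exact: rat_approx.
    pose qn : {ffun I -> rat} * nat := ([ffun j => q j], n).
    have gq : good qn.
      move=> y yb; have /hr : `|X w - y| < r.
        apply: le_lt_trans n2; apply: norm_le_coord; first by rewrite divr_ge0.
        move=> j; rewrite pcoordB; have := yb j; rewrite /= ffunE => yj; have xj := qP j.
        rewrite -(subrKA (ratr (q j))) (le_trans (ler_normD _ _))//.
        by rewrite distrC in yj; rewrite mulr_natl mulr2n ltW// ltrD.
      by rewrite /= => /(le_lt_trans (ler_norm _)) h; lra.
    exists (pickle qn) => //; rewrite /B pickleK asboolT//.
    by move=> j; rewrite /= ffunE; exact: qP.
  move=> [k _]; rewrite /B; case: unpickle => // q; case: asboolP => // gq.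
  exact: gq.
apply: bigcupT_measurable => k; rewrite /B; case: unpickle => // q; case: asboolP => // _.
have -> : (fun w => X w) @^-1` box q =
    \bigcap_(j in [set: I]) [set w | `|pcoord j (X w) - ratr (q.1 j)| < q.2.+1%:R^-1].
  by apply/seteqP; split => w /= h j; [move=> _|]; exact: h.
apply: fin_bigcap_measurable => // j _.
have mf : measurable_fun setT (fun w => `|pcoord j (X w) - ratr (q.1 j)|).
  by apply: measurableT_comp => //; exact: measurable_funB.
rewrite (_ : [set w | _] = ~` [set w | q.2.+1%:R^-1 <= `|pcoord j (X w) - ratr (q.1 j)|]).
  by apply: measurableC; exact: measurable_ge_set.
by apply/seteqP; split => w /=; rewrite ltNge => /negP.
Qed.

End continuous_measurable.

(** Cauchy-Schwarz up to the factor 2 that comes with |xy| <= x^2 + y^2. *)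
Lemma sqr_sum_norm_le (R : realDomainType) (m : nat) (a : 'I_m -> R) :
  (\sum_(k < m) `|a k|) ^+ 2 <= 2 * m%:R * \sum_(k < m) a k ^+ 2.
Proof.
rewrite expr2 mulr_suml.
apply: (@le_trans _ _ (\sum_(i < m) \sum_(j < m) (a i ^+ 2 + a j ^+ 2))).
  apply: ler_sum => i _; rewrite mulr_sumr; apply: ler_sum => j _.
  by rewrite -normrM normrM_le_sqrD.
under eq_bigr do rewrite big_split/= sumr_const card_ord.
rewrite big_split/= sumrMnl sumr_const card_ord -mulr2n -[leLHS]mulr_natl.
by rewrite -[in leLHS](mulr_natl _ m) mulrA.
Qed.

(** * Covariation of a function of the state with a Brownian motion *)

Section covariation_noise.
Context {R : realType} {dd : measure_display} {Omega : measurableType dd}.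
Context (P : probability Omega R) (F : R -> set (set Omega)) (T : R).
Hypothesis FF : complete_filtration P F T.
Hypothesis T0 : 0 < T.
Local Notation mu := (@lebesgue_measure R).

(** Completeness of the filtration is what makes an almost sure limit adapted: every subset of the
    set of non-convergence belongs to [F t], and outside it the limit is pointwise. *)
Lemma measurable_wrt_ae_cvg t (X : nat -> Omega -> R) (Y : Omega -> R) : 0 <= t <= T ->
  (forall n, measurable_wrt (F t) (X n)) ->
  {ae P, forall w, X ^~ w @ \oo --> Y w} -> measurable_wrt (F t) Y.
Proof.
move=> tT mX XY; have sG := filtration_sigma FF tT.
pose O := g_sigma_algebraType (F t).
have GE : <<s F t >> = F t by exact: sigma_algebra_id.
have FM (A : set Omega) : F t A -> measurable (A : set O) by rewrite /measurable/= GE.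
have MF (A : set Omega) : measurable (A : set O) -> F t A by rewrite /measurable/= GE.
pose N := ~` [set w | X ^~ w @ \oo --> Y w].
have NN : P.-negligible N by [].
have FN (A : set Omega) : A `<=` N -> F t A.
  by move=> AN; apply: (filtration_negligible FF tT); exact: negligibleS NN.
pose Z n w := X n w * \1_(~` N) w.
have mZ : measurable_wrt (F t) (fun w => Y w * \1_(~` N) w).
  apply: (@measurable_wrt_cvg _ _ _ _ sG Z).
    move=> n; apply: (measurable_wrtM sG); first exact: mX.
    apply/(measurable_wrtP _ sG).
    apply: (@measurable_indic _ O R setT (~` N)); apply: measurableC; apply: FM; exact: FN.
  move=> w; rewrite /Z indicE; have [wN|wN] := pselect (N w).
    by rewrite memNset//= mulr0; under eq_fun do rewrite mulr0; exact: cvg_cst.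
  rewrite mem_set// mulr1; under eq_fun do rewrite mulr1.
  by apply: contrapT.
move=> E mE.
have -> : Y @^-1` E = (((fun w => Y w * \1_(~` N) w) @^-1` E) `\` N) `|` (Y @^-1` E `&` N).
  apply/seteqP; split => w /=.
    move=> Ew; have [wN|wN] := pselect (N w); [by right|left; split => //].
    by rewrite indicE mem_set// mulr1.
  by move=> [[]|[]//]; rewrite indicE => + wN; rewrite mem_set// mulr1.
apply: MF; apply: measurableU.
  apply: measurableD; first by apply: FM; exact: mZ.
  by apply: FM; exact: FN.
by apply: FM; apply: FN => w [].
Qed.

Variable W : R -> Omega -> R.
Hypothesis BW : brownian_motion P F T W.
Context {d : nat}.
Local Notation I := ('I_d + 'I_d)%type.
Variables (X : R -> Omega -> phase R d) (c : I -> R) (A : I -> R -> Omega -> R).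
Hypothesis aX : forall j, adapted F T (fun t w => pcoord j (X t w)).
Hypothesis cX : forall j, as_continuous P T (fun t w => pcoord j (X t w)).
Hypothesis XA : forall j t, 0 <= t <= T ->
  {ae P, forall w, pcoord j (X t w) = A j t w + c j * W t w}.
Hypothesis A_lip : {ae P, forall w, exists2 L : R, 0 <= L & forall j s t,
  0 <= s -> s <= t -> t <= T -> `|A j t w - A j s w| <= L * (t - s)}.

Lemma ae_continuous_path : {ae P, forall w, {within `[0, T], continuous (fun t => X t w)}}.
Proof.
have : {ae P, forall w, forall j : I, {within `[0, T], continuous (fun t => pcoord j (X t w))}}.
  by apply: filter_forall => j; exact: cX.
by apply: filterS => w h; exact: within_continuous_phase.
Qed.

Lemma adapted_continuous (phi : phase R d -> R) t : continuous phi -> 0 <= t <= T ->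
  measurable_wrt (F t) (fun w => phi (X t w)).
Proof.
move=> cphi tT; have sG := filtration_sigma FF tT; apply/(measurable_wrtP _ sG).
apply: continuous_phase_measurable => // j; apply/(measurable_wrtP _ sG).
exact: (adapted_wrt (aX j) tT).
Qed.

(** The integral is an almost sure limit of Riemann sums over uniform grids of [[0, t]], each of
    which uses the state only up to time [t]. *)
Lemma time_integral_adapted (phi : phase R d -> R) : continuous phi ->
  adapted F T (fun t w => \int[mu]_(v in `[0, t]) phi (X v w)).
Proof.
move=> cphi t tT; have sG := filtration_sigma FF tT; have /andP[t0 tT'] := tT.
move: t0; rewrite le_eqVlt => /predU1P[t0|t0].
  have -> : (fun w => \int[mu]_(v in `[0, t]) phi (X v w)) = fun=> 0.
    by apply/funext => w; rewrite -t0 set_itv1 Rintegral_set1.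
  exact: (measurable_wrt_cst sG).
pose p n i : R := i%:R * t / n.+1%:R.
have n0 n : 0 < n.+1%:R :> R by rewrite ltr0n.
have pstep n i : p n i.+1 - p n i = t / n.+1%:R.
  by rewrite /p -[i.+1]addn1 natrD; field; rewrite gt_eqF.
have pT n i : (i <= n.+1)%N -> 0 <= p n i <= t.
  move=> iN; rewrite /p divr_ge0 ?mulr_ge0 ?(ltW t0)//= ler_pdivrMr// mulrC.
  by rewrite ler_wpM2l ?(ltW t0)// ler_nat.
apply: (@measurable_wrt_ae_cvg t (fun n w => \sum_(i < n.+1) phi (X (p n i) w) * (p n i.+1 - p n i))) => //.
  move=> n; apply: (measurable_wrt_sum sG) => i.
  apply: (measurable_wrtM sG); last exact: (measurable_wrt_cst sG).
  have /andP[p0 pt] := pT n i (ltnW (ltn_ord i)).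
  apply: (filtration_leW FF p0 pt tT'); apply: adapted_continuous => //.
  by rewrite p0 (le_trans pt).
apply: filterS ae_continuous_path => w cw.
apply/cvgrPdist_le => e e0.
have et0 : 0 < e / t by rewrite divr_gt0.
have cu := continuous_path cphi cw.
have [r r0 Hr] := within_continuous_modulus cu et0.
near=> n.
rewrite distrC [leRHS](_ : e = e / t * t); last by rewrite divfK// gt_eqF.
apply: (@riemann_sum_bound _ n.+1 (p n) (fun v => phi (X v w)) t T (e / t)) => //.
- by rewrite /p !mul0r.
- by rewrite /p; field; rewrite gt_eqF.
- by move=> i _; rewrite -subr_gt0 pstep divr_gt0.
- exact: ltW.
move=> i v iN /andP[pv vp].
have /andP[p0 pt] := pT n i (ltnW iN); have /andP[_ pt'] := pT n i.+1 iN.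
apply: Hr.
- by rewrite (le_trans p0 pv) (le_trans vp)// (le_trans pt').
- by rewrite p0 (le_trans pt).
rewrite ger0_norm ?subr_ge0//; apply: (@le_lt_trans _ _ (t / n.+1%:R)).
  by rewrite -(pstep n i) lerD2r.
rewrite ltr_pdivrMr// mulrC -ltr_pdivrMr//.
apply: (@lt_le_trans _ _ (Num.truncn (t / r)).+1%:R); first exact: truncnS_gt.
by rewrite ler_nat ltnS; near: n; exact: nbhs_infty_ge.
Unshelve. all: by end_near. Qed.

Lemma time_integral_continuous (phi : phase R d -> R) : continuous phi ->
  as_continuous P T (fun t w => \int[mu]_(v in `[0, t]) phi (X v w)).
Proof.
move=> cphi; apply: filterS ae_continuous_path => w cw.
apply: (@parameterized_integral_continuous _ 0 T (fun v => phi (X v w))); first exact: ltW.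
apply: continuous_compact_integrable; first exact: segment_compact.
exact: (continuous_path cphi cw).
Qed.

Variables (psi : phase R d -> R) (Z : R -> Omega -> R) (kappa Cd : R).
Hypothesis psi_C1 : class_C 1 psi.
Hypothesis BZ : brownian_motion P F T Z.
Hypothesis Cd0 : 0 <= Cd.
Hypothesis OD : orthogonal_defects P T W Z kappa Cd.
Local Notation phi := (noise_derivative psi c).

Section fixed_partition.
Variables (t : R) (s : seq R) (K : nat).
Hypothesis tT : 0 <= t <= T.
Hypothesis ps : itv_partition 0 t s.

Lemma ppt_itv i : (i <= size s)%N -> 0 <= ppt s i <= T.
Proof.
move=> iN; rewrite (ppt_ge0 ps iN) (le_trans (ppt_let ps iN))//.
by case/andP: tT.
Qed.

Lemma measurable_dinc (Y : R -> Omega -> R) i : adapted F T Y -> (i < size s)%N ->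
  measurable_fun setT (fun w => dinc (fun v => Y v w) s i).
Proof.
move=> aY iN; apply: measurable_funB; apply: (adapted_measurable FF aY); apply: ppt_itv => //.
exact: ltnW.
Qed.

Let aW := bm_adapted BW.
Let aZ := bm_adapted BZ.

Lemma measurable_defect i : (i < size s)%N ->
  measurable_fun setT (fun w => defect (fun v => W v w) (fun v => Z v w) kappa s i).
Proof.
move=> iN; apply: measurable_funB => //; apply: measurable_funM; exact: measurable_dinc.
Qed.

Definition blocks w : R :=
  \sum_(k < K.+1) block_defect (fun v => W v w) (fun v => Z v w) T kappa K s k ^+ 2.

Lemma measurable_block k : measurable_fun setT
  (fun w => block_defect (fun v => W v w) (fun v => Z v w) T kappa K s k).
Proof.
apply: measurable_sum => i; apply: measurable_funM => //.
exact: measurable_defect.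
Qed.

(** Orthogonality reduces each block to a sum of second moments, and every interval falls into
    exactly one block. The total is thus at most [Cd] times the sum of the squared lengths,
    independently of [K]. *)
Lemma expectation_blocks : (0 < K)%N ->
  (\int[P]_w (blocks w)%:E <= (Cd * T * mesh 0 s)%:E)%E.
Proof.
move=> K0; have [OD1 OD2] := OD; set N := size s; pose p := ppt s.
have plt i : (i < N)%N -> p i < p i.+1 by move=> iN; rewrite /p; have := ppt_lt ps iN.
have step k : (\int[P]_w (block_defect (fun v => W v w) (fun v => Z v w) T kappa K s k ^+ 2)%:E
    <= (\sum_(i < N) (block T K (p i) == k)%:R * (Cd * (p i.+1 - p i) ^+ 2))%:E)%E.
  apply: (@expectation_sum_sqr_le _ _ _ P N
    (fun i w => (block T K (p i) == k)%:R * defect (fun v => W v w) (fun v => Z v w) kappa s i)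
    (fun i => (block T K (p i) == k)%:R * (Cd * (p i.+1 - p i) ^+ 2))).
  - by move=> i iN; apply: measurable_funM => //; exact: measurable_defect.
  - move=> i iN; have /andP[p0 _] := ppt_itv (ltnW iN); have /andP[_ pT] := ppt_itv (iN : (i.+1 <= N)%N).
    case: (_ == k); last first.
      by under eq_integral do rewrite mul0r expr0n/=; rewrite integral0 mul0r.
    under eq_integral do rewrite mul1r; rewrite mul1r.
    exact: (OD1 _ _ p0 (plt i iN) pT).
  - move=> i j ij jN; have iN := ltn_trans ij jN.
    have /andP[p0 _] := ppt_itv (ltnW iN); have /andP[_ pT] := ppt_itv (jN : (j.+1 <= N)%N).
    case: (block T K (p i) == k); last first.
      by under eq_integral do rewrite !mul0r; rewrite integral0.
    case: (block T K (p j) == k); last first.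
      by under eq_integral do rewrite !mul0r mulr0; rewrite integral0.
    under eq_integral do rewrite !mul1r.
    apply: (OD2 _ _ _ _ p0 (plt i iN) _ (plt j jN) pT).
    by apply: (ppt_le ps) => //; exact: ltnW.
rewrite /blocks; under eq_integral do rewrite -sumEFin.
rewrite ge0_integral_sum//; last 2 first.
- by move=> k; apply/measurable_EFinP/measurable_funX; exact: measurable_block.
- by move=> k w _; rewrite lee_fin sqr_ge0.
apply: (@le_trans _ _ (\sum_(k < K.+1) \sum_(i < N) (block T K (p i) == k)%:R * (Cd * (p i.+1 - p i) ^+ 2))%:E).
  by rewrite -sumEFin; apply: lee_sum => k _; exact: step.
rewrite lee_fin exchange_big/=.
apply: (@le_trans _ _ (\sum_(i < N) Cd * mesh 0 s * (p i.+1 - p i))); last first.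
  rewrite -mulr_sumr (sum_ppt ps) -mulrA mulrCA -mulrA mulrCA ler_wpM2l//.
  by rewrite mulrC ler_wpM2r ?mesh_ge0//; case/andP: tT.
apply: ler_sum => i _; rewrite -mulr_suml.
have [b1 _ _] := block_bounds T0 K0 (ppt_itv (ltnW (ltn_ord i))).
rewrite (bigD1 (Ordinal (b1 : (block T K (p i) < K.+1)%N)))//= eqxx big1 ?addr0 ?mul1r.
  rewrite -mulrA ler_wpM2l// expr2 ler_wpM2r ?subr_ge0 ?(ltW (plt _ _))//.
  exact: ppt_mesh.
move=> k ki; rewrite [_ == _](_ : _ = false)//.
by apply: contraNF ki => /eqP ki; apply/eqP/val_inj.
Qed.

Lemma expectation_sqr_variation :
  (\int[P]_w (sqr_variation (fun v => W v w) (fun v => Z v w) s)%:E = (2 * t)%:E)%E.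
Proof.
rewrite /sqr_variation; under eq_integral do rewrite -sumEFin.
have mY Y i : brownian_motion P F T Y -> (i < size s)%N ->
    measurable_fun setT (fun w => (dinc (fun v => Y v w) s i ^+ 2)%:E).
  move=> BY iN; apply/measurable_EFinP/measurable_funX; apply: measurable_dinc => //.
  exact: bm_adapted BY.
rewrite ge0_integral_sum//; last 2 first.
- move=> i; under eq_fun do rewrite EFinD; apply: emeasurable_funD; exact: mY.
- by move=> i w _; rewrite lee_fin addr_ge0 ?sqr_ge0.
rewrite -[in RHS](sum_ppt ps) mulr_sumr -sumEFin; apply: eq_bigr => i _.
have iN := ltn_ord i.
have /andP[p0 _] := ppt_itv (ltnW iN); have /andP[_ pT] := ppt_itv (iN : (i.+1 <= size s)%N).
under eq_integral do rewrite EFinD.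
rewrite ge0_integralD//; last 4 first.
- by move=> w _; rewrite lee_fin sqr_ge0.
- exact: mY.
- by move=> w _; rewrite lee_fin sqr_ge0.
- exact: mY.
rewrite (bm_increment_sqr FF BW p0 (ppt_lt ps iN) pT) (bm_increment_sqr FF BZ p0 (ppt_lt ps iN) pT).
by rewrite -EFinD mulr_natl mulr2n.
Qed.

End fixed_partition.

(** The number of blocks must grow for freezing to be accurate, yet slowly enough against the mesh
    for the summed block defects to vanish. The choices of [r], [K] and [g] balance these two
    requirements. *)
Lemma covariation_noise : covariation P F T (fun t w => psi (X t w)) Z
  (fun t w => kappa * \int[mu]_(v in `[0, t]) phi (X v w)).
Proof.
have cphi : continuous phi by exact: continuous_noise_derivative.
have cpsi : continuous psi by exact: class_C_continuous psi_C1.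
have mulk : measurable_fun setT (fun x : R => kappa * x) by exact: measurable_funM.
have aV : adapted F T (fun t w => kappa * \int[mu]_(v in `[0, t]) phi (X v w)).
  move=> t tT; apply: (measurable_wrt_comp (filtration_sigma FF tT) mulk).
  exact: time_integral_adapted.
have aZ := bm_adapted BZ; have aW := bm_adapted BW.
split => //.
  apply: filterS (time_integral_continuous cphi) => w h v.
  by apply: cvgM; [exact: cvg_cst|exact: (h v)].
move=> t tT s ps mesh0.
have /andP[t0 tT'] := tT.
(* The added term keeps [m n] positive even for the empty partition of [[0, 0]], whose mesh is 0. *)
pose m n := mesh 0 (s n) + n.+1%:R^-1.
have mesh_pos n : 0 <= mesh 0 (s n) by exact: mesh_ge0.
have ninv n : 0 < n.+1%:R^-1 :> R by rewrite invr_gt0.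
have m0 n : 0 < m n by rewrite ltr_wpDl.
pose r n := Num.sqrt (m n).
have r0 n : 0 < r n by rewrite sqrtr_gt0.
have rr n : r n ^+ 2 = m n by rewrite sqr_sqrtr// ltW.
(* About the inverse square root of [m n]: then [T / K n] tends to zero, and so does [(K n).+1]
   times the mesh. *)
pose K n := (Num.truncn (r n)^-1).+1.
have K0 n : (0 < K n)%N by [].
have KR n : 0 < (K n)%:R :> R by rewrite ltr0n.
have Kr n : (K n)%:R^-1 < r n.
  by rewrite -[ltRHS]invrK ltf_pV2 ?posrE ?invr_gt0// truncnS_gt.
have K1 n : (K n).+1%:R * mesh 0 (s n) <= r n + 2 * r n ^+ 2.
  have h : (K n).+1%:R <= (r n)^-1 + 2.
    have : (Num.truncn (r n)^-1)%:R <= (r n)^-1 by rewrite truncn_le invr_ge0 ltW.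
    by rewrite /K -addn2 natrD lerD2r.
  apply: (@le_trans _ _ (((r n)^-1 + 2) * m n)).
    by apply: ler_pM => //; rewrite /m lerDl ltW.
  by rewrite -rr mulrDl lerD2r expr2 mulKf// gt_eqF.
have r_cvg : r @ \oo --> (0 : R).
  have : m @ \oo --> (0 : R).
    rewrite -[X in _ --> X](addr0 0); apply: cvgD => //.
    exact: cvg_harmonic.
  move=> mc; rewrite -(@sqrtr0 R).
  exact: (cvg_comp _ _ mc (@sqrt_continuous R 0)).
(* Dominates [2 * (K n).+1 * Cd * T * mesh], so that the block part of [Q n] has expectation at most
   1; the final [r n] keeps [g n] positive. *)
pose g n := 2 * (Cd * T) * (r n + 2 * r n ^+ 2) + r n.
have CT0 : 0 <= 2 * (Cd * T) by rewrite mulr_ge0// mulr_ge0// ltW.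
have g0 n : 0 < g n.
  by rewrite ltr_wpDl// mulr_ge0// addr_ge0 ?mulr_ge0 ?sqr_ge0// ltW.
have g_cvg : g @ \oo --> (0 : R).
  have -> : (0 : R) = 2 * (Cd * T) * (0 + 2 * (0 * 0)) + 0 by rewrite !mulr0 !addr0 mulr0.
  apply: cvgD => //; apply: cvgM; first exact: cvg_cst.
  apply: cvgD => //; apply: cvgM; first exact: cvg_cst.
  by under eq_fun do rewrite expr2; exact: cvgM.
pose Wp w v := W v w; pose Zp w v := Z v w.
pose SV n w := sqr_variation (Wp w) (Zp w) (s n).
pose R2 n := 2 * (K n).+1%:R / g n.
have R20 n : 0 <= R2 n by rewrite divr_ge0 ?mulr_ge0// ltW.
pose Q n w := SV n w + R2 n * blocks (s n) (K n) w.
have SV0 n w : 0 <= SV n w by apply: sumr_ge0 => i _; rewrite addr_ge0 ?sqr_ge0.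
have bl0 n w : 0 <= blocks (s n) (K n) w by apply: sumr_ge0 => k _; exact: sqr_ge0.
have mSV n : measurable_fun setT (SV n).
  apply: measurable_sum => i; apply: measurable_funD; apply: measurable_funX.
    exact: (measurable_dinc tT (ps n) aW (ltn_ord i)).
  exact: (measurable_dinc tT (ps n) aZ (ltn_ord i)).
have mbl n : measurable_fun setT (blocks (s n) (K n)).
  by apply: measurable_sum => k; apply: measurable_funX; exact: (measurable_block (K n) tT (ps n)).
have mpsi v : 0 <= v <= T -> measurable_fun setT (fun w => psi (X v w)).
  by move=> vT; apply: (filtration_measurable FF vT); exact: adapted_continuous.
(* [2 * T] bounds the expected squared variation of [W] and [Z] together, and 1 bounds the weighted
   block part. *)
apply: (@cvg_in_prob_random_bound _ _ _ P _ Q (2 * T + 1)).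
- move=> n; apply: measurable_funB; last exact: (adapted_measurable FF aV tT).
  apply: measurable_sum => i; apply: measurable_funM; apply: measurable_funB.
  + exact/mpsi/(ppt_itv tT (ps n) (ltn_ord i)).
  + exact/mpsi/(ppt_itv tT (ps n) (ltnW (ltn_ord i))).
  + exact: (adapted_measurable FF aZ (ppt_itv tT (ps n) (ltn_ord i))).
  + exact: (adapted_measurable FF aZ (ppt_itv tT (ps n) (ltnW (ltn_ord i)))).
- by move=> n; apply: measurable_funD => //; exact: measurable_funM.
- by move=> n w; apply: addr_ge0; [exact: SV0 | apply: mulr_ge0; [exact: R20 | exact: bl0]].
- move=> n; rewrite /Q; under eq_integral do rewrite EFinD.
  rewrite ge0_integralD//; last 4 first.
  + by move=> w _; rewrite lee_fin.
  + exact/measurable_EFinP.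
  + by move=> w _; rewrite lee_fin mulr_ge0.
  + by apply/measurable_EFinP; exact: measurable_funM.
  rewrite EFinD leeD//.
    by rewrite (expectation_sqr_variation tT (ps n)) lee_fin ler_wpM2l.
  under eq_integral do rewrite EFinM.
  rewrite ge0_integralZl//; last 3 first.
  + exact/measurable_EFinP.
  + by move=> w _; rewrite lee_fin.
  + by rewrite lee_fin.
  apply: (@le_trans _ _ ((R2 n)%:E * (Cd * T * mesh 0 (s n))%:E)%E).
    by rewrite lee_wpmul2l ?lee_fin//; exact: (expectation_blocks tT (ps n) (K0 n)).
  rewrite -EFinM lee_fin /R2 mulrAC ler_pdivrMr// mul1r.
  apply: (@le_trans _ _ (2 * (Cd * T) * ((K n).+1%:R * mesh 0 (s n)))).
    by rewrite le_eqVlt; apply/orP; left; apply/eqP; ring.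
  apply: (@le_trans _ _ (2 * (Cd * T) * (r n + 2 * r n ^+ 2))); first by rewrite ler_wpM2l.
  by rewrite lerDl ltW.
(* The decomposition holds almost surely for each time separately. Only the countably many partition
   points occur, so one null set suffices. *)
have XAn : {ae P, forall w, forall n i, (i <= size (s n))%N -> forall j,
    pcoord j (X (ppt (s n) i) w) = A j (ppt (s n) i) w + c j * W (ppt (s n) i) w}.
  apply: ae_foralln => n; apply: ae_foralln => i.
  have [iN|iN] := leqP i (size (s n)); last by apply: aeW => w.
  have : {ae P, forall w, forall j : I,
    pcoord j (X (ppt (s n) i) w) = A j (ppt (s n) i) w + c j * W (ppt (s n) i) w}.
    by apply: filter_forall => j; apply: XA; exact: (ppt_itv tT (ps n) iN).
  by apply: filterS => w h ? j; exact: h.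
have [_ _ cZ _ _] := BZ.
apply: filterS3 XAn A_lip (filterI ae_continuous_path cZ).
move=> w XAw [L L0 Lw] [cxw cZw] e e0.
have [B B0 HB] := @path_covariation_bound _ _ psi c (fun v => X v w) (Wp w) (Zp w) L T kappa
  T0 L0 psi_C1 cxw cZw.
have e20 : 0 < e / 2 by rewrite divr_gt0.
have [del del0 Hdel] := HB _ e20.
have eB0 : 0 < (e / 2) / (B + 1) by rewrite divr_gt0// ltr_wpDl.
have delT0 : 0 < del / T by rewrite divr_gt0.
have sg_cvg : (fun n => Num.sqrt (g n)) @ \oo --> (0 : R).
  by rewrite -(@sqrtr0 R); exact: (cvg_comp _ _ g_cvg (@sqrt_continuous R 0)).
near=> n.
have n1 : mesh 0 (s n) < del.
  rewrite -[ltLHS]ger0_norm//; near: n.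
  by have /cvgr0Pnorm_lt/(_ _ del0) := mesh0.
have n2 : r n < del / T.
  rewrite -[ltLHS]ger0_norm ?ltW//; near: n.
  by have /cvgr0Pnorm_lt/(_ _ delT0) := r_cvg.
have n3 : Num.sqrt (g n) <= (e / 2) / (B + 1).
  rewrite -[leLHS]ger0_norm ?sqrtr_ge0//; near: n.
  by have /cvgr0Pnorm_le/(_ _ eB0) := sg_cvg.
have TK : T / (K n)%:R < del.
  rewrite mulrC -ltr_pdivlMr//; exact: lt_trans (Kr n) n2.
have lip i j : (i < size (s n))%N ->
    `|pcoord j (X (ppt (s n) i.+1) w - X (ppt (s n) i) w) - c j * dinc (Wp w) (s n) i| <=
        L * (ppt (s n) i.+1 - ppt (s n) i).
  move=> iN; rewrite pcoordB XAw// XAw ?(ltnW iN)// /dinc /Wp.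
  rewrite [X in `|X|](_ : _ = A j (ppt (s n) i.+1) w - A j (ppt (s n) i) w); last by ring.
  have /andP[p0 _] := ppt_itv tT (ps n) (ltnW iN).
  have /andP[_ p1] := ppt_itv tT (ps n) (iN : (i.+1 <= size (s n))%N).
  by apply: Lw => //; rewrite ltW//; have := ppt_lt (ps n) iN.
have bound := Hdel t (s n) (K n) tT (ps n) n1 (K0 n) TK lip.
apply: le_trans bound _.
pose G := \sum_(k < (K n).+1) `|block_defect (Wp w) (Zp w) T kappa (K n) (s n) k|.
pose q := Num.sqrt (g n).
have q0 : 0 < q by rewrite sqrtr_gt0.
have qq : q ^+ 2 = g n by rewrite sqr_sqrtr// ltW.
have GQ : G ^+ 2 / g n <= R2 n * blocks (s n) (K n) w.
  by rewrite /R2 [leRHS]mulrAC; apply: ler_wpM2r; [by rewrite invr_ge0 ltW|exact: sqr_sum_norm_le].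
(* This is y <= 1 + y^2 at y = G / q: the vanishing factor [q] is split off, and the rest is charged
   to [Q n]. *)
have Gq : G <= q * (1 + G ^+ 2 / g n).
  rewrite mulrC -ler_pdivrMr// -qq -expr_div_n; move: (G / q) => y.
  by have := sqr_ge0 (y - 1); nra.
have BG : B * G <= e / 2 * (1 + R2 n * blocks (s n) (K n) w).
  apply: (@le_trans _ _ ((B + 1) * (q * (1 + G ^+ 2 / g n)))).
    apply: ler_pM => //; first by apply: sumr_ge0.
    by rewrite lerDl.
  rewrite mulrA; apply: ler_pM.
  - by rewrite mulr_ge0 ?addr_ge0// ltW.
  - by rewrite addr_ge0// divr_ge0 ?sqr_ge0// ltW.
  - by rewrite mulrC -ler_pdivlMr// ltr_wpDl.
  - by rewrite lerD2l.
apply: le_trans (lerD (lexx _) BG) _.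
rewrite /Q -/(SV n w); have := SV0 n w; have := mulr_ge0 (R20 n) (bl0 n w).
by move: (SV n w) (R2 n * _) => a1 a2 h1 h2; nra.
Unshelve. all: by end_near. Qed.

End covariation_noise.

(** * From Ito to Stratonovich form *)

Lemma time_integral_lipschitz (R : realType) (u : R -> R) (T B : R) :
  {within `[0, T], continuous u} -> (forall v, 0 <= v <= T -> `|u v| <= B) ->
  forall s t, 0 <= s -> s <= t -> t <= T ->
  `|\int[lebesgue_measure]_(v in `[0, t]) u v - \int[lebesgue_measure]_(v in `[0, s]) u v|
    <= B * (t - s).
Proof.
move=> cu uB s t s0 st tT.
have iu (a b : R) : 0 <= a -> b <= T -> lebesgue_measure.-integrable `[a, b] (EFin \o u).
  move=> a0 bT; apply: continuous_compact_integrable; first exact: segment_compact.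
  by apply: continuous_subspaceW cu => v /=; rewrite !in_itv/= => /andP[av vb];
    rewrite (le_trans a0)//= (le_trans vb).
have ist := iu _ _ s0 tT.
rewrite Rintegral_itvB ?bnd_simp//; last exact: iu.
rewrite Rintegral_itv_obnd_cbnd//; last first.
  by apply: (integrableS _ _ _ ist) => //; exact: subset_itv_oc_cc.
apply: le_trans (le_normr_Rintegral _ ist) _ => //.
have -> : B * (t - s) = \int[lebesgue_measure]_(v in `[s, t]) B.
  rewrite Rintegral_cst//= lebesgue_measure_itv/= lte_fin; case: ltP => // ts.
  have -> : t = s by apply/eqP; rewrite eq_le ts st.
  by rewrite subrr.
apply: le_Rintegral => //.
- exact: (integrable_norm ist).
- apply: continuous_compact_integrable; first exact: segment_compact.
  by apply: continuous_subspaceT => v; exact: cvg_cst.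
- move=> v /=; rewrite in_itv/= => /andP[sv vt]; apply: uB.
  by rewrite (le_trans s0)// (le_trans vt).
Qed.

Section main.
Context {R : realType} {dd : measure_display} {Omega : measurableType dd}.
Context (P : probability Omega R) (F : R -> set (set Omega)) (T : R).
Hypothesis FF : complete_filtration P F T.
Hypothesis T0 : 0 < T.
Variables W B : R -> Omega -> R.
Hypothesis BW : brownian_motion P F T W.
Hypothesis BB : brownian_motion P F T B.
Hypothesis WB : independent_processes P T W B.
Local Notation mu := (@lebesgue_measure R).
Context {d : nat}.
Local Notation I := ('I_d + 'I_d)%type.
Variables (f g : phase R d -> 'cV[R]_d) (a b : 'cV[R]_d) (x0 : phase R d).
Variables (X : R -> Omega -> phase R d).
Hypothesis f_cont : forall i, continuous (fcomp f i).
Hypothesis g_cont : forall i, continuous (fcomp g i).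
Hypothesis X_P : forall i, solves P F T (ito_integral P F T)
     (fun t w => (X t w).1 i 0) (x0.1 i 0) (fun t w => f (X t w) i 0)
     [:: (fun _ _ => a i 0, W)].
Hypothesis X_Q : forall i, solves P F T (ito_integral P F T)
     (fun t w => (X t w).2 i 0) (x0.2 i 0) (fun t w => g (X t w) i 0)
     [:: (fun _ _ => b i 0, W)].

Definition drift_coord (j : I) : phase R d -> R :=
  match j with inl i => fcomp f i | inr i => fcomp g i end.

Lemma X_solves j : solves P F T (ito_integral P F T) (fun t w => pcoord j (X t w))
  (pcoord j x0) (fun t w => drift_coord j (X t w)) [:: (fun _ _ => pcoord j (a, b), W)].
Proof. by case: j => i; [exact: X_P|exact: X_Q]. Qed.

Lemma drift_coord_continuous j : continuous (drift_coord j).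
Proof. by case: j => i; [exact: f_cont|exact: g_cont]. Qed.

Definition finite_variation_part (j : I) (t : R) (w : Omega) : R :=
  pcoord j x0 + \int[mu]_(v in `[0, t]) drift_coord j (X v w).

Lemma X_adapted j : adapted F T (fun t w => pcoord j (X t w)).
Proof. by have [] := X_solves j. Qed.

Lemma X_as_continuous j : as_continuous P T (fun t w => pcoord j (X t w)).
Proof. by have [] := X_solves j. Qed.

(** Identifying the integral of a constant costs a null set that depends on [t], hence a statement
    for one time at a time. *)
Lemma X_decomposition j t : 0 <= t <= T ->
  {ae P, forall w, pcoord j (X t w) = finite_variation_part j t w + pcoord j (a, b) * W t w}.
Proof.
move=> tT; have [_ _ _ [M [[J [N [hJ hN hM]]] hX]]] := X_solves j.
have J_ae := ito_integral_constant FF T0 BW hJ tT.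
apply: filterS2 hX J_ae => w hXw Jw.
by rewrite (hXw t tT) hM hN addr0 Jw.
Qed.

(** The Lipschitz constant is random: the drift is bounded along each continuous path, and the sum
    of the bounds serves all coordinates at once. *)
Lemma X_lipschitz : {ae P, forall w, exists2 L : R, 0 <= L & forall j s t,
  0 <= s -> s <= t -> t <= T ->
  `|finite_variation_part j t w - finite_variation_part j s w| <= L * (t - s)}.
Proof.
apply: filterS (ae_continuous_path X_as_continuous) => w cw.
have /choice[C CP] : forall j : I, exists Cj : R, 0 <= Cj /\
    forall v, 0 <= v <= T -> `|drift_coord j (X v w)| <= Cj.
  move=> j; have := within_continuous_bounded (continuous_path (@drift_coord_continuous j) cw).
  by move=> [M M0 HM]; exists M.
exists (\sum_j C j); first by apply: sumr_ge0 => j _; exact: (CP j).1.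
move=> j s t s0 st tT; rewrite /finite_variation_part opprD addrACA subrr add0r.
have cj := continuous_path (@drift_coord_continuous j) cw.
apply: le_trans (time_integral_lipschitz cj (CP j).2 s0 st tT) _.
rewrite ler_wpM2r ?subr_ge0// (bigD1 j)//= lerDl.
by apply: sumr_ge0 => l _; exact: (CP l).1.
Qed.

Lemma covariation_W (psi : phase R d -> R) : class_C 1 psi ->
  covariation P F T (fun t w => psi (X t w)) W (fun t w =>
    1 * \int[mu]_(v in `[0, t]) noise_derivative psi (fun j => pcoord j (a, b)) (X v w)).
Proof.
move=> C1.
have C0 : 0 <= 64 * Num.sqrt 2 + 2 :> R by rewrite addr_ge0// mulr_ge0// sqrtr_ge0.
exact: (covariation_noise FF T0 BW X_adapted X_as_continuous X_decomposition X_lipschitz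
  C1 BW C0 (brownian_defects FF BW)).
Qed.

Lemma covariation_B (psi : phase R d -> R) : class_C 1 psi ->
  covariation P F T (fun t w => psi (X t w)) B (fun t w =>
    0 * \int[mu]_(v in `[0, t]) noise_derivative psi (fun j => pcoord j (a, b)) (X v w)).
Proof.
move=> C1.
exact: (covariation_noise FF T0 BW X_adapted X_as_continuous X_decomposition X_lipschitz
  C1 BB ler01 (independent_defects FF BW BB WB)).
Qed.

(** The noise coefficients depend on [X] but not on the unknown [Y], so their brackets are explicit.
    The one with [W] moves half of the noise derivative from the drift into the integral; the one
    with [B] is zero. *)
Lemma ito_to_stratonovich (Y : R -> Omega -> R) (y0 : R) (drift sdrift : R -> Omega -> R)
  (psiW psiB : phase R d -> R) : class_C 1 psiW -> class_C 1 psiB ->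
  (forall t w, drift t w = sdrift t w +
     noise_derivative psiW (fun j => pcoord j (a, b)) (X t w) / 2) ->
  solves P F T (ito_integral P F T) Y y0 drift
    [:: (fun t w => psiW (X t w), W); (fun t w => psiB (X t w), B)] ->
  solves P F T (stratonovich_integral P F T) Y y0 sdrift
    [:: (fun t w => psiW (X t w), W); (fun t w => psiB (X t w), B)].
Proof.
move=> CW CB driftE [aY cY idr [M [[J1 [N1 [hJ1 [J2 [N2 [hJ2 hN2 hN1]]] hM]]] hY]]].
pose phi := noise_derivative psiW (fun j => pcoord j (a, b)).
have cphi : continuous phi by exact: continuous_noise_derivative.
have covW := covariation_W CW; have covB := covariation_B CB.
set VW := (fun (t : R) (w : Omega) => 1 * _) in covW.
set VB := (fun (t : R) (w : Omega) => 0 * _) in covB.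
have idr_phi : {ae P, forall w, mu.-integrable `[0, T] (EFin \o (fun s => phi (X s w)))}.
  apply: filterS (ae_continuous_path X_as_continuous) => w cw.
  apply: continuous_compact_integrable; first exact: segment_compact.
  exact: (continuous_path cphi cw).
have half (A : set R) w : measurable A -> mu.-integrable A (EFin \o (fun s => phi (X s w))) ->
    mu.-integrable A (EFin \o (fun s => phi (X s w) / 2)).
  move=> mA iphi.
  have -> : EFin \o (fun s => phi (X s w) / 2) =
      (fun s => (2^-1)%:E * (EFin \o (fun s => phi (X s w))) s)%E.
    by apply/funext => s /=; rewrite -EFinM mulrC.
  exact: integrableZl.
have sE w : (fun s => sdrift s w) = (fun s => drift s w - phi (X s w) / 2).
  by apply/funext => s; rewrite driftE addrK.
have isd : {ae P, forall w, mu.-integrable `[0, T] (EFin \o (fun s => sdrift s w))}.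
  apply: filterS2 idr idr_phi => w i1 i2; rewrite sE.
  exact: (integrableB _ i1 (half _ _ _ i2)).
split => //.
(* The same Ito integrals as before, each completed by half of its bracket. *)
exists (fun t w => (J1 t w + VW t w / 2) + (J2 t w + VB t w / 2)); split.
  exists (fun t w => J1 t w + VW t w / 2), (fun t w => J2 t w + VB t w / 2); split => //.
    by exists J1, VW.
  exists (fun t w => J2 t w + VB t w / 2), (fun _ _ => 0); split => //.
    by exists J2, VB.
  by move=> t w; rewrite addr0.
apply: filterS3 hY isd idr_phi => w hYw i1 i2 t tT.
have sub : `[0, t]%classic `<=` `[0, T]%classic.
  by move=> v /=; rewrite !in_itv/= => /andP[-> vt]; case/andP: tT => _; exact: le_trans.
have j1 : mu.-integrable `[0, t] (EFin \o (fun s => sdrift s w)).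
  by apply: integrableS i1 => //.
have j2 : mu.-integrable `[0, t] (EFin \o (fun s => phi (X s w))).
  by apply: integrableS i2 => //.
rewrite (hYw t tT) hM hN1 hN2 addr0.
have -> : \int[mu]_(s in `[0, t]) drift s w =
    \int[mu]_(s in `[0, t]) sdrift s w + (\int[mu]_(s in `[0, t]) phi (X s w)) / 2.
  rewrite -RintegralZr// -RintegralD//; last exact: half.
  by apply: eq_Rintegral => s _; rewrite driftE.
rewrite /VW /VB; ring.
Qed.

End main.

Unset Implicit Arguments.
Set Strict Implicit.
Set Printing Implicit Defensive.

Theorem theorem4p4 (R : realType) (dd : measure_display)
  (Omega : measurableType dd) (P : probability Omega R)
  (F : R -> set (set Omega)) (T : R) (W B : R -> Omega -> R)
  (d : nat) (theta : R) (H : phase R d -> R) (f g : phase R d -> 'cV[R]_d)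
  (a b : 'cV[R]_d) (x0 : phase R d) (X U : R -> Omega -> phase R d)
  (T_gt0 : 0 < T)
  (P_complete : measure_is_complete P)
  (F_filtration : complete_filtration P F T)
  (W_brownian : brownian_motion P F T W)
  (B_brownian : brownian_motion P F T B)
  (WB_indep : independent_processes P T W B)
  (theta01 : 0 <= theta <= 1)
  (H_diff : forall x : phase R d, differentiable H x)
  (f_def : forall x, f x = - gradQ H x)
  (g_def : forall x, g x = gradP H x)
  (f_lip : lipschitz f) (g_lip : lipschitz g)
  (f_C4 : forall i, class_C 4 (fcomp f i))
  (g_C4 : forall i, class_C 4 (fcomp g i))
  (f_growth : forall k, (2 <= k <= 4)%N -> deriv_poly_growth k f)
  (g_growth : forall k, (2 <= k <= 4)%N -> deriv_poly_growth k g)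
  (X_P : forall i, solves P F T (ito_integral P F T)
     (fun t w => (X t w).1 i 0) (x0.1 i 0) (fun t w => f (X t w) i 0)
     [:: (fun _ _ => a i 0, W)])
  (X_Q : forall i, solves P F T (ito_integral P F T)
     (fun t w => (X t w).2 i 0) (x0.2 i 0) (fun t w => g (X t w) i 0)
     [:: (fun _ _ => b i 0, W)])
  (U_P : forall i, solves P F T (ito_integral P F T)
     (fun t w => (U t w).1 i 0) 0
     (fun t w => ito_drift theta f g a b (fcomp f i) (X t w) (U t w))
     [:: (fun t w => ito_diffW theta a b (fcomp f i) (X t w), W);
         (fun t w => ito_diffB a b (fcomp f i) (X t w), B)])
  (U_Q : forall i, solves P F T (ito_integral P F T)
     (fun t w => (U t w).2 i 0) 0
     (fun t w => ito_drift theta f g a b (fcomp g i) (X t w) (U t w))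
     [:: (fun t w => ito_diffW theta a b (fcomp g i) (X t w), W);
         (fun t w => ito_diffB a b (fcomp g i) (X t w), B)]) :
  let H0 := ham0 theta f g a b in
  let H1 := ham1 theta f g a b in
  let H2 := ham2 f g a b in
  (forall i, solves P F T (stratonovich_integral P F T)
     (fun t w => (U t w).1 i 0) 0
     (fun t w => - gradQ (H0 (X t w)) (U t w) i 0)
     [:: (fun t w => - gradQ (H1 (X t w)) (U t w) i 0, W);
         (fun t w => - gradQ (H2 (X t w)) (U t w) i 0, B)]) /\
  (forall i, solves P F T (stratonovich_integral P F T)
     (fun t w => (U t w).2 i 0) 0
     (fun t w => gradP (H0 (X t w)) (U t w) i 0)
     [:: (fun t w => gradP (H1 (X t w)) (U t w) i 0, W);
         (fun t w => gradP (H2 (X t w)) (U t w) i 0, B)]).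

Proof.
have fC1 i : class_C 1 (fcomp f i) by do 3 apply: class_CW; exact: f_C4.
have gC1 i : class_C 1 (fcomp g i) by do 3 apply: class_CW; exact: g_C4.
have fc i : continuous (fcomp f i) by exact: class_C_continuous (fC1 i).
have gc i : continuous (fcomp g i) by exact: class_C_continuous (gC1 i).
have fC2 i : class_C 2 (fcomp f i) by do 2 apply: class_CW; exact: f_C4.
have gC2 i : class_C 2 (fcomp g i) by do 2 apply: class_CW; exact: g_C4.
move=> H0 H1 H2; split => i.
(* [H1] and [H2] are linear in [u]: their gradients do not involve [U] and are exactly the Ito
   coefficients, so that only the drift changes. *)
- have -> : (fun (t : R) (w : Omega) => - gradQ (H1 (X t w)) (U t w) i 0) =
      (fun t w => ito_diffW theta a b (fcomp f i) (X t w)).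
    by apply/funext => t; apply/funext => w; exact: gradQ_ham1.
  have -> : (fun (t : R) (w : Omega) => - gradQ (H2 (X t w)) (U t w) i 0) =
      (fun t w => ito_diffB a b (fcomp f i) (X t w)).
    by apply/funext => t; apply/funext => w; exact: gradQ_ham2.
  apply: (ito_to_stratonovich F_filtration T_gt0 W_brownian B_brownian WB_indep fc gc X_P X_Q _ _ _ (U_P i)).
  + exact: class_C_ito_diffW (fC2 i).
  + exact: class_C_ito_diffB (fC2 i).
  + move=> t w; rewrite (ito_drift_f theta a b H_diff f_def g_def fC1 gC1).
    by rewrite /noise_derivative (ito_diffW_derivative theta a b _ (fC2 i)).
- have -> : (fun (t : R) (w : Omega) => gradP (H1 (X t w)) (U t w) i 0) =
      (fun t w => ito_diffW theta a b (fcomp g i) (X t w)).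
    by apply/funext => t; apply/funext => w; exact: gradP_ham1.
  have -> : (fun (t : R) (w : Omega) => gradP (H2 (X t w)) (U t w) i 0) =
      (fun t w => ito_diffB a b (fcomp g i) (X t w)).
    by apply/funext => t; apply/funext => w; exact: gradP_ham2.
  apply: (ito_to_stratonovich F_filtration T_gt0 W_brownian B_brownian WB_indep fc gc X_P X_Q _ _ _ (U_Q i)).
  + exact: class_C_ito_diffW (gC2 i).
  + exact: class_C_ito_diffB (gC2 i).
  + move=> t w; rewrite (ito_drift_g theta a b H_diff f_def g_def fC1 gC1).
    by rewrite /noise_derivative (ito_diffW_derivative theta a b _ (gC2 i)).
Qed.
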